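(* Let $k$ be a field of characteristic $0$, $V$ a finite-dimensional $k$-vector space, and $g\in S^2(V)\subset V\otimes V$ of signature $(-1,1,\dots,1)$. Let $(L(V),\delta_g,\varphi_g)$ be the Pohlmeyer–Rehren quasi-Lie bialgebra on the free Lie algebra $L(V)$: $\delta_g(x)=[g,x\otimes1-1\otimes x]$ for $x\in V$ and $\varphi_g=-[g^{12},g^{13}]+[g^{12},g^{23}]-[g^{13},g^{23}]$. Let $\alpha,\beta\in k$. Let $\Delta=\Delta_0+h\Delta_1+h^2\Delta_2+O(h^3)$ be the algebra morphism given on generators $x\in V$ by $\Delta_0(x)=x\otimes1+1\otimes x$, $\Delta_1(x)=[g,x\otimes1]$ and \begin{align*} \Delta_2(x)=\ & \alpha\, g^2x_1-\tfrac12\, g x_1 g+\left(\tfrac12-\alpha\right)x_1g^2\\ &+\left(\tfrac12-\alpha\right)(\mathrm{id}\otimes\tau)(g^2x_1)-\tfrac12(\mathrm{id}\otimes\tau)(gx_1g)+\alpha(\mathrm{id}\otimes\tau)(x_1g^2)\\ &+\left(\beta-\tfrac12\right)g^2x_2+\tfrac12\, gx_2g-\beta\, x_2g^2\\ &+\left(\tfrac12-\beta\right)(\tau\otimes\mathrm{id})(g^2x_2)-\tfrac12(\tau\otimes\mathrm{id})(gx_2g)+\beta(\tau\otimes\mathrm{id})(x_2g^2), \end{align*} and let $\Phi=1\otimes1\otimes1-\tfrac12h^2[g^{12},g^{13}]+O(h^3)$. Then $(T(V)[[h]],\mu_0,\Delta,\Phi)$, with $\mu_0$ the undeformed multiplication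 of $T(V)$, is a quantization of $(L(V),\delta_g,\varphi_g)$ modulo $h^3$.
   Context: $T(V)=U(L(V))$ is the tensor algebra with counit $\varepsilon_0$, $\varepsilon_0(V)=0$ (unit and counit are not deformed). Signature $(-1,1,\dots,1)$ means that $g=-e_0\otimes e_0+\sum_{i\ge1}e_i\otimes e_i$ for some basis $(e_i)$ of $V$. Products and commutators are taken in $T(V)^{\otimes n}$; $x_1=x\otimes1$, $x_2=1\otimes x$; $g^{ij}$ is $g$ placed in tensor factors $i,j$. $\tau$ is the linear map on the degree-two part of $T(V)$ reversing products: $\tau(ab)=ba$ for $a,b\in V$. (Thus, writing $g=\sum_a e_a\otimes e'_a$, $(\mathrm{id}\otimes\tau)(g x_1 g)=\sum_{a,c} e_a x e_c\otimes e'_c e'_a$, etc.) $\operatorname{cp}$ is the sum over cyclic permutations of three tensor factors; $\operatorname{Alt}$ is the unnormalized alternating sum over all permutations of tensor factors. A quasi-Lie bialgebra $(\mathfrak g,\delta,\varphi)$ is a Lie algebra with a $1$-cocycle $\delta:\mathfrak g\to\bigwedge^2\mathfrak g$ (i.e. $\delta([x,y])=[x\otimes1+1\otimes x,\delta(y)]-[y\otimes 1+1\otimes y,\delta(x)]$) and $\varphi\in\bigwedge^3\mathfrak g$ such that $\operatorname{cp}(\delta\otimes\mathrm{id})\delta(x)=[x\otimes1\otimes1+1\otimes x\otimes1+1\otimes1\otimes x,\varphi]$ for all $x$ and $\operatorname{Alt}(\delta\otimes\mathrm{id}\otimes\mathrm{id})(\varphi)=0$. A $1$-cocycle on $L(V)$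 is determined by its values on $V$. A quasi-Hopf algebra $(A,\mu,\Delta,\Phi)$ is a unital associative algebra with algebra morphisms $\Delta:A\to A\otimes A$ and $\varepsilon:A\to$ (ground ring), and an invertible $\Phi\in A^{\otimes3}$ such that $(\mathrm{id}\otimes\Delta)\Delta(x)\,\Phi=\Phi\,(\Delta\otimes\mathrm{id})\Delta(x)$ for all $x$; $(\varepsilon\otimes\mathrm{id})\Delta=(\mathrm{id}\otimes\varepsilon)\Delta=\mathrm{id}$; $(\mathrm{id}\otimes\varepsilon\otimes\mathrm{id})(\Phi)=1\otimes1$; the pentagon $\Phi^{1,2,34}\Phi^{12,3,4}=\Phi^{2,3,4}\Phi^{1,23,4}\Phi^{1,2,3}$ holds (where $\Phi^{1,2,34}=(\mathrm{id}\otimes\mathrm{id}\otimes\Delta)(\Phi)$, $\Phi^{12,3,4}=(\Delta\otimes\mathrm{id}\otimes\mathrm{id})(\Phi)$, $\Phi^{1,23,4}=(\mathrm{id}\otimes\Delta\otimes\mathrm{id})(\Phi)$, $\Phi^{2,3,4}=1\otimes\Phi$, $\Phi^{1,2,3}=\Phi\otimes1$); and there is a quasi-antipode: an anti-automorphism $S$ of $A$ and elements $a,b\in A$ with $\sum S(x_{(1)})a x_{(2)}=\varepsilon(x)a$, $\sum x_{(1)}b S(x_{(2)})=\varepsilon(x)b$ (with $\Delta(x)=\sum x_{(1)}\otimes x_{(2)}$), $\sum_i X_ib S(Y_i)a Z_i=1$ and $\sum_j S(P_j)a Q_jb S(R_j)=1$, where $\Phi=\sum_i X_i\otimes Y_i\otimes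 Z_i$ and $\Phi^{-1}=\sum_j P_j\otimes Q_j\otimes R_j$. ''Quantization of $(\mathfrak g,\delta,\varphi)$ modulo $h^3$'' means that the quasi-Hopf algebra axioms hold modulo $h^3$ (i.e. one has a quasi-Hopf algebra over $k[[h]]/(h^3)$), that it reduces modulo $h$ to $(U(\mathfrak g),\mu_0,\Delta_0,1\otimes1\otimes1)$ with $\Phi\equiv1\otimes1\otimes1\bmod h^2$, and that $\delta(x)\equiv(\Delta(x)-\Delta(x)^{21})/h\bmod h$ for $x\in\mathfrak g$ and $\varphi\equiv(\operatorname{Alt}\Phi)/h^2\bmod h$. *)

(* Defs.v *)
From HB Require Import structures.
From mathcomp Require Import all_boot all_algebra perm.
From mathcomp Require Import finmap.
From mathcomp.multinomials Require Import monalg.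

Set Implicit Arguments.
Unset Strict Implicit.
Unset Printing Implicit Defensive.

Import GRing.Theory.
Local Open Scope ring_scope.

(** * Tensor powers of a monoid algebra

  The algebra A = K[M] of a (noncommutative) monoid M over a commutative ring K
  is free as a K-module with basis M, so its m-th tensor power over K is
  K[M ^ m], where (w_0, ..., w_(m-1)) stands for w_0 ⊗ ... ⊗ w_(m-1) and M ^ m
  has the componentwise product.  A itself is [tpow K M 1], the ground ring is
  [tpow K M 0], and [tpow K M (1 + 2)], [tpow K M (2 + 1)], [tpow K M 3] are
  convertible, so that no associativity isomorphism has to be written. *)

Section PowerMonoid.
Variables (m : nat) (M : monomType).
Implicit Types w z : {ffun 'I_m -> M}.

Definition wone : {ffun 'I_m -> M} := [ffun=> mone].
Definition wmul w z : {ffun 'I_m -> M} := [ffun i => mmul (w i) (z i)].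

Fact wmulA : associative wmul.
Proof. by move=> x y z; apply/ffunP=> i; rewrite !ffunE mulmA. Qed.

Fact wmul1 : left_id wone wmul.
Proof. by move=> x; apply/ffunP=> i; rewrite !ffunE mul1m. Qed.

Fact wmulw1 : right_id wone wmul.
Proof. by move=> x; apply/ffunP=> i; rewrite !ffunE mulm1. Qed.

Fact wmul_eq1 w z : wmul w z = wone -> w = wone /\ z = wone.
Proof.
move/ffunP=> wz; split; apply/ffunP=> i; have := wz i; rewrite !ffunE.
  by case/unitm.
by case/unitm.
Qed.

HB.instance Definition _ := Choice_isMonomialDef.Build {ffun 'I_m -> M}
  wmulA wmul1 wmulw1 wmul_eq1.

End PowerMonoid.

Notation tpow K M m := {malg K[{ffun 'I_m -> M}]}.

(* The K-linear map K[W] -> B with value f on the basis W. *)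
HB.lock Definition mlin (K : comNzRingType) (W : choiceType) (B : lmodType K)
    (f : W -> B) (u : {malg K[W]}) : B :=
  \sum_(w <- msupp u) u@_w *: f w.

Section LinearExtension.
Variables (K : comNzRingType) (W : choiceType) (B : lmodType K) (f : W -> B).
Local Notation mlin := (mlin f).

Lemma mlinEw (d : {fset W}) u : (msupp u `<=` d)%fset ->
  mlin u = \sum_(w <- d) u@_w *: f w.
Proof.
move=> le_ud; rewrite mlin.unlock (big_fset_incl _ le_ud) //=.
by move=> w _ /mcoeff_outdom ->; rewrite scale0r.
Qed.

Fact mlin_is_linear : linear mlin.
Proof.
move=> c u v; set d := (msupp (c *: u + v) `|` msupp u `|` msupp v)%fset.
rewrite !(@mlinEw d) /d ?fsubsetUr //; last first.
- by rewrite -fsetUA fsubsetUl.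
- by rewrite fsetUAC fsubsetUr.
rewrite scaler_sumr -big_split; apply: eq_bigr => w _ /=.
by rewrite mcoeffD mcoeffZ scalerDl scalerA.
Qed.

HB.instance Definition _ :=
  GRing.isLinear.Build K {malg K[W]} B *:%R mlin mlin_is_linear.

Lemma mlinU w : mlin << w >> = f w.
Proof.
by rewrite (@mlinEw [fset w]%fset) ?msuppU_le // big_seq_fset1 mcoeffUU scale1r.
Qed.

Lemma mlin_unique (F : {linear {malg K[W]} -> B}) :
  (forall w, F << w >> = f w) -> F =1 mlin.
Proof.
move=> FU u; rewrite mlin.unlock {1}[u]monalgE linear_sum; apply: eq_bigr => w _ /=.
rewrite -FU -linearZ; congr (F _); apply/malgP => w'.
by rewrite mcoeffZ !mcoeffU mulr_natr.
Qed.

End LinearExtension.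

(* Change of coefficients along f, which has to map 0 to 0. *)
Definition tcoef (R S : nzRingType) (W : choiceType) (f : R -> S)
  (u : {malg R[W]}) : {malg S[W]} := \sum_(w <- msupp u) << f u@_w *g w >>.

Definition lie (R : pzRingType) (x y : R) : R := x * y - y * x.

Inductive lspan (K : pzRingType) (B : lmodType K) (P : B -> Prop) : B -> Prop :=
| lspan0 : lspan P 0
| lspanD c u v : P u -> lspan P v -> lspan P (c *: u + v).

Section TensorOperations.
Variables (K : comNzRingType) (M : monomType).

Definition wcat p q (w : {ffun 'I_p -> M}) (z : {ffun 'I_q -> M}) :
    {ffun 'I_(p + q) -> M} :=
  [ffun i => match split i with inl j => w j | inr j => z j end].
Definition wleft p q (w : {ffun 'I_(p + q) -> M}) : {ffun 'I_p -> M} :=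
  [ffun i => w (lshift q i)].
Definition wright p q (w : {ffun 'I_(p + q) -> M}) : {ffun 'I_q -> M} :=
  [ffun i => w (rshift p i)].

Definition tens p q (u : tpow K M p) (v : tpow K M q) : tpow K M (p + q) :=
  mlin (fun w : {ffun 'I_p -> M} =>
    mlin (fun z : {ffun 'I_q -> M} => << wcat w z >>) v) u.

(* f ⊗ g, for K-linear maps f and g. *)
Definition tmap p p' q q' (f : tpow K M p -> tpow K M p')
    (g : tpow K M q -> tpow K M q') :
    tpow K M (p + q) -> tpow K M (p' + q') :=
  mlin (fun w : {ffun 'I_(p + q) -> M} =>
    tens (f << wleft w >>) (g << wright w >>)).

(* The i-th tensor factor of a basis element, as an element of A. *)
Definition factor m (w : {ffun 'I_m -> M}) (i : 'I_m) : tpow K M 1 :=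
  << [ffun=> w i] >>.

Definition tshuffle m (s : 'I_m -> 'I_m) (u : tpow K M m) : tpow K M m :=
  mlin (fun w : {ffun 'I_m -> M} => << [ffun i => w (s i)] >>) u.

(* u^{21} *)
Definition flip (u : tpow K M 2) : tpow K M 2 := tshuffle (@rev_ord 2) u.

(* Sum over the cyclic permutations; addition in 'I_3 is modulo 3. *)
Definition cp (u : tpow K M 3) : tpow K M 3 :=
  \sum_(j : 'I_3) tshuffle (fun i => i + j) u.

Definition Alt m (u : tpow K M m) : tpow K M m :=
  \sum_(s : 'S_m) (-1) ^+ (odd_perm s) *: tshuffle s u.

(* u^{ij}; tensor factors are numbered from 0. *)
Definition place m (i j : 'I_m) (u : tpow K M 2) : tpow K M m :=
  mlin (fun w : {ffun 'I_2 -> M} => << [ffun l => if l == i then w ord0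
                                     else if l == j then w ord_max
                                     else mone] >>) u.

End TensorOperations.

Notation "u \ot v" := (tens u v) (at level 38, left associativity).
Notation "f \otf g" := (tmap f g) (at level 38, left associativity).

(** * Quasi-Lie bialgebras and quasi-Hopf algebras *)

Section QuasiStructures.
Variables (K : comNzRingType) (M : monomType).
Local Notation A := (tpow K M 1).
Local Notation idA := (@idfun A).

Definition prim2 (x : A) : tpow K M 2 := x \ot (1 : A) + (1 : A) \ot x.
Definition prim3 (x : A) : tpow K M 3 :=
  x \ot (1 : A) \ot (1 : A) + (1 : A) \ot x \ot (1 : A)
  + (1 : A) \ot (1 : A) \ot x.

Definition Lie_subalgebra (L : A -> Prop) : Prop :=
  [/\ L 0, forall c x y, L x -> L y -> L (c *: x + y) &
      forall x y, L x -> L y -> L (lie x y)].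

(* The antisymmetric tensors on L (K is a field of characteristic 0). *)
Definition wedge2 (L : A -> Prop) : tpow K M 2 -> Prop :=
  lspan (fun t => exists x y, [/\ L x, L y & t = Alt (x \ot y)]).
Definition wedge3 (L : A -> Prop) : tpow K M 3 -> Prop :=
  lspan (fun t => exists x y z, [/\ L x, L y, L z & t = Alt (x \ot y \ot z)]).

(* The Lie algebra is a Lie subalgebra L of A.  The cobracket is the restriction
   of delta to L; delta is required to be linear on all of A because
   (delta ⊗ id), which is applied to tensors on L only, is computed in A ⊗ A. *)
Record quasi_Lie_bialgebra (L : A -> Prop) (delta : A -> tpow K M 2)
    (phi : tpow K M 3) : Prop := QuasiLieBialgebra {
  qL_Lie : Lie_subalgebra L;
  qL_linear : linear delta;
  qL_wedge2 : forall x, L x -> wedge2 L (delta x);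
  qL_cocycle : forall x y, L x -> L y ->
    delta (lie x y) = lie (prim2 x) (delta y) - lie (prim2 y) (delta x);
  qL_wedge3 : wedge3 L phi;
  qL_coJacobi : forall x, L x ->
    cp ((delta \otf idA) (delta x)) = lie (prim3 x) phi;
  qL_Alt : Alt ((delta \otf idA \otf idA) phi) = 0
}.

(* In antipode_Phi and antipode_Phi_inv, the argument of [mlin] is the value of
   the K-linear map A ⊗ A ⊗ A -> A on X ⊗ Y ⊗ Z. *)
Record quasi_antipode (Delta : A -> tpow K M 2) (eps : A -> K)
    (Phi Phi_inv : tpow K M 3) (S : A -> A) (a b : A) : Prop := QuasiAntipode {
  antipode_linear : linear S;
  antipode_bij : bijective S;
  antipode_1 : S 1 = 1;
  antipode_anti : forall x y, S (x * y) = S y * S x;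
  antipode_left : forall x,
    mlin (fun w : {ffun 'I_2 -> M} => S (factor K w 0) * a * factor K w 1)
      (Delta x) = eps x *: a;
  antipode_right : forall x,
    mlin (fun w : {ffun 'I_2 -> M} => factor K w 0 * b * S (factor K w 1))
      (Delta x) = eps x *: b;
  antipode_Phi :
    mlin (fun w : {ffun 'I_3 -> M} =>
      factor K w 0 * b * S (factor K w 1) * a * factor K w 2) Phi = 1;
  antipode_Phi_inv :
    mlin (fun w : {ffun 'I_3 -> M} =>
      S (factor K w 0) * a * factor K w 1 * b * S (factor K w 2)) Phi_inv = 1
}.

(* eps with values in A^{⊗0}. *)
Definition eps_scalar (eps : A -> K) (x : A) : tpow K M 0 := (eps x)%:MP.

Record quasi_Hopf (Delta : A -> tpow K M 2) (eps : A -> K) (Phi : tpow K M 3) :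
    Prop := QuasiHopf {
  qH_Delta_linear : linear Delta;
  qH_Delta_monoid : monoid_morphism Delta;
  qH_eps_linear : scalar eps;
  qH_eps_monoid : monoid_morphism eps;
  qH_coassoc : forall x,
    (idA \otf Delta) (Delta x) * Phi = Phi * (Delta \otf idA) (Delta x);
  qH_counit_left : forall x, (eps_scalar eps \otf idA) (Delta x) = x;
  qH_counit_right : forall x, (idA \otf eps_scalar eps) (Delta x) = x;
  qH_counit_Phi : (idA \otf eps_scalar eps \otf idA) Phi = 1 :> tpow K M 2;
  qH_pentagon :
    (idA \otf idA \otf Delta) Phi * (Delta \otf idA \otf idA) Phi
    = (1 : A) \ot Phi * (idA \otf Delta \otf idA) Phi * (Phi \ot (1 : A))
    :> tpow K M 4;
  qH_antipode : exists Phi_inv, [/\ Phi * Phi_inv = 1, Phi_inv * Phi = 1 &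
    exists S a b, quasi_antipode Delta eps Phi Phi_inv S a b]
}.

End QuasiStructures.

(** * The tensor algebra

  T(V) is the algebra of noncommutative polynomials in the vectors of the basis
  [vbasis {:V}], i.e. the algebra of the free monoid on its index set. *)

Notation word V := {fmonom 'I_(\dim (fullv : {vspace V}))}.
Notation TV K V m := (tpow K (word V) m).

Section TensorAlgebra.
Variables (K : comNzRingType) (k : fieldType) (V : vectType k).
Local Notation I := 'I_(\dim (fullv : {vspace V})).

Definition gen (i : I) : TV K V 1 := << [ffun=> fmu i] >>.

(* The algebra morphism T_K(V) -> B with value f i on the i-th generator. *)
Definition tlift (B : lalgType K) (f : I -> B) : TV K V 1 -> B :=
  mlin (fun w : {ffun 'I_1 -> word V} => \prod_(i <- (w ord0 : seq I)) f i).

Definition Delta0 : TV K V 1 -> TV K V 2 := tlift (fun i => prim2 (gen i)).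

(* The counit, which is the identity on constants and vanishes on V: the
   coefficient of the empty word. *)
Definition counit (u : TV K V 1) : K := u@_mone.

(* The derivation T_K(V) -> T_K(V) ⊗ T_K(V) along Delta0, with value f i on the
   i-th generator: D(xy) = D(x) Delta0(y) + Delta0(x) D(y).  On the free Lie
   algebra it restricts to the 1-cocycle with these values on generators. *)
Fixpoint wder (f : I -> TV K V 2) (s : seq I) : TV K V 2 :=
  if s is i :: s' then
    f i * (\prod_(j <- s') prim2 (gen j)) + prim2 (gen i) * wder f s'
  else 0.

Definition derlift (f : I -> TV K V 2) : TV K V 1 -> TV K V 2 :=
  mlin (fun w : {ffun 'I_1 -> word V} => wder f (w ord0)).

End TensorAlgebra.

Section FreeLie.
Variables (k : fieldType) (V : vectType k).
Local Notation T := (TV k V 1).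

Definition iotaV (x : V) : T :=
  \sum_i coord (vbasis (fullv : {vspace V})) i x *: gen k i.

(* L(V), as the Lie subalgebra of T(V) generated by V. *)
Inductive freeLie : T -> Prop :=
| freeLie_gen x : freeLie (iotaV x)
| freeLie_lin c u v : freeLie u -> freeLie v -> freeLie (c *: u + v)
| freeLie_lie u v : freeLie u -> freeLie v -> freeLie (lie u v).

Definition in1 (x : V) : TV k V 2 := iotaV x \ot (1 : T).
Definition in2 (x : V) : TV k V 2 := (1 : T) \ot iotaV x.

(* Signature (-1, 1, ..., 1); in particular, g lies in S^2(V). *)
Definition minkowski_signature (g : TV k V 2) : Prop :=
  exists (d : nat) (e : d.+1.-tuple V), basis_of fullv e /\
    g = - (iotaV (tnth e ord0) \ot iotaV (tnth e ord0))
        + \sum_(i < d) iotaV (tnth e (lift ord0 i))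
                       \ot iotaV (tnth e (lift ord0 i)).

(* The Pohlmeyer-Rehren cobracket and associator defect on L(V). *)
Definition PR_delta (g : TV k V 2) : T -> TV k V 2 :=
  derlift (fun i => let x := (vbasis (fullv : {vspace V}))`_i in
                    lie g (in1 x - in2 x)).

Definition PR_phi (g : TV k V 2) : TV k V 3 :=
  let g12 := place 0 1 g in let g13 := place 0 2%:R g in
  let g23 := place 1 2%:R g in
  - lie g12 g13 + lie g12 g23 - lie g13 g23.

(* Word reversal, which on the degree-two part is τ; only that part is used. *)
Definition tau : T -> T :=
  mlin (fun w : {ffun 'I_1 -> word V} =>
    << [ffun i => FMonom (rev (w i : seq _))] >>).

Definition Delta1 (g : TV k V 2) (x : V) : TV k V 2 := lie g (in1 x).

Definition Delta2 (alpha beta : k) (g : TV k V 2) (x : V) : TV k V 2 :=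
  let half := 2%:R^-1 : k in
  let idT := @idfun T in
  let x1 := in1 x in let x2 := in2 x in
    alpha *: (g ^+ 2 * x1) - half *: (g * x1 * g)
    + (half - alpha) *: (x1 * g ^+ 2)
    + (half - alpha) *: (idT \otf tau) (g ^+ 2 * x1)
    - half *: (idT \otf tau) (g * x1 * g)
    + alpha *: (idT \otf tau) (x1 * g ^+ 2)
    + (beta - half) *: (g ^+ 2 * x2) + half *: (g * x2 * g)
    - beta *: (x2 * g ^+ 2)
    + (half - beta) *: (tau \otf idT) (g ^+ 2 * x2)
    - half *: (tau \otf idT) (g * x2 * g)
    + beta *: (tau \otf idT) (x2 * g ^+ 2).

Definition Phi2 (g : TV k V 2) : TV k V 3 :=
  - (2%:R^-1 *: lie (place 0 1 g) (place 0 2%:R g)).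

End FreeLie.

(** * Quantization modulo h^3 *)

(* k[h] / (h^3) = k[[h]] / (h^3) *)
Notation kh k := {poly %/ ('X^3 : {poly k})}.

Section Quantization.
Variables (k : fieldType) (V : vectType k).

Definition hbar : kh k := 'qX.

Definition const_h m (u : TV k V m) : TV (kh k) V m := tcoef (qpolyC 'X^3) u.

Definition modh m (u : TV (kh k) V m) : TV k V m :=
  tcoef (fun c : kh k => (c : {poly k})`_0) u.

(* Quantization of (L(V), delta, phi) on T(V)[h]/(h^3) = TV (kh k) V 1, with
   its undeformed multiplication, unit and counit.  Modulo h this is T(V), which
   is the enveloping algebra of L(V) with its standard coproduct Delta0.
   In the last two fields, E and F are not unique but their classes modulo h
   are. *)
Record quantization_mod_h3 (delta : TV k V 1 -> TV k V 2) (phi : TV k V 3)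
    (Delta : TV (kh k) V 1 -> TV (kh k) V 2) (Phi : TV (kh k) V 3) : Prop :=
  QuantizationModH3 {
  qz_quasi_Lie : quasi_Lie_bialgebra (@freeLie k V) delta phi;
  qz_quasi_Hopf : quasi_Hopf Delta (@counit (kh k) k V) Phi;
  qz_Delta_modh : forall u, modh (Delta u) = Delta0 (modh u);
  qz_Phi_modh2 : exists F, Phi = 1 + hbar ^+ 2 *: F;
  qz_delta : forall x, freeLie x -> exists E,
    Delta (const_h x) - flip (Delta (const_h x)) = hbar *: E
    /\ modh E = delta x;
  qz_phi : exists F, Alt Phi = hbar ^+ 2 *: F /\ modh F = phi
}.

End Quantization.

(** * Properties of these constructions *)

Lemma malg_ind (K : comNzRingType) (W : choiceType) (P : {malg K[W]} -> Prop) :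
  P 0 -> (forall c w u, P u -> P (c *: << w >> + u)) -> forall u, P u.
Proof.
move=> P0 PD u; rewrite [u]monalgE; elim: (enum_fset _) => [|w s IHs].
  by rewrite big_nil.
rewrite big_cons; suff -> : << u@_w *g w >> = u@_w *: << w >> by apply: PD.
by apply/malgP => z; rewrite mcoeffZ !mcoeffU mulr_natr.
Qed.

Section MonoidAlgebra.
Variables (K : comNzRingType) (W : monomType).
Implicit Types u v : {malg K[W]}.

Lemma malg_scalerAr (c : K) u v : u * (c *: v) = c *: (u * v).
Proof.
apply/malgP => w; rewrite mcoeffZ (mcoeffMlw _ (fsubset_refl _) (msuppZ_le c v)).
rewrite (mcoeffMlw _ (fsubset_refl _) (fsubset_refl _)) !mulr_sumr.
apply: eq_bigr => w1 _; rewrite mulr_sumr; apply: eq_bigr => w2 _.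
by rewrite mcoeffZ mulrCA mulrnAr.
Qed.

Lemma malgUM (w z : W) : << w >> * << z >> = << mmul w z >> :> {malg K[W]}.
Proof. by rewrite malgM_def fgmulUU mulr1. Qed.

Lemma mlin_morphM (B : lalgType K) (f : W -> B) :
    (forall c (a b : B), a * (c *: b) = c *: (a * b)) ->
    {morph f : w z / mmul w z >-> w * z} ->
  {morph mlin f : u v / u * v}.
Proof.
move=> scaleBr fM u v; elim/malg_ind: u => [|c w u IHu].
  by rewrite mul0r linear0 mul0r.
rewrite mulrDl -scalerAl !mlin_is_linear IHu mulrDl -scalerAl; congr (_ *: _ + _).
elim/malg_ind: v {IHu} => [|d z v IHv]; first by rewrite mulr0 linear0 mulr0.
by rewrite mulrDr malg_scalerAr !mlin_is_linear IHv mulrDr scaleBr malgUM !mlinU fM.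
Qed.

End MonoidAlgebra.

Fact scaler_swap (K : comNzRingType) (B : lmodType K) (c d : K) (x y z t : B) :
  d *: (c *: x + y) + (c *: z + t) = c *: (d *: x + z) + (d *: y + t).
Proof. by rewrite !scalerDr !scalerA (mulrC c d) addrACA. Qed.

Fact scaleD_congr (K : comNzRingType) (B : lmodType K) (c : K) (x y x' y' : B) :
  x = x' -> y = y' -> c *: x + y = c *: x' + y'.
Proof. by move=> -> ->. Qed.

Fact scaleD_addrACA (K : comNzRingType) (B : lmodType K) (c : K)
    (x y x1 x2 y1 y2 : B) :
  x = x1 + y1 -> y = x2 + y2 -> c *: x + y = c *: x1 + x2 + (c *: y1 + y2).
Proof. by move=> -> ->; rewrite scalerDr addrACA. Qed.

Fact mulPl (K : comNzRingType) (B : lalgType K) (c : K) (x y z : B) :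
  (c *: x + y) * z = c *: (x * z) + y * z.
Proof. by rewrite mulrDl scalerAl. Qed.

Fact malg_mulPr (K : comNzRingType) (W : monomType) (c : K) (x y z : {malg K[W]}) :
  x * (c *: y + z) = c *: (x * y) + x * z.
Proof. by rewrite mulrDr malg_scalerAr. Qed.

Fact der_step (B : nzRingType) (a p x y d e : B) :
  a * (x * y) + p * (d * y + x * e) = (a * x + p * d) * y + p * x * e.
Proof. by rewrite mulrDr mulrDl !mulrA addrA. Qed.

Section TensorTheory.
Variables (K : comNzRingType) (M : monomType).

Lemma tensPl p q c (u u' : tpow K M p) (v : tpow K M q) :
  (c *: u + u') \ot v = c *: (u \ot v) + u' \ot v.
Proof. exact: mlin_is_linear. Qed.

Lemma tens0l p q (v : tpow K M q) : (0 : tpow K M p) \ot v = 0.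
Proof. exact: linear0. Qed.

Lemma tensUl p q (w : {ffun 'I_p -> M}) (v : tpow K M q) :
  << w >> \ot v = mlin (fun z => << wcat w z >>) v.
Proof. exact: mlinU. Qed.

Lemma tensPr p q c (u : tpow K M p) (v v' : tpow K M q) :
  u \ot (c *: v + v') = c *: (u \ot v) + u \ot v'.
Proof.
elim/malg_ind: u => [|d w u IHu]; first by rewrite !tens0l scaler0 addr0.
by rewrite !tensPl IHu !tensUl mlin_is_linear; apply: scaler_swap.
Qed.

Lemma tens0r p q (u : tpow K M p) : u \ot (0 : tpow K M q) = 0.
Proof. by have := @tensPr p q (-1) u 0 0; rewrite scaler0 add0r scaleN1r addNr. Qed.

Lemma tensUU p q (w : {ffun 'I_p -> M}) (z : {ffun 'I_q -> M}) :
  << w >> \ot << z >> = << wcat w z >> :> tpow K M (p + q).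
Proof. by rewrite /tens !mlinU. Qed.

Lemma tensM p q (u u' : tpow K M p) (v v' : tpow K M q) :
  (u \ot v) * (u' \ot v') = (u * u') \ot (v * v').
Proof.
elim/malg_ind: u => [|c w u IHu]; first by rewrite !(mul0r, tens0l).
rewrite mulrDl -scalerAl !tensPl mulrDl -scalerAl.
apply: scaleD_congr; last exact: IHu.
elim/malg_ind: u' {u IHu} => [|d w' u' IHu].
  by rewrite !(mulr0, tens0l).
rewrite mulrDr malg_scalerAr !tensPl mulrDr malg_scalerAr.
apply: scaleD_congr; last exact: IHu.
elim/malg_ind: v {u' IHu} => [|e z v IHv].
  by rewrite tens0r !mul0r tens0r.
rewrite mulrDl -scalerAl !tensPr mulrDl -scalerAl.
apply: scaleD_congr; last exact: IHv.
elim/malg_ind: v' {v IHv} => [|f z' v' IHv].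
  by rewrite tens0r !mulr0 tens0r.
rewrite mulrDr malg_scalerAr !tensPr mulrDr malg_scalerAr.
apply: scaleD_congr; last exact: IHv.
rewrite !malgUM !tensUU malgUM; congr << _ >>.
by apply/ffunP=> i; rewrite !ffunE; case: split => j; rewrite !ffunE.
Qed.

HB.instance Definition _ p p' q q' (f : tpow K M p -> tpow K M p')
    (g : tpow K M q -> tpow K M q') :=
  GRing.Linear.copy (tmap f g) (mlin _).

Lemma tmap_tens p p' q q' (f : {linear tpow K M p -> tpow K M p'})
    (g : {linear tpow K M q -> tpow K M q'}) u v :
  (f \otf g) (u \ot v) = f u \ot g v.
Proof.
elim/malg_ind: u => [|c w u IHu].
  by rewrite tens0l [LHS]linear0 linear0 tens0l.
rewrite tensPl (linearP f) [LHS]linearP tensPl; apply: scaleD_congr => //.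
elim/malg_ind: v {u IHu} => [|d z v IHv].
  by rewrite tens0r [LHS]linear0 linear0 tens0r.
rewrite tensPr (linearP g) [LHS]linearP tensPr; apply: scaleD_congr => //.
rewrite tensUU [LHS]mlinU; congr (f << _ >> \ot g << _ >>).
  by apply/ffunP=> i; rewrite !ffunE (unsplitK (inl i)).
by apply/ffunP=> i; rewrite !ffunE (unsplitK (inr i)).
Qed.

End TensorTheory.

Section TensorAlgebraTheory.
Variables (K : comNzRingType) (k : fieldType) (V : vectType k).
Local Notation I := 'I_(\dim (fullv : {vspace V})).

Local Notation word1 := {ffun 'I_1 -> word V}.

Lemma tlift_gen (B : lalgType K) (f : I -> B) i : tlift f (gen K i) = f i.
Proof. by rewrite /tlift mlinU ffunE /= fmU big_seq1. Qed.

Section Morphism.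
Variables (B : lalgType K) (f : I -> B).
Hypothesis scaleBr : forall c (a b : B), a * (c *: b) = c *: (a * b).

Lemma tlift_monoid_morphism : monoid_morphism (tlift f).
Proof.
split; first by rewrite /tlift mlinU ffunE fm1 big_nil.
apply: mlin_morphM => // w z; rewrite ffunE fmM.
by rewrite big_cat.
Qed.

Lemma tlift_unique (F : {lrmorphism TV K V 1 -> B}) :
  (forall i, F (gen K i) = f i) -> F =1 tlift f.
Proof.
move=> Fgen; apply: mlin_unique => w.
have -> : w = [ffun=> FMonom (w ord0 : seq I)].
  by apply/ffunP=> i; rewrite ffunE (ord1 i); case: (w ord0).
rewrite ffunE /=; elim: (w ord0 : seq I) => [|i s IHs].
  rewrite big_nil -(rmorph1 F); have -> // : [ffun=> FMonom [::]] = mone :> word1.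
  by apply/ffunP=> j; rewrite !ffunE; apply/val_inj; rewrite /= fm1.
rewrite big_cons -IHs -Fgen -rmorphM malgUM; congr (F << _ >>).
by apply/ffunP=> j; rewrite !ffunE; apply/val_inj; rewrite /= fmM fmU.
Qed.
End Morphism.

HB.instance Definition _ (B : lalgType K) (f : I -> B) :=
  GRing.Linear.copy (tlift f) (mlin _).

HB.instance Definition _ (W : monomType) (f : I -> {malg K[W]}) :=
  GRing.isMonoidMorphism.Build (TV K V 1) {malg K[W]} (tlift f)
    (tlift_monoid_morphism f (@malg_scalerAr K W)).

HB.instance Definition _ := GRing.LRMorphism.copy (@Delta0 K k V) (tlift _).

Lemma derlift_gen (f : I -> TV K V 2) i : derlift f (gen K i) = f i.
Proof. by rewrite /derlift mlinU ffunE /= fmU /= big_nil mulr1 mulr0 addr0. Qed.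

HB.instance Definition _ (f : I -> TV K V 2) :=
  GRing.Linear.copy (derlift f) (mlin _).

Lemma derliftM (f : I -> TV K V 2) u v :
  derlift f (u * v) = derlift f u * Delta0 v + Delta0 u * derlift f v.
Proof.
have DP c x y : derlift f (c *: x + y) = c *: derlift f x + derlift f y.
  exact: linearP.
have D0P c (x y : TV K V 1) : Delta0 (c *: x + y) = c *: Delta0 x + Delta0 y.
  exact: linearP.
have D_0 : derlift f 0 = 0 by exact: linear0.
have D0_0 : Delta0 (0 : TV K V 1) = 0 by exact: linear0.
elim/malg_ind: u => [|c w u IHu]; first by rewrite mul0r D_0 D0_0 !mul0r addr0.
rewrite mulPl !DP D0P !mulPl.
apply: scaleD_addrACA; last exact: IHu.
elim/malg_ind: v {u IHu} => [|d z v IHv].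
  by rewrite mulr0 D_0 D0_0 !mulr0 addr0.
rewrite malg_mulPr !DP D0P !malg_mulPr.
apply: scaleD_addrACA; last exact: IHv.
rewrite malgUM /derlift /Delta0 /tlift !mlinU ffunE fmM.
elim: (w ord0 : seq I) => [|i s IHs] /=.
  by rewrite big_nil mul0r add0r mul1r.
rewrite IHs big_cat big_cons; exact: der_step.
Qed.

End TensorAlgebraTheory.

Fact lie_step (B : nzRingType) (p q r s : B) : p * s = s * p -> r * q = q * r ->
  p * r + q * s - (r * p + s * q) = lie (p + q) (r + s).
Proof.
move=> ps rq; rewrite /lie !mulrDl !mulrDr ps -rq.
move: (p * r) (s * p) (r * q) (q * s) (r * p) (s * q) => {ps rq}a b c d e f.
by rewrite (addrC c d) (addrACA a b) (addrC b f) (addrACA e c) (addrC (e + f))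
  (addrC c b) [RHS]addrKA.
Qed.

Fact cocycle_step (B : nzRingType) (X Y dx dy : B) :
  dx * Y + X * dy - (dy * X + Y * dx) = lie X dy - lie Y dx.
Proof.
rewrite /lie; move: (dx * Y) (X * dy) (dy * X) (Y * dx) => p q r s.
by rewrite opprB opprD [RHS]addrACA (addrC q p).
Qed.

Fact lie_linear_step (K : comNzRingType) (B : lalgType K) (g : B) :
    (forall c (x y : B), x * (c *: y) = c *: (x * y)) ->
  forall c (x y z t : B),
  lie g (c *: x + y - (c *: z + t)) = c *: lie g (x - z) + lie g (y - t).
Proof.
move=> Br c x y z t; rewrite opprD addrACA -scalerBr /lie mulrDr mulrDl.
by rewrite opprD addrACA Br -scalerAl scalerBr.
Qed.

Section FreeLieTheory.
Variables (k : fieldType) (V : vectType k).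
Local Notation T := (TV k V 1).
Local Notation I := 'I_(\dim (fullv : {vspace V})).
Local Notation b := (vbasis (fullv : {vspace V})).

Fact iotaV_is_linear : linear (@iotaV k V).
Proof.
move=> c x y; rewrite /iotaV scaler_sumr -big_split; apply: eq_bigr => i _ /=.
by rewrite linearP scalerDl scalerA.
Qed.

HB.instance Definition _ :=
  GRing.isLinear.Build k V T *:%R (@iotaV k V) iotaV_is_linear.

Lemma iotaV_basis (i : I) : iotaV b`_i = gen k i.
Proof.
rewrite /iotaV (bigD1 i) //= big1 => [|j ji]; last first.
  by rewrite coord_free ?(basis_free (vbasisP _)) // eq_sym (negPf ji) scale0r.
by rewrite coord_free ?(basis_free (vbasisP _)) // eqxx scale1r addr0.
Qed.

Fact iotaV_ext (B : lmodType k) (F G : T -> B) : linear F -> linear G ->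
  (forall i, F (gen k i) = G (gen k i)) -> forall x, F (iotaV x) = G (iotaV x).
Proof.
move=> linF linG FG x.
pose FL := GRing.isLinear.Build _ _ _ _ F linF.
pose GL := GRing.isLinear.Build _ _ _ _ G linG.
pose F' : {linear T -> B} := HB.pack F FL.
pose G' : {linear T -> B} := HB.pack G GL.
rewrite -[LHS]/(F' _) -[RHS]/(G' _) !linear_sum; apply: eq_bigr => i _.
by rewrite !linearZ /= FG.
Qed.

Fact iotaV_lift (B : lmodType k) (F : T -> B) (f : {linear V -> B}) : linear F ->
  (forall i, F (gen k i) = f b`_i) -> forall x, F (iotaV x) = f x.
Proof.
move=> linF FG x.
pose FL := GRing.isLinear.Build _ _ _ _ F linF.
pose F' : {linear T -> B} := HB.pack F FL.
rewrite -[LHS]/(F' _) {2}(coord_vbasis (memvf x)) !linear_sum.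
by apply: eq_bigr => i _; rewrite !linearZ /= FG.
Qed.

(* T(V) with iotaV has the universal property of the tensor algebra. *)
Lemma tensor_algebra_exists (B : algType k) (f : {linear V -> B}) :
  exists F : {lrmorphism T -> B}, forall x, F (iotaV x) = f x.
Proof.
have Br c (x y : B) : x * (c *: y) = c *: (x * y) by rewrite scalerAr.
pose f0 (i : I) := f b`_i.
pose L := GRing.isMonoidMorphism.Build T B (tlift f0) (tlift_monoid_morphism _ Br).
pose F : {lrmorphism T -> B} := HB.pack (tlift f0) L.
exists F => x; rewrite {2}(coord_vbasis (memvf x)) !linear_sum.
apply: eq_bigr => i _; rewrite !linearZ; congr (_ *: _).
exact: tlift_gen.
Qed.

Lemma tensor_algebra_unique (B : lalgType k) (F G : {lrmorphism T -> B}) :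
  (forall x, F (iotaV x) = G (iotaV x)) -> F =1 G.
Proof.
move=> FG u; rewrite (@tlift_unique _ _ _ _ (fun i => G (gen k i)) F).
  by rewrite -(@tlift_unique _ _ _ _ (fun i => G (gen k i)) G).
by move=> i; rewrite -iotaV_basis.
Qed.

Fact prim2_is_linear (K : comNzRingType) (M : monomType) :
  linear (@prim2 K M).
Proof. by move=> c x y; rewrite /prim2 tensPl tensPr scalerDr addrACA. Qed.

HB.instance Definition _ (K : comNzRingType) (M : monomType) :=
  GRing.isLinear.Build K (tpow K M 1) (tpow K M 2) *:%R (@prim2 K M)
    (@prim2_is_linear K M).

Lemma prim2_lie (K : comNzRingType) (M : monomType) (u v : tpow K M 1) :
  prim2 (lie u v) = lie (prim2 u) (prim2 v).
Proof.
have prim2M (x y : tpow K M 1) : prim2 (x * y) =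
    (x \ot (1 : tpow K M 1)) * (y \ot (1 : tpow K M 1))
    + ((1 : tpow K M 1) \ot x) * ((1 : tpow K M 1) \ot y).
  by rewrite !tensM !mul1r.
have comm12 (x y : tpow K M 1) :
    (x \ot (1 : tpow K M 1)) * ((1 : tpow K M 1) \ot y)
    = ((1 : tpow K M 1) \ot y) * (x \ot (1 : tpow K M 1)).
  by rewrite !tensM !mul1r !mulr1.
have prim2B (x y : tpow K M 1) : prim2 (x - y) = prim2 x - prim2 y.
  exact: linearB.
rewrite {1}/lie prim2B !prim2M; apply: lie_step; exact: comm12.
Qed.

Lemma Delta0_freeLie (u : T) : freeLie u -> Delta0 u = prim2 u.
Proof.
have D0P c (x y : T) : Delta0 (c *: x + y) = c *: Delta0 x + Delta0 y.
  exact: linearP.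
have p2P c (x y : T) : prim2 (c *: x + y) = c *: prim2 x + prim2 y.
  exact: prim2_is_linear.
elim=> [x|c {}u v _ IHu _ IHv|{}u v _ IHu _ IHv].
- apply: (iotaV_ext D0P p2P) => i; exact: tlift_gen.
- by rewrite D0P p2P IHu IHv.
- rewrite prim2_lie -IHu -IHv /lie; have -> := rmorphB (@Delta0 k k V) (u * v) (v * u).
  have D0M (x y : T) : Delta0 (x * y) = Delta0 x * Delta0 y by exact: rmorphM.
  by rewrite -!D0M.
Qed.

Lemma PR_delta_gen (g : TV k V 2) (x : V) :
  PR_delta g (iotaV x) = lie g (in1 x - in2 x).
Proof.
pose D (y : V) := lie g (in1 y - in2 y).
have D_linear : linear D.
  move=> c y z; rewrite /D /in1 /in2 !(linearP (@iotaV k V)) tensPl tensPr.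
  apply: (@lie_linear_step k (TV k V 2) g (@malg_scalerAr k _)).
pose DL := GRing.isLinear.Build _ _ _ _ D D_linear.
pose D' : {linear V -> TV k V 2} := HB.pack D DL.
have DP c (u v : T) : PR_delta g (c *: u + v) = c *: PR_delta g u + PR_delta g v.
  exact: linearP.
exact: (iotaV_lift (f := D')) DP (@derlift_gen k k V _) x.
Qed.

Lemma PR_delta_cocycle (g : TV k V 2) (x y : T) : freeLie x -> freeLie y ->
  PR_delta g (lie x y) =
    lie (prim2 x) (PR_delta g y) - lie (prim2 y) (PR_delta g x).
Proof.
move=> Lx Ly; rewrite -!Delta0_freeLie // {1}/lie /PR_delta.
have DB f (u v : T) : derlift f (u - v) = derlift f u - derlift f v.
  exact: linearB.
rewrite DB !derliftM; exact: cocycle_step.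
Qed.
End FreeLieTheory.

Lemma tcoefE (R S : nzRingType) (W : choiceType) (f : R -> S)
  (u : {malg R[W]}) w : f 0 = 0 -> (tcoef f u)@_w = f u@_w.
Proof.
move=> f0; rewrite /tcoef raddf_sum /=.
case: (boolP (w \in msupp u)) => [uw|w'u].
  rewrite (big_fsetD1 w) //= mcoeffUU big_seq big1 ?addr0 // => z.
  by rewrite in_fsetD1 => /andP[zw _]; rewrite mcoeffU (negPf zw).
rewrite mcoeff_outdom // f0 big_seq big1 // => z uz; rewrite mcoeffU.
by case: eqP => // zw; rewrite -zw uz in w'u.
Qed.

Section LinearCombinators.
Variables (k : fieldType) (V : lmodType k) (W : monomType).
Implicit Types f g : V -> {malg k[W]}.

Fact linear_addf f g : linear f -> linear g -> linear (fun x => f x + g x).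
Proof. by move=> lf lg c x y; rewrite lf lg scalerDr addrACA. Qed.

Fact linear_scalef a f : linear f -> linear (fun x => a *: f x).
Proof. by move=> lf c x y; rewrite lf scalerDr !scalerA mulrC. Qed.

Fact linear_oppf f : linear f -> linear (fun x => - f x).
Proof. by move=> lf c x y; rewrite lf opprD scalerN. Qed.

Fact linear_mullf a f : linear f -> linear (fun x => a * f x).
Proof. by move=> lf c x y; rewrite lf mulrDr malg_scalerAr. Qed.

Fact linear_mulrf a f : linear f -> linear (fun x => f x * a).
Proof. by move=> lf c x y; rewrite lf mulrDl scalerAl. Qed.

Fact linear_comp (W' : monomType) (h : {malg k[W]} -> {malg k[W']}) f :
  linear h -> linear f -> linear (fun x => h (f x)).
Proof. by move=> lh lf c x y; rewrite lf lh. Qed.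

End LinearCombinators.

Fact semilinear_step (K : comNzRingType) (B : lmodType K) (C t s : K)
    (a a' b b' d d' : B) :
  C *: a + a' + t *: (C *: b + b') + s *: (C *: d + d')
  = C *: (a + t *: b + s *: d) + (a' + t *: b' + s *: d').
Proof.
rewrite !scalerDr !scalerA (mulrC t) (mulrC s) -!scalerA.
by rewrite (addrACA (C *: a)) (addrACA (C *: a + _)).
Qed.

Section Deformation.
Variables (k : fieldType) (V : vectType k) (g : TV k V 2) (alpha beta : k).
Local Notation b := (vbasis (fullv : {vspace V})).

Fact in1_is_linear : linear (@in1 k V).
Proof. by move=> c x y; rewrite /in1 iotaV_is_linear tensPl. Qed.

Fact in2_is_linear : linear (@in2 k V).
Proof. by move=> c x y; rewrite /in2 iotaV_is_linear tensPr. Qed.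

Fact Delta1_is_linear : linear (Delta1 g).
Proof.
by apply: linear_addf; [|apply: linear_oppf];
  [apply: linear_mullf | apply: linear_mulrf]; apply: in1_is_linear.
Qed.

Fact Delta2_is_linear : linear (Delta2 alpha beta g).
Proof.
have l1 := in1_is_linear; have l2 := in2_is_linear.
have a1 := linear_mullf (g ^+ 2) l1; have c1 := linear_mulrf (g ^+ 2) l1.
have b1 := linear_mulrf g (linear_mullf g l1).
have a2 := linear_mullf (g ^+ 2) l2; have c2 := linear_mulrf (g ^+ 2) l2.
have b2 := linear_mulrf g (linear_mullf g l2).
have rt : linear (@idfun (TV k V 1) \otf @tau k V) by exact: mlin_is_linear.
have lt : linear (@tau k V \otf @idfun (TV k V 1)) by exact: mlin_is_linear.
have Z := linear_scalef; have N := linear_oppf; have C := linear_comp.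
pose h := 2%:R^-1 : k; pose A := linear_addf.
have L1 := A _ _ _ _ _ (A _ _ _ _ _ (Z _ _ _ alpha _ a1)
  (N _ _ _ _ (Z _ _ _ h _ b1))) (Z _ _ _ (h - alpha) _ c1).
have L2 := A _ _ _ _ _ (A _ _ _ _ _ (A _ _ _ _ _ L1
  (Z _ _ _ (h - alpha) _ (C _ _ _ _ _ _ rt a1)))
  (N _ _ _ _ (Z _ _ _ h _ (C _ _ _ _ _ _ rt b1))))
  (Z _ _ _ alpha _ (C _ _ _ _ _ _ rt c1)).
have L3 := A _ _ _ _ _ (A _ _ _ _ _ (A _ _ _ _ _ L2
  (Z _ _ _ (beta - h) _ a2)) (Z _ _ _ h _ b2))
  (N _ _ _ _ (Z _ _ _ beta _ c2)).
exact (A _ _ _ _ _ (A _ _ _ _ _ (A _ _ _ _ _ L3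
  (Z _ _ _ (h - beta) _ (C _ _ _ _ _ _ lt a2)))
  (N _ _ _ _ (Z _ _ _ h _ (C _ _ _ _ _ _ lt b2))))
  (Z _ _ _ beta _ (C _ _ _ _ _ _ lt c2))).
Qed.

Fact const_hP m c (u v : TV k V m) :
  const_h (c *: u + v) = qpolyC 'X^3 c *: const_h u + const_h v.
Proof.
have cE (z : TV k V m) w : (const_h z)@_w = qpolyC 'X^3 z@_w.
  exact: (tcoefE _ _ (qpolyC0 _)).
apply/malgP => w; rewrite mcoeffD mcoeffZ !cE.
by rewrite mcoeffD mcoeffZ qpolyCD qpolyCM.
Qed.

Fact deformed_is_semilinear (f0 f1 f2 : V -> TV k V 2) c x y :
    linear f0 -> linear f1 -> linear f2 ->
  let D z := const_h (f0 z) + hbar k *: const_h (f1 z)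
    + hbar k ^+ 2 *: const_h (f2 z) in
  D (c *: x + y) = qpolyC 'X^3 c *: D x + D y.
Proof.
by move=> l0 l1 l2 D; rewrite /D l0 l1 l2 !const_hP; apply: semilinear_step.
Qed.

(* Existence of an algebra morphism with the deformed values on V. *)
Lemma deformed_coproduct_exists :
  exists Delta : {lrmorphism TV (kh k) V 1 -> TV (kh k) V 2},
  forall x : V, Delta (const_h (iotaV x)) =
    const_h (in1 x + in2 x) + hbar k *: const_h (Delta1 g x)
    + hbar k ^+ 2 *: const_h (Delta2 alpha beta g x).
Proof.
pose D x := const_h (in1 x + in2 x) + hbar k *: const_h (Delta1 g x)
    + hbar k ^+ 2 *: const_h (Delta2 alpha beta g x).
have DP c x y : D (c *: x + y) = qpolyC 'X^3 c *: D x + D y.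
  exact: (deformed_is_semilinear c x y
    (linear_addf in1_is_linear in2_is_linear) Delta1_is_linear Delta2_is_linear).
have D0 : D 0 = 0.
  have := DP (-1) 0 0; rewrite scaler0 addr0 => ->.
  have -> : qpolyC 'X^3 (-1 : k) = -1 by rewrite rmorphN rmorph1.
  by rewrite scaleN1r addNr.
have const_h0 : const_h (0 : TV k V 1) = 0 by rewrite /const_h /tcoef msupp0 big_nil.
pose F : {lrmorphism TV (kh k) V 1 -> TV (kh k) V 2} := tlift (fun i => D b`_i).
have FP c (u v : TV (kh k) V 1) : F (c *: u + v) = c *: F u + F v.
  exact: linearP.
have Fgen i : F (gen (kh k) i) = D b`_i by exact: tlift_gen.
have gen_h i : const_h (gen k i) = gen (kh k) i.
  apply/malgP => w; rewrite tcoefE ?qpolyC0 // !mcoeffU.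
  by case: eqP; rewrite ?qpolyC0.
exists F => x; rewrite -/(D x) {2}(coord_vbasis (memvf x)) /iotaV.
elim: (index_enum _) => [|i s IHs].
  by rewrite !big_nil const_h0 D0; exact: (linear0 F).
by rewrite !big_cons const_hP DP FP IHs gen_h Fgen.
Qed.
End Deformation.

(* Main.v *)
(** All the maps involved are determined by their values on V, and since
  g = \sum_j eps_j e_j ⊗ e_j each axiom becomes an identity between sums
  \sum_(i, j, ...) eps_i eps_j ... w_0 ⊗ w_1 ⊗ ..., where the w's are words in e_i,
  e_j, ... and in a few given vectors.  Two such sums are equal as soon as they
  agree after a renaming of the summation indices, which is decided by computation.

  The quasi-antipode has a = 1: the equation m (S ⊗ id) Delta = eps on V then
  determines the anti-morphism S order by order in h, and the axiom on Phi
  determines b = 1 + O(h^2).  S is bijective because S o S = id + O(h).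

  The co-Jacobi identity on [x, y] follows from those on x and y because the terms
  of cp (delta ⊗ id) delta [x, y] that mix delta x and delta y cancel. *)

Require Import Defs.
From HB Require Import structures.
From mathcomp Require Import all_boot all_algebra perm ring.
From mathcomp Require Import finmap.
From mathcomp.multinomials Require Import monalg.

Set Implicit Arguments.
Unset Strict Implicit.
Unset Printing Implicit Defensive.

Import GRing.Theory.
Local Open Scope ring_scope.

(** * Tensors of families *)

(** T(V) is generated by the basis [vbasis], whereas g is diagonal in another basis e. Formal words
    therefore have arbitrary letters, and a predicate [Q] on letters (membership in V or in L(V))
    delimits where the formula for a map is known; linearity moves such formulas from the generators
    to all of V. A frame leaves the ground ring abstract and keeps of h and u only the relations h h
    = 2u, h u = 0, u u = 0. It covers both k with h = u = 0, where the quasi-Lie axioms are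
    computed, and k[h]/(h^3). Passing from V to T(V) or L(V) needs its own reason for each axiom:
    for coassociativity, the intertwining relation is closed under products; for the quasi-antipode,
    an inner factor that contracts to a scalar can be pulled out of m (S ⊗ id) and m (id ⊗ S); for
    the classical limit, the antisymmetrized first-order part of an algebra morphism is a cocycle.
    The factor -1/2 in Phi comes from Alt [g12, g13] = -2 phi. *)

Section TensorFamilies.
Variables (K : comNzRingType) (M : monomType).
Local Notation A := (tpow K M 1).

Lemma eq_wcat p q (a : {ffun 'I_p -> M}) (b : {ffun 'I_q -> M}) w :
  (wcat a b == w) = (a == wleft w) && (b == wright w).
Proof.
apply/eqP/andP => [<-|[/eqP-> /eqP->]].
  split; apply/eqP/ffunP=> i; rewrite !ffunE.
    by rewrite (unsplitK (inl i)).
  by rewrite (unsplitK (inr i)).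
apply/ffunP=> i; rewrite !ffunE.
by case: (splitP i) => j ij; rewrite ffunE; congr (w _); apply: val_inj.
Qed.

(** Makes identities between tensors provable coefficient by coefficient, without induction on the
    arguments. *)
Lemma tens_coef p q (u : tpow K M p) (v : tpow K M q) w :
  (u \ot v)@_w = u@_(wleft w) * v@_(wright w).
Proof.
elim/malg_ind: u => [|c a u IHu]; first by rewrite tens0l !mcoeff0 mul0r.
rewrite tensPl !mcoeffD !mcoeffZ IHu mulrDl -mulrA; congr (_ * _ + _).
elim/malg_ind: v {u IHu} => [|d b v IHv]; first by rewrite tens0r !mcoeff0 mulr0.
rewrite tensPr !mcoeffD !mcoeffZ IHv mulrDr; congr (_ + _).
rewrite tensUU !mcoeffU1 eq_wcat mulrCA; congr (_ * _).
by rewrite -natrM mulnb.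
Qed.

Lemma tens1 p q : (1 : tpow K M p) \ot (1 : tpow K M q) = 1.
Proof.
rewrite tensUU; congr << _ >>; apply/ffunP=> i; rewrite !ffunE.
by case: split => j; rewrite ffunE.
Qed.

(** Families are indexed by [nat], so that the tail of a family is a plain composition and a list of
    words becomes a family through [nth]. *)
Fixpoint tn n (f : nat -> A) : tpow K M n :=
  if n is n'.+1 then (f 0%N : tpow K M 1) \ot tn n' (f \o S) else 1.

Lemma tn_coef n f w : (tn n f)@_w = \prod_(i < n) (f i)@_[ffun=> w i].
Proof.
elim: n f w => [|n IH] f w.
  rewrite big_ord0 /= mcoeff1; case: eqP => // -[].
  by apply/ffunP; case.
rewrite /= (@tens_coef 1 n) IH big_ord_recl; congr (_@_ _ * _).
  by apply/ffunP=> i; rewrite !ffunE; congr (w _); apply: val_inj; rewrite /= ord1.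
apply: eq_bigr => i _; congr (_@_ _).
by apply/ffunP=> j; rewrite !ffunE; congr (w _); apply: val_inj.
Qed.

Lemma eq_tn n f g : (forall i, (i < n)%N -> f i = g i) -> tn n f = tn n g.
Proof.
by move=> fg; apply/malgP => w; rewrite !tn_coef; apply: eq_bigr => i _; rewrite fg.
Qed.

Lemma tn_mul n f g : tn n f * tn n g = tn n (fun i => f i * g i).
Proof.
elim: n f g => [|n IH] f g; first by rewrite /= mulr1.
by rewrite /= (@tensM _ _ 1 n) IH.
Qed.

Lemma tn_1 n f : (forall i, (i < n)%N -> f i = 1) -> tn n f = 1.
Proof.
elim: n f => [|n IH] f f1 //=; rewrite IH ?f1 ?(@tens1 1 n) // => i lt_in.
by rewrite /= f1.
Qed.

Lemma tn_tens p q f g : tn p f \ot tn q g =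
  tn (p + q) (fun i => if (i < p)%N then f i else g (i - p)%N).
Proof.
apply/malgP => w; rewrite tens_coef !tn_coef big_split_ord /=.
congr (_ * _); apply: eq_bigr => i _.
  by rewrite ltn_ord; congr (_@_ _); apply/ffunP=> j; rewrite !ffunE.
rewrite ltnNge leq_addr addKn; congr (_@_ _).
by apply/ffunP=> j; rewrite !ffunE.
Qed.

Lemma word1_eta (w : {ffun 'I_1 -> M}) : [ffun=> w ord0] = w.
Proof. by apply/ffunP=> i; rewrite !ffunE (ord1 i). Qed.

Lemma tn1E f : tn 1 f = f 0%N.
Proof. by apply/malgP => w; rewrite tn_coef big_ord1 word1_eta. Qed.

Let ffun1 (w w' : {ffun 'I_1 -> M}) : w ord0 = w' ord0 -> w = w'.
Proof. by move=> e; apply/ffunP=> i; rewrite (ord1 i). Qed.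

Lemma tn2E f : tn 2 f = (f 0%N : A) \ot (f 1%N : A).
Proof.
apply/malgP => w; rewrite tn_coef (@tens_coef 1 1) !big_ord_recl big_ord0 mulr1.
by congr (_ * _); congr (mcoeff _ _); apply: ffun1; rewrite !ffunE; congr (w _);
  apply: val_inj.
Qed.

Lemma tn3E f : tn 3 f = (f 0%N : A) \ot (f 1%N : A) \ot (f 2%N : A).
Proof.
apply/malgP => w; rewrite tn_coef (@tens_coef 2 1) (@tens_coef 1 1).
rewrite !big_ord_recl big_ord0 mulr1 mulrA.
by congr (_ * _ * _); congr (mcoeff _ _); apply: ffun1; rewrite !ffunE; congr (w _);
  apply: val_inj.
Qed.

Lemma tshuffle_coef n (s t : 'I_n -> 'I_n) (u : tpow K M n) w :
  cancel s t -> cancel t s -> (tshuffle s u)@_w = u@_[ffun i => w (t i)].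
Proof.
move=> sK tK; rewrite /tshuffle; elim/malg_ind: u => [|c z u IH].
  by rewrite linear0 !mcoeff0.
rewrite linearP /= !mcoeffD !mcoeffZ IH mlinU !mcoeffU1.
congr (_ * _%:R + _); congr (nat_of_bool _); apply/eqP/eqP => [<-|->].
  by apply/ffunP=> i; rewrite !ffunE tK.
by apply/ffunP=> i; rewrite !ffunE sK.
Qed.

Lemma tshuffle_tn n (s t : 'I_n -> 'I_n) (f g : nat -> A) : cancel s t -> cancel t s ->
  (forall i : 'I_n, g i = f (s i)) -> tshuffle s (tn n f) = tn n g.
Proof.
move=> sK tK fg; apply/malgP => w; rewrite (tshuffle_coef _ _ sK tK) !tn_coef.
rewrite (reindex s) /=; last by exists t => i _; rewrite (sK, tK).
by apply: eq_bigr => i _; rewrite fg; congr (_@_ _); apply/ffunP=> j; rewrite !ffunE sK.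
Qed.

(** The universal property of the tensor product, in the form in which [place] and the contractions
    of the quasi-antipode axioms present themselves: a bilinear map given through its values on
    basis words. *)
Lemma mlin_tens p q (B : lmodType K) (F : tpow K M p -> tpow K M q -> B) u v :
    (forall c a b d, F (c *: a + b) d = c *: F a d + F b d) ->
    (forall c a b d, F a (c *: b + d) = c *: F a b + F a d) ->
  mlin (fun w : {ffun 'I_(p + q) -> M} => F << wleft w >> << wright w >>) (u \ot v)
  = F u v.
Proof.
move=> Fl Fr.
have F0l d : F 0 d = 0.
  by have := Fl (-1) 0 0 d; rewrite scaler0 add0r scaleN1r addNr.
have F0r d : F d 0 = 0.
  by have := Fr (-1) d 0 0; rewrite scaler0 add0r scaleN1r addNr.
elim/malg_ind: u => [|c w u IHu]; first by rewrite tens0l linear0 F0l.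
rewrite tensPl linearP Fl; apply: scaleD_congr => //.
elim/malg_ind: v {u IHu} => [|d z v IHv]; first by rewrite tens0r linear0 F0r.
rewrite tensPr linearP Fr; apply: scaleD_congr => //.
rewrite tensUU [LHS]mlinU; congr (F << _ >> << _ >>).
  by apply/ffunP=> i; rewrite !ffunE (unsplitK (inl i)).
by apply/ffunP=> i; rewrite !ffunE (unsplitK (inr i)).
Qed.

End TensorFamilies.

(** * Formal sums *)

(* The coefficient (c0, c1, c2, ca, cb) stands for c0 + c1 h + (c2 + ca a + cb b) u,
   where u = h^2 / 2, a = 2 alpha, b = 2 beta and h^3 = 0; this clears all
   denominators. *)
Notation coef5 := (int * int * int * int * int)%type.
(* A formal sum in a context of m letters: the term (c, (r, [:: w_0; w_1; ...]))
   stands for c times the sum over indices j_0, ..., j_(r-1), with weight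
   eps_(j_0) ... eps_(j_(r-1)), of the tensor w_0 ⊗ w_1 ⊗ ..., where the letters
   below m are those of the context and the letter m + i is e_(j_i). *)
Notation fsum := (seq (coef5 * (nat * seq (seq nat)))).

Definition cadd (c d : coef5) : coef5 :=
  let: (c0, c1, c2, ca, cb) := c in let: (d0, d1, d2, da, db) := d in
  (c0 + d0, c1 + d1, c2 + d2, ca + da, cb + db).

(** The factor 2 is h^2 = 2u. Since a and b occur only next to u, and u^2 = 0, no product of a and b
    arises. *)
Definition cmul (c d : coef5) : coef5 :=
  let: (c0, c1, c2, ca, cb) := c in let: (d0, d1, d2, da, db) := d in
  (c0 * d0, c0 * d1 + c1 * d0, c0 * d2 + c2 * d0 + 2%:Z * (c1 * d1),
   c0 * da + ca * d0, c0 * db + cb * d0).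

Definition cint (n : int) : coef5 := (n, 0, 0, 0, 0).
Definition ch (n : int) : coef5 := (0, n, 0, 0, 0).
Definition cu (n na nb : int) : coef5 := (0, 0, n, na, nb).

(** Products of order h^3 get the coefficient 0 from [cmul]; dropping them is the truncation that
    keeps formal sums small. *)
Definition fprune (P : fsum) : fsum := [seq x <- P | x.1 != cint 0].

Definition fscale c (P : fsum) : fsum := [seq (cmul c x.1, x.2) | x <- P].

Definition fsub P Q : fsum := P ++ fscale (cint (-1)) Q.

(** Makes room for r bound letters after the first m letters. In a product, the bound letters of the
    right factor are moved past those of the left one; in the left factor only letters out of range
    move. *)
Definition lsh m r l := if (l < m)%N then l else (l + r)%N.

Definition fmul n m (P Q : fsum) : fsum := fprune
  [seq (cmul x.1 y.1, ((x.2.1 + y.2.1)%N,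
     mkseq (fun i => map (lsh (m + x.2.1) y.2.1) (nth [::] x.2.2 i)
                  ++ map (lsh m x.2.1) (nth [::] y.2.2 i)) n)) | x <- P, y <- Q].

Definition ftens p q m (P Q : fsum) : fsum := fprune
  [seq (cmul x.1 y.1, ((x.2.1 + y.2.1)%N,
     mkseq (fun i => if (i < p)%N
                     then map (lsh (m + x.2.1) y.2.1) (nth [::] x.2.2 i)
                     else map (lsh m x.2.1) (nth [::] y.2.2 (i - p))) (p + q)))
    | x <- P, y <- Q].

Definition fone n : fsum := [:: (cint 1, (0%N, nseq n [::]))].
Definition fword w : fsum := [:: (cint 1, (0%N, [:: w]))].

Definition fhom n m (img : nat -> fsum) (w : seq nat) : fsum :=
  foldr (fun l P => fmul n m (img l) P) (fone n) w.

Definition fahom n m (img : nat -> fsum) (w : seq nat) : fsum :=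
  foldr (fun l P => fmul n m P (img l)) (fone n) w.

Fixpoint fder n m (img prim : nat -> fsum) (w : seq nat) : fsum :=
  if w is l :: w' then
    fmul n m (img l) (fhom n m prim w') ++ fmul n m (prim l) (fder n m img prim w')
  else [::].

(** [G] acts on a single tensor of words, for which the bound letters of the term are further
    letters of the context; hence the enlarged context [m + x.2.1]. *)
Definition fbind m (G : nat -> seq (seq nat) -> fsum) (P : fsum) : fsum := fprune
  (flatten [seq [seq (cmul x.1 y.1, ((x.2.1 + y.2.1)%N, y.2.2))
                | y <- G (m + x.2.1)%N x.2.2] | x <- P]).

(** Substitutes the letter l for the single context letter 0 of P. A letter out of range has the
    value 0, so its image under a linear map is the empty sum. *)
Definition rebase m l (P : fsum) : fsum :=
  if (l < m)%N then
    [seq (x.1, (x.2.1, map (map (fun i => if i is i'.+1 then (m + i')%N else l))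
                          x.2.2)) | x <- P]
  else [::].

(* Renames the bound letters in their order of occurrence. *)
Definition fren m (rW : nat * seq (seq nat)) : nat * seq (seq nat) :=
  let: (r, W) := rW in
  let bs := undup [seq (l - m)%N | l <- flatten W & (m <= l < m + r)%N] in
  let p := [seq index i bs | i <- iota 0 r] in
  (* This guard is all that soundness needs: bound letters may be renamed by any permutation, and
     otherwise the term is left as it is. *)
  if perm_eq p (iota 0 r) then
    (r, map (map (fun l => if (l < m)%N then l else (m + nth r p (l - m))%N)) W)
  else rW.

Fixpoint fins (x : coef5 * (nat * seq (seq nat))) (P : fsum) : fsum :=
  if P is y :: P' then
    if x.2 == y.2 then (cadd x.1 y.1, y.2) :: P' else y :: fins x P'
  else [:: x].

Definition fnorm m (P : fsum) : fsum :=
  fprune (foldr (fun x Q => fins (x.1, fren m x.2) Q) [::] P).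

(** An interpretation of formal sums. The point [fidx0] serves as default value for [nth], and h, u
    enter through their three relations, so that the same computation is valid before and after
    deformation. *)
Record frame (K : comNzRingType) (M : monomType) := Frame {
  fidx : finType;
  fidx0 : fidx;
  feps : fidx -> K;
  fvec : fidx -> tpow K M 1;
  fh : K;
  fu : K;
  fa : K;
  fb : K;
  fhh : fh * fh = 2%:R * fu;
  fhu : fh * fu = 0;
  fuu : fu * fu = 0
}.

(** * Weighted sums over bound indices *)

Section BoundSums.
Variables (K : comNzRingType) (J : finType) (j0 : J) (eps : J -> K).

Fixpoint bsum (B : lmodType K) r (G : seq J -> B) : B :=
  if r is r'.+1 then \sum_j eps j *: bsum r' (fun t => G (j :: t)) else G [::].

Lemma eq_bsum (B : lmodType K) r (G H : seq J -> B) :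
  (forall t, size t = r -> G t = H t) -> bsum r G = bsum r H.
Proof.
elim: r G H => [|r IH] G H GH /=; first exact: GH.
apply: eq_bigr => j _; congr (_ *: _); apply: IH => t st.
by apply: GH; rewrite /= st.
Qed.

Lemma bsum_cat (B : lmodType K) r r' (G : seq J -> B) :
  bsum (r + r') G = bsum r (fun t => bsum r' (fun t' => G (t ++ t'))).
Proof.
elim: r G => [|r IH] G //=; apply: eq_bigr => j _; congr (_ *: _).
by rewrite IH.
Qed.

Lemma bsum_linear (B B' : lmodType K) (L : {linear B -> B'}) r (G : seq J -> B) :
  L (bsum r G) = bsum r (fun t => L (G t)).
Proof.
elim: r G => [|r IH] G //=.
by rewrite linear_sum; apply: eq_bigr => j _; rewrite linearZ /= IH.
Qed.

Lemma bsumZ (B : lmodType K) r c (G : seq J -> B) :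
  bsum r (fun t => c *: G t) = c *: bsum r G.
Proof.
elim: r G => [|r IH] G //=; rewrite scaler_sumr; apply: eq_bigr => j _.
by rewrite IH !scalerA mulrC.
Qed.

Lemma bsum_sum (B : lmodType K) (I : Type) r (s : seq I) (G : I -> seq J -> B) :
  bsum r (fun t => \sum_(i <- s) G i t) = \sum_(i <- s) bsum r (G i).
Proof.
elim: r G => [|r IH] G //=; rewrite exchange_big; apply: eq_bigr => j _ /=.
by rewrite IH scaler_sumr.
Qed.

Lemma bsum_tens (M : monomType) p q r r' (G : seq J -> tpow K M p)
    (H : seq J -> tpow K M q) :
  bsum r G \ot bsum r' H = bsum r (fun t => bsum r' (fun t' => G t \ot H t')).
Proof.
transitivity (bsum r (fun t => G t \ot bsum r' H)).
  by rewrite /tens bsum_linear.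
apply: eq_bsum => t _; elim: r' H => [|r' IH] H //=.
(* The sum over the index type is generalized to a sum over a list, so that [tensPr] can be applied
   one summand at a time. *)
suff E (s : seq J) : G t \ot (\sum_(j <- s) eps j *: bsum r' (fun t' => H (j :: t')))
    = \sum_(j <- s) eps j *: bsum r' (fun t' => G t \ot H (j :: t')) by exact: E.
elim: s => [|j s IHs]; first by rewrite !big_nil tens0r.
by rewrite !big_cons tensPr IHs IH.
Qed.

Lemma bsum_mul (W : monomType) r r' (G H : seq J -> {malg K[W]}) :
  bsum r G * bsum r' H = bsum r (fun t => bsum r' (fun t' => G t * H t')).
Proof.
elim: r G => [|r IH] G /=; last first.
  by rewrite mulr_suml; apply: eq_bigr => j _; rewrite -scalerAl IH.
elim: r' H => [|r' IH] H //=; rewrite mulr_sumr; apply: eq_bigr => j _.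
by rewrite malg_scalerAr IH.
Qed.

Fixpoint tuples r : seq (seq J) :=
  if r is r'.+1 then [seq j :: t | j <- enum J, t <- tuples r'] else [:: [::]].

Lemma mem_tuples r t : (t \in tuples r) = (size t == r).
Proof.
elim: r t => [|r IH] [|j t] //=.
  by apply/negbTE/negP => /allpairsP[x [_ _]].
rewrite eqSS -IH; apply/allpairsP/idP => [[[i s] /= [_ sr [_ ->]]]|tr] //.
by exists (j, t); rewrite mem_enum.
Qed.

Lemma tuples_uniq r : uniq (tuples r).
Proof.
elim: r => //= r IH; apply: allpairs_uniq => //; first exact: enum_uniq.
by move=> [i s] [j t] _ _ [-> ->].
Qed.

Lemma bsumE (B : lmodType K) r (G : seq J -> B) :
  bsum r G = \sum_(t <- tuples r) (\prod_(j <- t) eps j) *: G t.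
Proof.
elim: r G => [|r IH] G /=; first by rewrite big_seq1 big_nil scale1r.
rewrite big_allpairs_dep /= big_enum; apply: eq_bigr => j _.
rewrite IH scaler_sumr; apply: eq_bigr => t _.
by rewrite big_cons scalerA.
Qed.

(** Reading a tuple along p is an injection of the finite set of r-tuples into itself, hence a
    bijection, and it only permutes the entries of a tuple, which leaves the product of the weights
    unchanged. *)
Lemma bsum_perm (B : lmodType K) r (p : seq nat) (G : seq J -> B) :
  perm_eq p (iota 0 r) -> bsum r G = bsum r (fun t => G (map (nth j0 t) p)).
Proof.
move=> pr; have sp : size p = r by rewrite (perm_size pr) size_iota.
have pK t : size t = r -> perm_eq (map (nth j0 t) p) t.
  by move=> st; rewrite -{2}(mkseq_nth j0 t) st; apply: perm_map.
rewrite !bsumE; set f := fun t => map (nth j0 t) p.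
have f_inj : {in tuples r &, injective f}.
  move=> t t'; rewrite !mem_tuples => /eqP st /eqP st' ftt'.
  apply: (@eq_from_nth _ j0) => [|i]; rewrite ?st' // st => ir.
  have ip : i \in p by rewrite (perm_mem pr) mem_iota.
  have := congr1 (fun x => nth j0 x (index i p)) ftt'.
  by rewrite /f !(nth_map 0%N) ?index_mem // nth_index.
have fU : uniq (map f (tuples r)) by rewrite map_inj_in_uniq ?tuples_uniq.
have fS : {subset map f (tuples r) <= tuples r}.
  by move=> _ /mapP[t _ ->]; rewrite mem_tuples size_map sp.
have fP : perm_eq (tuples r) (map f (tuples r)).
  rewrite perm_sym; apply: uniq_perm (tuples_uniq r) _ => //.
  by have [] := uniq_min_size fU fS; rewrite ?size_map.
rewrite (perm_big _ fP) big_map big_seq [RHS]big_seq; apply: eq_bigr => t.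
by rewrite mem_tuples => /eqP st; rewrite (perm_big _ (pK t st)).
Qed.

End BoundSums.

(** * Evaluation of formal sums *)

Section Interpretation.
Variables (K : comNzRingType) (M : monomType) (F : frame K M).
Local Notation A := (tpow K M 1).
Local Notation J := (fidx F).

Definition cval (c : coef5) : K :=
  let: (c0, c1, c2, ca, cb) := c in
  c0%:~R + c1%:~R * fh F
  + (c2%:~R + ca%:~R * fa F + cb%:~R * fb F) * fu F.

Lemma cvalD c d : cval (cadd c d) = cval c + cval d.
Proof.
case: c d => [[[[c0 c1] c2] ca] cb] [[[[d0 d1] d2] da] db] /=.
by rewrite !rmorphD /=; ring.
Qed.

Lemma cvalM c d : cval (cmul c d) = cval c * cval d.
Proof.
case: c d => [[[[c0 c1] c2] ca] cb] [[[[d0 d1] d2] da] db] /=.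
rewrite !rmorphD !rmorphM /=.
have hh := fhh F; have hu := fhu F; have uu := fuu F.
move: (fh F) (fu F) hh hu uu (fa F) (fb F) => h u hh hu uu a b.
set X := c2%:~R + _ + _; set Y := d2%:~R + _ + _.
(* In this form h*h, h*u and u*u stand apart: the frame relations turn it into the left-hand side,
   and it equals the right-hand side in any commutative ring. *)
transitivity (c0%:~R * d0%:~R + (c0%:~R * d1%:~R + c1%:~R * d0%:~R) * h
  + (c0%:~R * Y + d0%:~R * X) * u + c1%:~R * d1%:~R * (h * h)
  + (c1%:~R * Y + d1%:~R * X) * (h * u) + X * Y * (u * u)).
  by rewrite hh hu uu /X /Y; ring.
by ring.
Qed.

Lemma cval_int n : cval (cint n) = n%:~R.
Proof. by rewrite /= !mul0r !addr0 mul0r addr0. Qed.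

Lemma cval0 : cval (cint 0) = 0. Proof. by rewrite cval_int. Qed.

Definition wval (s : seq A) (w : seq nat) : A := \prod_(l <- w) nth 0 s l.
Definition tval n (s : seq A) (W : seq (seq nat)) : tpow K M n :=
  tn n (fun i => wval s (nth [::] W i)).
Definition eval1 n (s : seq A) r W : tpow K M n :=
  bsum (feps (f := F)) r (fun t => tval n (s ++ map (fvec (f := F)) t) W).
Definition eval n (s : seq A) (P : fsum) : tpow K M n :=
  \sum_(x <- P) cval x.1 *: eval1 n s x.2.1 x.2.2.

Lemma eval_nil n s : eval n s [::] = 0.
Proof. by rewrite /eval big_nil. Qed.

Lemma eval_cons n s x P :
  eval n s (x :: P) = cval x.1 *: eval1 n s x.2.1 x.2.2 + eval n s P.
Proof. by rewrite /eval big_cons. Qed.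

Lemma eval_cat n s P Q : eval n s (P ++ Q) = eval n s P + eval n s Q.
Proof. by rewrite /eval big_cat. Qed.

Lemma eval_seq1 n s c r W : eval n s [:: (c, (r, W))] = cval c *: eval1 n s r W.
Proof. by rewrite /eval big_seq1. Qed.

Lemma eval_prune n s P : eval n s (fprune P) = eval n s P.
Proof.
rewrite /eval big_filter big_mkcond; apply: eq_bigr => x _.
by case: eqP => //= ->; rewrite cval0 scale0r.
Qed.

Lemma eval_scale n s c P : eval n s (fscale c P) = cval c *: eval n s P.
Proof.
rewrite /eval big_map scaler_sumr; apply: eq_bigr => x _.
by rewrite cvalM scalerA.
Qed.

Lemma eval_sub n s P Q : eval n s (fsub P Q) = eval n s P - eval n s Q.
Proof. by rewrite eval_cat eval_scale cval_int scaleN1r. Qed.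

Lemma eval_one n s : eval n s (fone n) = 1.
Proof.
rewrite eval_seq1 cval_int scale1r /eval1 /= /tval; apply: tn_1 => i lt_in.
by rewrite nth_nseq lt_in /wval big_nil.
Qed.

Lemma eval_word s w : eval 1 s (fword w) = wval s w.
Proof. by rewrite eval_seq1 cval_int scale1r /eval1 /= /tval tn1E cats0. Qed.

(* Letters that are out of range have the junk value 0; the shift keeps them
   out of range. *)
Lemma nth_lsh (s t s' : seq A) l :
  nth 0 (s ++ t ++ s') (lsh (size s) (size t) l) = nth 0 (s ++ s') l.
Proof.
rewrite /lsh; case: ltnP => lm; first by rewrite !nth_cat lm.
rewrite !nth_cat [(l < _)%N]ltnNge lm.
rewrite ltnNge (leq_trans lm (leq_addr _ _)) /= -addnBAC // ltnNge leq_addl /=.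
by rewrite addnK.
Qed.

Lemma wval_lsh s t s' w m r : size s = m -> size t = r ->
  wval (s ++ t ++ s') (map (lsh m r) w) = wval (s ++ s') w.
Proof.
move=> <- <-; rewrite /wval big_map; apply: eq_bigr => l _; exact: nth_lsh.
Qed.

Lemma wval_lshr s t w m r : size s = m -> size t = r ->
  wval (s ++ t) (map (lsh m r) w) = wval s w.
Proof.
by move=> sm tr; have := wval_lsh [::] w sm tr; rewrite !cats0.
Qed.

Lemma wval_cat s w w' : wval s (w ++ w') = wval s w * wval s w'.
Proof. by rewrite /wval big_cat. Qed.

(** The part common to products and tensor products: for a bilinear operation it is enough to
    compare single terms with coefficient 1. *)
Lemma eval_allpairs n p q s P Q (c : tpow K M p -> tpow K M q -> tpow K M n)
    (C : coef5 * (nat * seq (seq nat)) -> coef5 * (nat * seq (seq nat)) ->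
         seq (seq nat)) :
  (forall k x y z, c (k *: x + y) z = k *: c x z + c y z) ->
  (forall k x y z, c x (k *: y + z) = k *: c x y + c x z) ->
  (forall x y, eval1 n s (x.2.1 + y.2.1) (C x y)
               = c (eval1 p s x.2.1 x.2.2) (eval1 q s y.2.1 y.2.2)) ->
  eval n s [seq (cmul x.1 y.1, ((x.2.1 + y.2.1)%N, C x y)) | x <- P, y <- Q]
  = c (eval p s P) (eval q s Q).
Proof.
move=> cl cr cC.
have c0l z : c 0 z = 0 by have := cl (-1) 0 0 z; rewrite scaler0 add0r scaleN1r addNr.
have c0r z : c z 0 = 0 by have := cr (-1) z 0 0; rewrite scaler0 add0r scaleN1r addNr.
elim: P => [|x P IH]; first by rewrite !eval_nil c0l.
rewrite /= eval_cat IH eval_cons cl; congr (_ + _).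
elim: Q {IH} => [|y Q IH]; first by rewrite !eval_nil c0r scaler0.
rewrite /= eval_cons IH (eval_cons q).
rewrite (cr (cval y.1) (eval1 p s x.2.1 x.2.2) (eval1 q s y.2.1 y.2.2) (eval q s Q)).
by rewrite scalerDr scalerA -cvalM -cC.
Qed.

Lemma eval_mul n m s P Q : size s = m ->
  eval n s (fmul n m P Q) = eval n s P * eval n s Q.
Proof.
move=> sm; rewrite eval_prune.
apply: (@eval_allpairs n n n s P Q (fun x y => x * y) (fun x y => _)).
- exact: mulPl.
- exact: malg_mulPr.
move=> x y; rewrite /eval1 bsum_mul bsum_cat.
apply: eq_bsum => t st; apply: eq_bsum => t' st'.
rewrite /tval tn_mul; apply: eq_tn => i lt_in.
rewrite nth_mkseq // wval_cat map_cat; congr (_ * _).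
  by rewrite catA; apply: wval_lshr; rewrite ?size_cat size_map ?sm ?st.
by apply: wval_lsh; rewrite ?size_map.
Qed.

Lemma eval_tens p q m s P Q : size s = m ->
  eval (p + q) s (ftens p q m P Q) = eval p s P \ot eval q s Q.
Proof.
move=> sm; rewrite eval_prune.
apply: (@eval_allpairs (p + q) p q s P Q (@tens K M p q) (fun x y => _)).
- by move=> *; exact: tensPl.
- by move=> *; exact: tensPr.
move=> x y; rewrite /eval1 bsum_tens bsum_cat.
apply: eq_bsum => t st; apply: eq_bsum => t' st'.
rewrite /tval tn_tens; apply: eq_tn => i lt_in.
rewrite nth_mkseq // map_cat catA; case: ifP => _.
  by rewrite (wval_lshr _ (m := m + x.2.1)) // ?size_map ?size_cat ?size_map ?sm ?st.
by rewrite -catA (wval_lsh _ _ (m := m)) // size_map.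
Qed.

Section LetterMaps.
Variables (n m : nat) (s : seq A).
Hypothesis sm : size s = m.

Lemma eval_hom img (L : A -> tpow K M n) w :
    L 1 = 1 -> (forall x y, L (x * y) = L x * L y) ->
    (forall l, eval n s (img l) = L (nth 0 s l)) ->
  eval n s (fhom n m img w) = L (wval s w).
Proof.
move=> L1 LM Limg; elim: w => [|l w IH]; first by rewrite /wval big_nil L1 eval_one.
by rewrite /= eval_mul // Limg IH /wval big_cons LM.
Qed.

Lemma eval_ahom img (L : A -> tpow K M n) w :
    L 1 = 1 -> (forall x y, L (x * y) = L y * L x) ->
    (forall l, eval n s (img l) = L (nth 0 s l)) ->
  eval n s (fahom n m img w) = L (wval s w).
Proof.
move=> L1 LM Limg; elim: w => [|l w IH]; first by rewrite /wval big_nil L1 eval_one.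
by rewrite /= eval_mul // Limg IH /wval big_cons LM.
Qed.

Lemma eval_der (img prim : nat -> fsum) (D L : A -> tpow K M n) w :
    L 1 = 1 -> (forall x y, L (x * y) = L x * L y) ->
    D 1 = 0 -> (forall x y, D (x * y) = D x * L y + L x * D y) ->
    (forall l, eval n s (prim l) = L (nth 0 s l)) ->
    (forall l, eval n s (img l) = D (nth 0 s l)) ->
  eval n s (fder n m img prim w) = D (wval s w).
Proof.
move=> L1 LM D1 DM Lp Di; elim: w => [|l w IH].
  by rewrite /wval big_nil D1 eval_nil.
rewrite /= eval_cat !eval_mul // Lp Di IH (eval_hom _ L1 LM Lp).
by rewrite /wval big_cons DM.
Qed.

End LetterMaps.

Lemma eval_linear n n' (L : {linear tpow K M n -> tpow K M n'}) s P :
  L (eval n s P) = \sum_(x <- P) cval x.1 *: bsum (feps (f := F)) x.2.1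
    (fun t => L (tval n (s ++ map (fvec (f := F)) t) x.2.2)).
Proof.
rewrite linear_sum; apply: eq_bigr => x _.
by rewrite linearZ /= /eval1 bsum_linear.
Qed.

(** [Q] holds the letters on which [G] is known to compute [L]. The vectors of the frame have to
    satisfy it as well, because bound letters become context letters for [G]. *)
Lemma eval_bind n n' m (Q : A -> Prop) (L : tpow K M n -> tpow K M n') G s P :
    linear L -> (forall j, Q (@fvec _ _ F j)) ->
    (forall s' W, {in s', forall y, Q y} ->
       eval n' s' (G (size s') W) = L (tval n s' W)) ->
    size s = m -> {in s, forall y, Q y} ->
  eval n' s (fbind m G P) = L (eval n s P).
Proof.
move=> Llin Qe GL sm Qs.
pose Lc : {linear tpow K M n -> tpow K M n'} := HB.pack L (GRing.isLinear.Build _ _ _ _ L Llin).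
rewrite -[L _]/(Lc _) eval_linear eval_prune /eval big_flatten big_map.
apply: eq_bigr => x _; rewrite big_map.
rewrite -[RHS]bsumZ /=.
transitivity (\sum_(y <- G (m + x.2.1)%N x.2.2) cval x.1 *:
    bsum (feps (f := F)) x.2.1 (fun t => cval y.1 *:
       eval1 n' (s ++ map (fvec (f := F)) t) y.2.1 y.2.2)).
  apply: eq_bigr => y _; rewrite cvalM bsumZ scalerA; congr (_ *: _).
  rewrite /eval1 bsum_cat; apply: eq_bsum => t _; apply: eq_bsum => t' _.
  by rewrite map_cat catA.
rewrite -scaler_sumr -bsum_sum bsumZ; congr (_ *: _).
apply: eq_bsum => t st; rewrite -[L _]GL; first by rewrite size_cat size_map sm st.
by move=> y; rewrite mem_cat => /orP[/Qs|/mapP[j _ ->]].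
Qed.

(** The condition [L 0 = 0] takes care of letters out of range, which have the value 0 and the empty
    formal sum. *)
Lemma eval_rebase n m s P (Q : A -> Prop) (L : A -> tpow K M n) l :
    L 0 = 0 -> (forall y, Q y -> eval n [:: y] P = L y) ->
    size s = m -> {in s, forall y, Q y} ->
  eval n s (rebase m l P) = L (nth 0 s l).
Proof.
move=> L0 LP sm Qs; rewrite /rebase; case: ltnP => lm; last first.
  by rewrite eval_nil nth_default ?sm.
rewrite -LP; last by apply: Qs; rewrite mem_nth ?sm.
rewrite /eval big_map; apply: eq_bigr => x _; congr (_ *: _).
apply: eq_bsum => t _; apply: eq_tn => i _ /=.
case: (ltnP i (size x.2.2)) => ix; last first.
  by rewrite !(nth_default [::]) ?size_map // /wval !big_nil.
rewrite (nth_map [::]) // /wval big_map; apply: eq_bigr => -[|k] _ /=.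
  by rewrite nth_cat sm lm.
by rewrite nth_cat -{1}sm ltnNge leq_addr /= sm addKn.
Qed.

Lemma eval1_ren n m s rW : size s = m ->
  eval1 n s (fren m rW).1 (fren m rW).2 = eval1 n s rW.1 rW.2.
Proof.
case: rW => r W sm; rewrite /fren; set p := map _ (iota 0 r).
case: ifP => //= pr; have sp : size p = r by rewrite size_map size_iota.
rewrite /eval1 [RHS](bsum_perm (fidx0 F) _ _ pr); apply: eq_bsum => t st.
apply: eq_tn => i _.
case: (ltnP i (size W)) => iW; last first.
  by rewrite !(nth_default [::]) ?size_map // /wval !big_nil.
rewrite (nth_map [::]) // /wval big_map; apply: eq_bigr => l _.
case: ltnP => lm; first by rewrite !nth_cat sm lm.
rewrite !nth_cat sm ltnNge leq_addr ltnNge lm /= addKn.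
(* A letter out of range is renamed to [m + r], again out of range, so both sides read the default
   value 0. *)
case: (ltnP (l - m) r) => lr; last first.
  by rewrite (nth_default r) ?sp // !(nth_default 0) ?size_map ?size_iota ?st.
have : nth r p (l - m) \in iota 0 r by rewrite -(perm_mem pr) mem_nth ?sp.
rewrite mem_iota /= add0n => pl.
rewrite (nth_map (fidx0 F)) ?st // (nth_map (fidx0 F)) ?size_map ?size_iota //.
by rewrite (nth_map r) ?sp.
Qed.

Lemma eval_ins n s x P :
  eval n s (fins x P) = cval x.1 *: eval1 n s x.2.1 x.2.2 + eval n s P.
Proof.
elim: P => [|y P IH] /=; first by rewrite eval_cons.
case: eqP => [->|_]; rewrite !eval_cons /=.
  by rewrite cvalD scalerDl addrA.
by rewrite IH addrCA.
Qed.

Lemma eval_norm n m s P : size s = m -> eval n s (fnorm m P) = eval n s P.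
Proof.
move=> sm; rewrite eval_prune; elim: P => [|x P IH] //=.
by rewrite eval_ins /= eval1_ren // IH eval_cons.
Qed.

(** The reflection step behind the [vm_compute] checks. Only soundness is proved: if the normal form
    of the difference is empty, the values agree in every frame. *)
Lemma eval_eq n m s P Q : size s = m -> nilp (fnorm m (fsub P Q)) ->
  eval n s P = eval n s Q.
Proof.
move=> sm /nilP PQ; apply/eqP; rewrite -subr_eq0 -eval_sub -(eval_norm _ _ sm) PQ.
by rewrite eval_nil.
Qed.

End Interpretation.

(** * Formal linear maps *)

(** Weakening of a sum in the empty context: all its letters are bound, so all of them move past the
    m new context letters. *)
Definition flift m (P : fsum) : fsum :=
  [seq (x.1, (x.2.1, map (map (addn m)) x.2.2)) | x <- P].

(** In these names the digit 1 marks the tensor factor to which [phi] is applied, 0 a factor left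
    alone; q is the number of factors that [phi] produces. *)
Definition fmap10 q (phi : nat -> seq nat -> fsum) m W : fsum :=
  ftens q 1 m (phi m (nth [::] W 0)) (fword (nth [::] W 1)).
Definition fmap01 q (phi : nat -> seq nat -> fsum) m W : fsum :=
  ftens 1 q m (fword (nth [::] W 0)) (phi m (nth [::] W 1)).
Definition fmap100 q (phi : nat -> seq nat -> fsum) m W : fsum :=
  ftens (q + 1) 1 m (fmap10 q phi m W) (fword (nth [::] W 2)).
Definition fmap010 q (phi : nat -> seq nat -> fsum) m W : fsum :=
  ftens (1 + q) 1 m (fmap01 q phi m W) (fword (nth [::] W 2)).
Definition fmap001 q (phi : nat -> seq nat -> fsum) m W : fsum :=
  ftens 2 q m (ftens 1 1 m (fword (nth [::] W 0)) (fword (nth [::] W 1)))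
    (phi m (nth [::] W 2)).

Lemma mlin_antimorph (K : comNzRingType) (W : monomType) (B : lalgType K) (f : W -> B) :
    (forall c (a b : B), a * (c *: b) = c *: (a * b)) ->
    (forall w z, f (mmul w z) = f z * f w) ->
  forall u v, mlin f (u * v) = mlin f v * mlin f u.
Proof.
move=> scaleBr fM u v; elim/malg_ind: u => [|c w u IHu].
  by rewrite mul0r linear0 mulr0.
rewrite mulrDl -scalerAl !mlin_is_linear IHu mulrDr scaleBr; congr (_ *: _ + _).
elim/malg_ind: v {IHu} => [|d z v IHv]; first by rewrite mulr0 linear0 mul0r.
by rewrite mulrDr malg_scalerAr !mlin_is_linear IHv mulrDl -scalerAl malgUM !mlinU fM.
Qed.

Section Contractions.
Variables (K : comNzRingType) (M : monomType).
Local Notation A := (tpow K M 1).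

Lemma eq_mlin (W : choiceType) (B : lmodType K) (f f' : W -> B) :
  f =1 f' -> mlin f =1 mlin f'.
Proof. by move=> ff u; rewrite mlin.unlock; apply: eq_bigr => w _; rewrite ff. Qed.

Lemma mlin_tens2 (B : lmodType K) (f : A -> A -> B) (u v : A) :
    (forall c a b d, f (c *: a + b) d = c *: f a d + f b d) ->
    (forall c a b d, f a (c *: b + d) = c *: f a b + f a d) ->
  mlin (fun w : {ffun 'I_2 -> M} => f (factor K w 0) (factor K w 1)) (u \ot v) = f u v.
Proof.
move=> fl fr; rewrite -(mlin_tens u v fl fr); apply: eq_mlin => w.
congr (f << _ >> << _ >>); apply/ffunP=> i; rewrite !ffunE; congr (w _);
  by apply: val_inj; rewrite (ord1 i).
Qed.

Lemma mlin_tens3 (B : lmodType K) (f : A -> A -> A -> B) (u v z : A) :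
    (forall c a a' b d, f (c *: a + a') b d = c *: f a b d + f a' b d) ->
    (forall c a b b' d, f a (c *: b + b') d = c *: f a b d + f a b' d) ->
    (forall c a b d d', f a b (c *: d + d') = c *: f a b d + f a b d') ->
  mlin (fun w : {ffun 'I_3 -> M} => f (factor K w 0) (factor K w 1) (factor K w 2%:R))
    (u \ot v \ot z) = f u v z.
Proof.
move=> f1 f2 f3.
pose g (x : tpow K M 2) (y : A) : B := mlin (fun w : {ffun 'I_2 -> M} =>
  f (factor K w 0) (factor K w 1) y) x.
have gE (x y d : A) : g (x \ot y) d = f x y d.
  by apply: (@mlin_tens2 _ (fun x y => f x y d)) => *; rewrite (f1, f2).
have gl c a b d : g (c *: a + b) d = c *: g a d + g b d by exact: linearP.
have gr c a b d : g a (c *: b + d) = c *: g a b + g a d.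
  elim/malg_ind: a => [|e w a IH]; first by rewrite /g !linear0 ?scaler0 addr0.
  by rewrite !gl IH /g !mlinU f3; apply: scaler_swap.
rewrite -gE -(mlin_tens _ _ gl gr); apply: eq_mlin => w.
rewrite /g mlinU; congr (f << _ >> << _ >> << _ >>); apply/ffunP=> i;
  rewrite !ffunE; congr (w _); by apply: val_inj; rewrite ?(ord1 i).
Qed.

Lemma tmap_tens3 p p' q q' r r' (f : {linear tpow K M p -> tpow K M p'})
    (f' : {linear tpow K M q -> tpow K M q'}) (f'' : {linear tpow K M r -> tpow K M r'})
    u v z :
  (f \otf f' \otf f'') (u \ot v \ot z) = f u \ot f' v \ot f'' z.
Proof. by rewrite tmap_tens; congr (_ \ot _); apply: tmap_tens. Qed.

End Contractions.

Section FormalMaps.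
Variables (K : comNzRingType) (M : monomType) (F : frame K M).
Local Notation A := (tpow K M 1).
Local Notation eval := (eval F).
Local Notation idA := (@idfun A).

Lemma eval_lift n m s P : size s = m -> eval n s (flift m P) = eval n [::] P.
Proof.
move=> sm; rewrite /eval big_map; apply: eq_bigr => x _; congr (_ *: _).
apply: eq_bsum => t _; apply: eq_tn => i _ /=.
case: (ltnP i (size x.2.2)) => ix; last first.
  by rewrite !(nth_default [::]) ?size_map // /wval !big_nil.
rewrite (nth_map [::]) // /wval big_map; apply: eq_bigr => l _.
by rewrite nth_cat sm ltnNge leq_addr addKn.
Qed.

Lemma eval1E n s r W : eval1 F n s r W = eval n s [:: (cint 1, (r, W))].
Proof. by rewrite eval_seq1 cval_int scale1r. Qed.

Lemma tval2E (s : seq A) W : tval 2 s W =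
  (wval s (nth [::] W 0) : A) \ot (wval s (nth [::] W 1) : A).
Proof. exact: tn2E. Qed.

Lemma tval3E (s : seq A) W : tval 3 s W =
  (wval s (nth [::] W 0) : A) \ot (wval s (nth [::] W 1) : A)
  \ot (wval s (nth [::] W 2) : A).
Proof. exact: tn3E. Qed.

Variables (Q : A -> Prop).
Hypothesis Qvec : forall j, Q (@fvec _ _ F j).

(** The restriction to letters in [Q] lets a map be represented when its closed formula is known on
    V alone. *)
Definition represents q (phi : nat -> seq nat -> fsum) (L : A -> tpow K M q) :=
  forall s w, {in s, forall y, Q y} -> eval q s (phi (size s) w) = L (wval s w).

Section OneFactor.
Variables (q : nat) (phi : nat -> seq nat -> fsum) (L : {linear A -> tpow K M q}).
Hypothesis phiL : represents phi L.
Variables (m : nat) (s : seq A) (P : fsum).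
Hypotheses (sm : size s = m) (Qs : {in s, forall y, Q y}).

Lemma eval_map10 :
  eval (q + 1) s (fbind m (fmap10 q phi) P) = (L \otf idA) (eval 2 s P).
Proof.
apply: (eval_bind (Q := Q)) => // [|s' W Qs']; first exact: mlin_is_linear.
by rewrite eval_tens // phiL // eval_word tval2E tmap_tens.
Qed.

Lemma eval_map01 :
  eval (1 + q) s (fbind m (fmap01 q phi) P) = (idA \otf L) (eval 2 s P).
Proof.
apply: (eval_bind (Q := Q)) => // [|s' W Qs']; first exact: mlin_is_linear.
by rewrite eval_tens // phiL // eval_word tval2E tmap_tens.
Qed.

Lemma eval_map100 :
  eval (q + 1 + 1) s (fbind m (fmap100 q phi) P) = (L \otf idA \otf idA) (eval 3 s P).
Proof.
apply: (eval_bind (Q := Q)) => // [|s' W Qs']; first exact: mlin_is_linear.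
by rewrite eval_tens // eval_tens // phiL // !eval_word tval3E tmap_tens3.
Qed.

Lemma eval_map010 :
  eval (1 + q + 1) s (fbind m (fmap010 q phi) P) = (idA \otf L \otf idA) (eval 3 s P).
Proof.
apply: (eval_bind (Q := Q)) => // [|s' W Qs']; first exact: mlin_is_linear.
by rewrite eval_tens // eval_tens // phiL // !eval_word tval3E tmap_tens3.
Qed.

Lemma eval_map001 :
  eval (2 + q) s (fbind m (fmap001 q phi) P) = (idA \otf idA \otf L) (eval 3 s P).
Proof.
apply: (eval_bind (Q := Q)) => // [|s' W Qs']; first exact: mlin_is_linear.
by rewrite eval_tens // (@eval_tens _ _ _ 1 1) // phiL // !eval_word tval3E tmap_tens3.
Qed.

End OneFactor.

Lemma represents_hom q (P : fsum) (L : A -> tpow K M q) :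
    L 0 = 0 -> L 1 = 1 -> (forall x y, L (x * y) = L x * L y) ->
    (forall y, Q y -> eval q [:: y] P = L y) ->
  represents (fun m w => fhom q m (fun l => rebase m l P) w) L.
Proof.
move=> L0 L1 LM LP s w Qs; apply: eval_hom => // l.
exact: (eval_rebase (Q := Q)).
Qed.

Lemma represents_ahom q (P : fsum) (L : A -> tpow K M q) :
    L 0 = 0 -> L 1 = 1 -> (forall x y, L (x * y) = L y * L x) ->
    (forall y, Q y -> eval q [:: y] P = L y) ->
  represents (fun m w => fahom q m (fun l => rebase m l P) w) L.
Proof.
move=> L0 L1 LM LP s w Qs; apply: eval_ahom => // l.
exact: (eval_rebase (Q := Q)).
Qed.

Lemma represents_der q (P P0 : fsum) (D L : A -> tpow K M q) :
    L 0 = 0 -> L 1 = 1 -> (forall x y, L (x * y) = L x * L y) ->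
    D 0 = 0 -> D 1 = 0 -> (forall x y, D (x * y) = D x * L y + L x * D y) ->
    (forall y, Q y -> eval q [:: y] P0 = L y) ->
    (forall y, Q y -> eval q [:: y] P = D y) ->
  represents (fun m w =>
    fder q m (fun l => rebase m l P) (fun l => rebase m l P0) w) D.
Proof.
move=> L0 L1 LM D0 D1 DM LP DP s w Qs; apply: (@eval_der _ _ _ _ _ _ _ _ _ _ L) => // l;
  exact: (eval_rebase (Q := Q)).
Qed.

End FormalMaps.

(** * Change of coefficients *)

Section CoefficientChange.
Variables (R S : comNzRingType) (f : {rmorphism R -> S}).

Section Module.
Variable (W : choiceType).
Implicit Types u v : {malg R[W]}.

Lemma tcoef_coef u w : (tcoef f u)@_w = f u@_w.
Proof. by rewrite tcoefE ?rmorph0. Qed.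

Lemma tcoef0 : tcoef f (0 : {malg R[W]}) = 0.
Proof. by apply/malgP => w; rewrite tcoef_coef !mcoeff0 rmorph0. Qed.

Lemma tcoefD u v : tcoef f (u + v) = tcoef f u + tcoef f v.
Proof. by apply/malgP => w; rewrite mcoeffD !tcoef_coef mcoeffD rmorphD. Qed.

Lemma tcoefN u : tcoef f (- u) = - tcoef f u.
Proof. by apply/malgP => w; rewrite mcoeffN !tcoef_coef mcoeffN rmorphN. Qed.

Lemma tcoefZ c u : tcoef f (c *: u) = f c *: tcoef f u.
Proof. by apply/malgP => w; rewrite mcoeffZ !tcoef_coef mcoeffZ rmorphM. Qed.

Lemma tcoefU w : tcoef f (<< w >> : {malg R[W]}) = << w >>.
Proof. by apply/malgP => z; rewrite tcoef_coef !mcoeffU rmorphMn rmorph1. Qed.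

Lemma tcoef_sum (I : Type) (r : seq I) (G : I -> {malg R[W]}) :
  tcoef f (\sum_(i <- r) G i) = \sum_(i <- r) tcoef f (G i).
Proof.
elim: r => [|i r IH]; first by rewrite !big_nil tcoef0.
by rewrite !big_cons tcoefD IH.
Qed.

End Module.

Lemma tcoefM (W : monomType) (u v : {malg R[W]}) :
  tcoef f (u * v) = tcoef f u * tcoef f v.
Proof.
(* The change of coefficients may shrink supports, so both product formulas are summed over the
   supports of u and v. *)
have supp (x : {malg R[W]}) : (msupp (tcoef f x) `<=` msupp x)%fset.
  apply/fsubsetP => w; rewrite -!mcoeff_neq0 tcoef_coef.
  by apply: contra_neq => ->; rewrite rmorph0.
apply/malgP => w; rewrite tcoef_coef.
rewrite (mcoeffMlw w (fsubset_refl (msupp u)) (fsubset_refl (msupp v))).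
rewrite (mcoeffMlw _ (supp u) (supp v)) rmorph_sum; apply: eq_bigr => w1 _.
rewrite rmorph_sum; apply: eq_bigr => w2 _.
by rewrite rmorphMn rmorphM !tcoef_coef.
Qed.

Lemma tcoef_lie (W : monomType) (u v : {malg R[W]}) :
  tcoef f (lie u v) = lie (tcoef f u) (tcoef f v).
Proof.
by rewrite /lie (tcoefD (u * v) (- (v * u))) (tcoefN (v * u)) (tcoefM u v) (tcoefM v u).
Qed.

Lemma tcoef_tens (M : monomType) p q (u : tpow R M p) (v : tpow R M q) :
  tcoef f (u \ot v) = tcoef f u \ot tcoef f v.
Proof. by apply/malgP => w; rewrite tcoef_coef !tens_coef !tcoef_coef rmorphM. Qed.

Lemma tcoef_tshuffle (M : monomType) n (s t : 'I_n -> 'I_n) (u : tpow R M n) :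
    cancel s t -> cancel t s ->
  tcoef f (tshuffle s u) = tshuffle s (tcoef f u).
Proof.
move=> sK tK; apply/malgP => w.
by rewrite tcoef_coef !(tshuffle_coef _ _ sK tK) tcoef_coef.
Qed.

Lemma tcoef_tn (M : monomType) n (G : nat -> tpow R M 1) :
  tcoef f (tn n G) = tn n (fun i => tcoef f (G i)).
Proof.
elim: n G => [|n IH] G /=; first exact: tcoefU.
by rewrite (@tcoef_tens M 1 n) IH.
Qed.

End CoefficientChange.

(** * The deformed coproduct on generators *)

Section Data.
Local Open Scope nat_scope.

Definition metricP : fsum := [:: (cint 1%Z, (1, [:: [:: 0]; [:: 0]]))].
Definition in1P : fsum := [:: (cint 1%Z, (0, [:: [:: 0]; [::]]))].
Definition in2P : fsum := [:: (cint 1%Z, (0, [:: [::]; [:: 0]]))].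

(** Letter 0 is x; 1 and 2 are the bound e_i, e_j. The last twelve terms follow the order of
    [Delta2], and τ shows as the reversed word 2, 1. Since [cu n p q] means (n + 2 p alpha + 2 q
    beta) h^2/2, alpha becomes [cu 0 1 0] and 1/2 - alpha becomes [cu 1 (-1) 0]. *)
Definition DeltaP : fsum :=
  [:: (cint 1%Z, (0, [:: [:: 0]; [::]]));
      (cint 1%Z, (0, [:: [::]; [:: 0]]));
      (ch 1%Z, (1, [:: [:: 1; 0]; [:: 1]]));
      (ch (-1)%Z, (1, [:: [:: 0; 1]; [:: 1]]));
      (cu 0%Z 1%Z 0%Z, (2, [:: [:: 1; 2; 0]; [:: 1; 2]]));
      (cu (-1)%Z 0%Z 0%Z, (2, [:: [:: 1; 0; 2]; [:: 1; 2]]));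
      (cu 1%Z (-1)%Z 0%Z, (2, [:: [:: 0; 1; 2]; [:: 1; 2]]));
      (cu 1%Z (-1)%Z 0%Z, (2, [:: [:: 1; 2; 0]; [:: 2; 1]]));
      (cu (-1)%Z 0%Z 0%Z, (2, [:: [:: 1; 0; 2]; [:: 2; 1]]));
      (cu 0%Z 1%Z 0%Z, (2, [:: [:: 0; 1; 2]; [:: 2; 1]]));
      (cu (-1)%Z 0%Z 1%Z, (2, [:: [:: 1; 2]; [:: 1; 2; 0]]));
      (cu 1%Z 0%Z 0%Z, (2, [:: [:: 1; 2]; [:: 1; 0; 2]]));
      (cu 0%Z 0%Z (-1)%Z, (2, [:: [:: 1; 2]; [:: 0; 1; 2]]));
      (cu 1%Z 0%Z (-1)%Z, (2, [:: [:: 2; 1]; [:: 1; 2; 0]]));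
      (cu (-1)%Z 0%Z 0%Z, (2, [:: [:: 2; 1]; [:: 1; 0; 2]]));
      (cu 0%Z 0%Z 1%Z, (2, [:: [:: 2; 1]; [:: 0; 1; 2]]))].

(* 1 + c h^2/2 [g12, g13] *)
Definition PhiP (c : int) : fsum :=
  [:: (cint 1%Z, (0, [:: [::]; [::]; [::]]));
      (cu c 0%Z 0%Z, (2, [:: [:: 0; 1]; [:: 0]; [:: 1]]));
      (cu (- c)%R 0%Z 0%Z, (2, [:: [:: 1; 0]; [:: 0]; [:: 1]]))].

End Data.

Section ConstH.
Variables (k : fieldType) (V : vectType k).
Local Notation word := {fmonom 'I_(\dim (fullv : {vspace V}))}.
Local Notation qC := (qpolyC ('X^3 : {poly k})).

Lemma hbar3 : hbar k ^+ 3 = 0.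
Proof.
have -> : hbar k ^+ 3 = in_qpoly 'X^3 ('X^3).
  by rewrite /hbar /qpolyX -(rmorphXn (in_qpoly 'X^3)).
apply/val_inj => /=.
by rewrite mk_monic_Xn Pdiv.RingMonic.rmodpp ?monicXn.
Qed.

Lemma const_h0 m : const_h (0 : TV k V m) = 0.
Proof. exact: (tcoef0 qC). Qed.

Lemma const_hD m (u v : TV k V m) : const_h (u + v) = const_h u + const_h v.
Proof. exact: (tcoefD qC). Qed.

Lemma const_hZ m c (u : TV k V m) : const_h (c *: u) = qC c *: const_h u.
Proof. exact: (tcoefZ qC). Qed.

Lemma const_hN m (u : TV k V m) : const_h (- u) = - const_h u.
Proof. exact: (tcoefN qC). Qed.

Lemma const_h_sum m (I : Type) (r : seq I) (f : I -> TV k V m) :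
  const_h (\sum_(i <- r) f i) = \sum_(i <- r) const_h (f i).
Proof. exact: (tcoef_sum qC). Qed.

Lemma const_hM m (u v : TV k V m) : const_h (u * v) = const_h u * const_h v.
Proof. exact: (tcoefM qC). Qed.

Lemma const_h1 m : const_h (1 : TV k V m) = 1.
Proof. exact: (tcoefU qC). Qed.

Lemma const_h_tn n f : const_h (tn n f : TV k V n) = tn n (fun i => const_h (f i)).
Proof. exact: (tcoef_tn qC). Qed.

Lemma const_h_gen i : const_h (gen k i : TV k V 1) = gen (kh k) i.
Proof. exact: (tcoefU qC). Qed.

Lemma const_h_iotaV (v : V) : const_h (iotaV v) =
  \sum_i qC (coord (vbasis (fullv : {vspace V})) i v) *: gen (kh k) i.
Proof.
rewrite const_h_sum; apply: eq_bigr => i _.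
by rewrite const_hZ const_h_gen.
Qed.

(** The letters of the deformed computation: this set contains both the generators, on which maps
    are defined, and the vectors e_j, in which g is diagonal. *)
Definition isV (y : TV (kh k) V 1) := exists v : V, y = const_h (iotaV v).

Lemma isV_gen i : isV (gen (kh k) i).
Proof. by exists (vbasis fullv)`_i; rewrite iotaV_basis const_h_gen. Qed.

Lemma linear_isV (B : lmodType (kh k)) (f f' : TV (kh k) V 1 -> B) :
    linear f -> linear f' -> (forall i, f (gen (kh k) i) = f' (gen (kh k) i)) ->
  forall y, isV y -> f y = f' y.
Proof.
move=> lf lf' ff y [v ->]; rewrite const_h_iotaV.
pose F : {linear TV (kh k) V 1 -> B} := HB.pack f (GRing.isLinear.Build _ _ _ _ f lf).
pose F' : {linear TV (kh k) V 1 -> B} := HB.pack f' (GRing.isLinear.Build _ _ _ _ f' lf').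
rewrite -[LHS]/(F _) -[RHS]/(F' _) !linear_sum; apply: eq_bigr => i _.
by rewrite !linearZ /= ff.
Qed.

End ConstH.

(** * The undeformed and the deformed frame *)

Section Frames.
Variables (k : fieldType) (V : vectType k).
Hypothesis char0 : [pchar k] =i pred0.
Variables (d : nat) (ep : 'I_d.+1 -> k) (e : 'I_d.+1 -> V) (alpha beta : k).
Local Notation qC := (qpolyC ('X^3 : {poly k})).
Local Notation T := (TV k V 1).
Local Notation Th := (TV (kh k) V 1).

(** The parameters h and u are read off from the proofs of the relations; here both are 0, as are a
    and b. *)
Definition frame0 : frame k (word V) :=
  Frame ord0 ep (fun j => iotaV (e j)) 0 0
    (etrans (mul0r 0) (esym (mulr0 2%:R))) (mul0r 0) (mul0r 0).

Let two_neq0 : 2%:R != 0 :> k.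
Proof. by rewrite ((pcharf0P k).1 char0). Qed.

Fact hbar_hh : hbar k * hbar k = 2%:R * (qC 2%:R^-1 * hbar k ^+ 2).
Proof.
have -> : 2%:R * (qC 2%:R^-1 * hbar k ^+ 2) = qC (2%:R * 2%:R^-1) * hbar k ^+ 2.
  by rewrite rmorphM /= rmorph_nat mulrA.
by rewrite divff // rmorph1 mul1r expr2.
Qed.

Fact hbar_hu : hbar k * (qC 2%:R^-1 * hbar k ^+ 2) = 0.
Proof. by rewrite mulrCA -exprS hbar3 mulr0. Qed.

Fact hbar_uu : qC 2%:R^-1 * hbar k ^+ 2 * (qC 2%:R^-1 * hbar k ^+ 2) = 0.
Proof. by rewrite mulrACA -exprD (exprS (hbar k) 3) hbar3 !mulr0. Qed.

(** Here [hbar_hh] fixes u as h^2/2, and a = 2 alpha, b = 2 beta absorb the denominators of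
    [Delta2]. *)
Definition frameh : frame (kh k) (word V) :=
  Frame (ord0 : 'I_d.+1) (fun j => qC (ep j)) (fun j => const_h (iotaV (e j)))
    (qC (2%:R * alpha)) (qC (2%:R * beta)) hbar_hh hbar_hu hbar_uu.

Lemma frameh_vec j : isV (@fvec _ _ frameh j).
Proof. by exists (e j). Qed.

Lemma const_bsum n r (G : seq 'I_d.+1 -> TV k V n) :
  const_h (bsum ep r G) = bsum (fun j => qC (ep j)) r (fun t => const_h (G t)).
Proof.
elim: r G => [|r IH] G //=; rewrite const_h_sum; apply: eq_bigr => j _.
by rewrite const_hZ IH.
Qed.

Lemma const_tval n (s : seq T) W :
  const_h (tval n s W) = tval n (map (@const_h k V 1) s) W.
Proof.
rewrite const_h_tn; apply: eq_tn => i _; rewrite /wval.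
elim: (nth _ W i) => [|l w IH]; first by rewrite !big_nil const_h1.
rewrite !big_cons const_hM IH; congr (_ * _).
case: (ltnP l (size s)) => ls; first by rewrite (nth_map 0).
by rewrite !nth_default ?size_map // const_h0.
Qed.

Lemma const_eval1 n s r W :
  const_h (eval1 frame0 n s r W) = eval1 frameh n (map (@const_h k V 1) s) r W.
Proof.
rewrite /eval1 const_bsum; apply: eq_bsum => t _.
by rewrite const_tval map_cat -map_comp.
Qed.

(** Restricted to integer coefficients because the two frames give different values to h and u. *)
Lemma const_eval n s P : all (fun x => x.1 == cint x.1.1.1.1.1) P ->
  const_h (eval frame0 n s P) = eval frameh n (map (@const_h k V 1) s) P.
Proof.
elim: P => [|x P IH] /=; first by rewrite !eval_nil const_h0.
case/andP=> /eqP cx /IH {}IH; rewrite !eval_cons const_hD const_hZ IH const_eval1 cx.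
by rewrite !cval_int rmorph_int.
Qed.

Variables (g : TV k V 2).
Hypothesis gE : g = \sum_j ep j *: (iotaV (e j) \ot iotaV (e j)).

Lemma eval_metric : g = eval frame0 2 [::] metricP.
Proof.
rewrite gE eval_seq1 cval_int scale1r /eval1 /=; apply: eq_bigr => j _.
by rewrite tval2E /= /wval !big_seq1.
Qed.

Lemma eval_metric_at m s : size s = m -> g = eval frame0 2 s (flift m metricP).
Proof. by move=> sm; rewrite eval_lift // -eval_metric. Qed.

Lemma eval_in1 x : in1 x = eval frame0 2 [:: iotaV x] in1P.
Proof. by rewrite -eval1E /eval1 /= tval2E /= /wval big_seq1 big_nil. Qed.

Lemma eval_in2 x : in2 x = eval frame0 2 [:: iotaV x] in2P.
Proof. by rewrite -eval1E /eval1 /= tval2E /= /wval big_seq1 big_nil. Qed.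

(** Monomials in g and x are brought to a single formal term, because on such a term τ acts by
    reversing one word. *)
Fact eval_form x (P : fsum) r W : nilp (fnorm 1 (fsub P [:: (cint 1, (r, W))])) ->
  eval frame0 2 [:: iotaV x] P = eval1 frame0 2 [:: iotaV x] r W.
Proof. by move=> PW; rewrite eval1E; apply: (@eval_eq _ _ _ _ 1). Qed.

Ltac form x := rewrite (@eval_metric_at 1 [:: iotaV x] erefl) ?expr2
  ?eval_in1 ?eval_in2 -?(@eval_mul _ _ frame0 2 1 [:: iotaV x]) //;
  apply: eval_form; vm_compute; reflexivity.

Fact form_g1 x : g * in1 x = eval1 frame0 2 [:: iotaV x] 1 [:: [:: 1; 0]; [:: 1]]%N.
Proof. form x. Qed.
Fact form_1g x : in1 x * g = eval1 frame0 2 [:: iotaV x] 1 [:: [:: 0; 1]; [:: 1]]%N.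
Proof. form x. Qed.
Fact form_gg1 x : g ^+ 2 * in1 x =
  eval1 frame0 2 [:: iotaV x] 2 [:: [:: 1; 2; 0]; [:: 1; 2]]%N.
Proof. form x. Qed.
Fact form_g1g x : g * in1 x * g =
  eval1 frame0 2 [:: iotaV x] 2 [:: [:: 1; 0; 2]; [:: 1; 2]]%N.
Proof. form x. Qed.
Fact form_1gg x : in1 x * g ^+ 2 =
  eval1 frame0 2 [:: iotaV x] 2 [:: [:: 0; 1; 2]; [:: 1; 2]]%N.
Proof. form x. Qed.
Fact form_gg2 x : g ^+ 2 * in2 x =
  eval1 frame0 2 [:: iotaV x] 2 [:: [:: 1; 2]; [:: 1; 2; 0]]%N.
Proof. form x. Qed.
Fact form_g2g x : g * in2 x * g =
  eval1 frame0 2 [:: iotaV x] 2 [:: [:: 1; 2]; [:: 1; 0; 2]]%N.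
Proof. form x. Qed.
Fact form_2gg x : in2 x * g ^+ 2 =
  eval1 frame0 2 [:: iotaV x] 2 [:: [:: 1; 2]; [:: 0; 1; 2]]%N.
Proof. form x. Qed.

Lemma tau_anti (x y : T) : tau (x * y) = tau y * tau x.
Proof.
apply: mlin_antimorph => [|w z]; first exact: malg_scalerAr.
rewrite malgUM; congr << _ >>; apply/ffunP=> i; rewrite !ffunE.
by apply/val_inj; rewrite fmM /= fmM rev_cat.
Qed.

Lemma tau_iotaV (x : V) : tau (iotaV x) = iotaV x.
Proof.
have tauP : linear (@tau k V) by exact: mlin_is_linear.
apply: (iotaV_ext (F := @tau k V) (G := idfun) tauP) => // i.
rewrite /tau mlinU /gen; congr << _ >>; apply/ffunP=> j; rewrite !ffunE.
by apply/val_inj; rewrite /= fmU.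
Qed.

(** [tau] reverses words in the generators. Being an anti-morphism that fixes V, it also reverses
    words in arbitrary vectors, in particular in the e_j. *)
Lemma tau_wval s w : {in s, forall y, exists x : V, y = iotaV x} ->
  tau (wval s w) = wval s (rev w).
Proof.
move=> Qs; rewrite /wval; elim: w => [|l w IH].
  rewrite !big_nil /tau mlinU; congr << _ >>; apply/ffunP=> j; rewrite !ffunE.
  by apply/val_inj; rewrite /= fm1.
rewrite rev_cons -cats1 big_cat big_seq1 big_cons tau_anti IH; congr (_ * _).
case: (ltnP l (size s)) => ls; last by rewrite nth_default // /tau linear0.
by have [x ->] := Qs _ (mem_nth 0 ls); apply: tau_iotaV.
Qed.

Fact form_tau2 x r w w' : (@idfun T \otf @tau k V) (eval1 frame0 2 [:: iotaV x] r [:: w; w'])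
  = eval1 frame0 2 [:: iotaV x] r [:: w; rev w'].
Proof.
rewrite /eval1 bsum_linear; apply: eq_bsum => t _.
rewrite !tval2E /= [LHS](tmap_tens idfun (mlin _)) -tau_wval // => y.
by rewrite inE => /orP[/eqP->|/mapP[j _ ->]]; eexists.
Qed.

Fact form_tau1 x r w w' : (@tau k V \otf @idfun T) (eval1 frame0 2 [:: iotaV x] r [:: w; w'])
  = eval1 frame0 2 [:: iotaV x] r [:: rev w; w'].
Proof.
rewrite /eval1 bsum_linear; apply: eq_bsum => t _.
rewrite !tval2E /= [LHS](tmap_tens (mlin _) idfun) -tau_wval // => y.
by rewrite inE => /orP[/eqP->|/mapP[j _ ->]]; eexists.
Qed.

End Frames.

(** Matches the coefficients of [Delta2] with those of [DeltaP]: c is the value of [cu] with h^2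
    removed, and the nested right-hand side ending in 0 is what unfolding the sum over the list
    yields. *)
Fact combination12 (k : fieldType) (W : lmodType k) (two0 : 2%:R != 0 :> k) (a b : k)
    (E1 E2 E3 E4 E5 E6 E7 E8 E9 E10 E11 E12 : W) :
  let c (n p q : int) : k :=
    (n%:~R + p%:~R * (2%:R * a) + q%:~R * (2%:R * b)) / 2%:R in
  let h := 2%:R^-1 : k in
  a *: E1 - h *: E2 + (h - a) *: E3 + (h - a) *: E4 - h *: E5 + a *: E6
  + (b - h) *: E7 + h *: E8 - b *: E9 + (h - b) *: E10 - h *: E11 + b *: E12
  = c 0 1 0 *: E1 + (c (-1) 0 0 *: E2 + (c 1 (-1) 0 *: E3 + (c 1 (-1) 0 *: E4
  + (c (-1) 0 0 *: E5 + (c 0 1 0 *: E6 + (c (-1) 0 1 *: E7 + (c 1 0 0 *: E8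
  + (c 0 0 (-1) *: E9 + (c 1 0 (-1) *: E10 + (c (-1) 0 0 *: E11
  + (c 0 0 1 *: E12 + 0))))))))))).
Proof.
move=> c h.
have c1 : c 0 1 0 = a by rewrite /c; field.
have c2 : c (-1) 0 0 = - h by rewrite /c /h; field.
have c3 : c 1 (-1) 0 = h - a by rewrite /c /h; field.
have c7 : c (-1) 0 1 = b - h by rewrite /c /h; field.
have c8 : c 1 0 0 = h by rewrite /c /h; field.
have c9 : c 0 0 (-1) = - b by rewrite /c; field.
have c10 : c 1 0 (-1) = h - b by rewrite /c /h; field.
have c12 : c 0 0 1 = b by rewrite /c; field.
rewrite c1 c2 c3 c7 c8 c9 c10 c12 -!scaleNr addr0 !addrA; by [].
Qed.

Fact scale_sub (R : comNzRingType) (W : lmodType R) (h : R) (E E' : W) :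
  1%:~R * h *: E + (-1)%:~R * h *: E' = h *: (E - E').
Proof. by rewrite mul1r mulN1r scaleNr scalerBr. Qed.

Fact congr12 (k : fieldType) (W : lmodType k)
    (a1 a2 a3 a4 a5 a6 a7 a8 a9 a10 a11 a12 : k)
    (E1 E2 E3 E4 E5 E6 E7 E8 E9 E10 E11 E12 : W)
    (G1 G2 G3 G4 G5 G6 G7 G8 G9 G10 G11 G12 : W) :
  E1 = G1 -> E2 = G2 -> E3 = G3 -> E4 = G4 -> E5 = G5 -> E6 = G6 ->
  E7 = G7 -> E8 = G8 -> E9 = G9 -> E10 = G10 -> E11 = G11 -> E12 = G12 ->
  a1 *: E1 - a2 *: E2 + a3 *: E3 + a4 *: E4 - a5 *: E5 + a6 *: E6
  + a7 *: E7 + a8 *: E8 - a9 *: E9 + a10 *: E10 - a11 *: E11 + a12 *: E12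
  = a1 *: G1 - a2 *: G2 + a3 *: G3 + a4 *: G4 - a5 *: G5 + a6 *: G6
  + a7 *: G7 + a8 *: G8 - a9 *: G9 + a10 *: G10 - a11 *: G11 + a12 *: G12.
Proof. by do 12 ! [move=> ->]. Qed.

Section DeltaValues.
Variables (k : fieldType) (V : vectType k).
Hypothesis char0 : [pchar k] =i pred0.
Variables (d : nat) (ep : 'I_d.+1 -> k) (e : 'I_d.+1 -> V) (alpha beta : k).
Local Notation qC := (qpolyC ('X^3 : {poly k})).
Local Notation T := (TV k V 1).
Local Notation Th := (TV (kh k) V 1).
Local Notation F0 := (frame0 ep e).
Local Notation Fh := (frameh char0 ep e alpha beta).
Variables (g : TV k V 2).
Hypothesis gE : g = \sum_j ep j *: (iotaV (e j) \ot iotaV (e j)).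

Lemma cval_ch n : cval Fh (ch n) = n%:~R * hbar k.
Proof. by rewrite /= !mul0r !addr0 mul0r addr0 add0r. Qed.

Definition cu_coef (c : coef5) : k :=
  let: (_, _, n, p, q) := c in
  (n%:~R + p%:~R * (2%:R * alpha) + q%:~R * (2%:R * beta)) / 2%:R.

Lemma cval_cu n p q : cval Fh (cu n p q) = hbar k ^+ 2 * qC (cu_coef (cu n p q)).
Proof.
have -> : qC (cu_coef (cu n p q))
    = (n%:~R + p%:~R * qC (2%:R * alpha) + q%:~R * qC (2%:R * beta)) * qC 2%:R^-1.
  rewrite (rmorphM qC) 2!(rmorphD qC) (rmorphM qC p%:~R) (rmorphM qC q%:~R).
  by rewrite !(rmorph_int qC).
by rewrite [LHS]/= mul0r !add0r [RHS]mulrC -mulrA.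
Qed.

Definition is_cu (x : coef5 * (nat * seq (seq nat))) : bool :=
  let: (_, _, n, p, q) := x.1 in x.1 == cu n p q.

Lemma eval_cu n s P : all is_cu P ->
  eval Fh n (map (@const_h k V 1) s) P = hbar k ^+ 2 *:
    const_h (\sum_(x <- P) cu_coef x.1 *: eval1 F0 n s x.2.1 x.2.2).
Proof.
elim: P => [|x P IH]; first by rewrite eval_nil big_nil const_h0 scaler0.
case/andP=> cx /IH {}IH.
have cE : cval Fh x.1 = hbar k ^+ 2 * qC (cu_coef x.1).
  move: cx; rewrite /is_cu; case: x.1 => -[[[c0 c1] c2] ca] cb /eqP[-> ->].
  exact: cval_cu.
rewrite big_cons const_hD const_hZ (const_eval1 char0 ep e alpha beta).
rewrite [RHS]scalerDr scalerA -IH -cE; exact: eval_cons.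
Qed.

Lemma Delta2_form x : Delta2 alpha beta g x = \sum_(y <- drop 4 DeltaP)
  cu_coef y.1 *: eval1 F0 2 [:: iotaV x] y.2.1 y.2.2.
Proof.
have two0 : 2%:R != 0 :> k by rewrite ((pcharf0P k).1 char0).
rewrite !big_cons big_nil [RHS]/=.
apply: etrans (combination12 two0 alpha beta _ _ _ _ _ _ _ _ _ _ _ _).
apply: congr12.
- exact: form_gg1.
- exact: form_g1g.
- exact: form_1gg.
- exact: etrans (congr1 _ (form_gg1 gE x)) (form_tau2 _ _ _ _ _ _).
- exact: etrans (congr1 _ (form_g1g gE x)) (form_tau2 _ _ _ _ _ _).
- exact: etrans (congr1 _ (form_1gg gE x)) (form_tau2 _ _ _ _ _ _).
- exact: form_gg2.
- exact: form_g2g.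
- exact: form_2gg.
- exact: etrans (congr1 _ (form_gg2 gE x)) (form_tau1 _ _ _ _ _ _).
- exact: etrans (congr1 _ (form_g2g gE x)) (form_tau1 _ _ _ _ _ _).
- exact: etrans (congr1 _ (form_2gg gE x)) (form_tau1 _ _ _ _ _ _).
Qed.

Lemma eval_DeltaP x :
  eval Fh 2 [:: const_h (iotaV x)] DeltaP =
    const_h (in1 x + in2 x) + hbar k *: const_h (Delta1 g x)
    + hbar k ^+ 2 *: const_h (Delta2 alpha beta g x).
Proof.
have E2 : eval Fh 2 [:: const_h (iotaV x)] (drop 4 DeltaP) =
    hbar k ^+ 2 *: const_h (Delta2 alpha beta g x).
  by rewrite Delta2_form; apply: (@eval_cu 2 [:: iotaV x]).
have hE n r W : eval1 Fh n [:: const_h (iotaV x)] r W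
    = const_h (eval1 F0 n [:: iotaV x] r W).
  by rewrite (const_eval1 char0 ep e alpha beta).
have E0 : eval Fh 2 [:: const_h (iotaV x)] (take 2 DeltaP) = const_h (in1 x + in2 x).
  rewrite (eval_in1 ep e) (eval_in2 ep e) -eval_cat.
  by rewrite (const_eval char0 ep e alpha beta).
have E1 : eval Fh 2 [:: const_h (iotaV x)] (take 2 (drop 2 DeltaP))
    = hbar k *: const_h (Delta1 g x).
  rewrite /Delta1 /lie (form_g1 gE) (form_1g gE) const_hD const_hN -!hE.
  by rewrite [LHS]eval_cons [X in _ + X]eval_seq1 !cval_ch; apply: scale_sub.
rewrite -E0 -E1 -E2 -!eval_cat; by [].
Qed.

End DeltaValues.

(** * Quasi-Hopf axioms *)

Section RingMaps.
Variables (K : comNzRingType) (M : monomType).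

Lemma tmapM p p' q q' (f : tpow K M p -> tpow K M p') (f' : tpow K M q -> tpow K M q') :
    (forall x y, f (x * y) = f x * f y) -> (forall x y, f' (x * y) = f' x * f' y) ->
  forall x y, (f \otf f') (x * y) = (f \otf f') x * (f \otf f') y.
Proof.
move=> fM f'M; apply: mlin_morphM => [|w z]; first exact: malg_scalerAr.
rewrite tensM -fM -f'M !malgUM; congr (f << _ >> \ot f' << _ >>);
  by apply/ffunP=> i; rewrite !ffunE.
Qed.

Lemma tensZl p q c (u : tpow K M p) (v : tpow K M q) : (c *: u) \ot v = c *: (u \ot v).
Proof. by rewrite -[c *: u]addr0 tensPl tens0l addr0. Qed.

Lemma tens_scalar0 q (c : K) (v : tpow K M q) : (c%:MP : tpow K M 0) \ot v = c *: v.
Proof.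
apply/malgP => w; rewrite (@tens_coef K M 0 q) mcoeffC mcoeffZ.
have -> : (wleft w == (mone : {ffun 'I_0 -> M}) :> {ffun 'I_0 -> M}) = true.
  by apply/eqP/ffunP; case.
by rewrite mulr1n; congr (_ * mcoeff _ _); apply/ffunP=> i; rewrite !ffunE;
  congr (w _); apply: val_inj.
Qed.

End RingMaps.

(** Words are built by multiplying by one generator on the left, so that a property compatible with
    such products is left to be checked on generators. *)
Lemma tensor_ind (K : comNzRingType) (k : fieldType) (V : vectType k)
    (P : TV K V 1 -> Prop) :
    P 1 -> (forall i u, P u -> P (gen K i * u)) ->
    (forall c u v, P u -> P v -> P (c *: u + v)) ->
  forall u, P u.
Proof.
move=> P1 Pg PD; have P0 : P 0.
  by have := PD (-1) _ _ P1 P1; rewrite scaleN1r addNr.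
elim/malg_ind => [|c w u Pu] //; apply: PD => //.
have -> : w = [ffun=> FMonom (w ord0 : seq 'I_(\dim (fullv : {vspace V})))].
  by apply/ffunP=> i; rewrite ffunE (ord1 i); case: (w ord0).
elim: (w ord0 : seq _) => [|i s IHs].
  rewrite (_ : [ffun=> FMonom [::]] = mone) //.
  by apply/ffunP=> j; rewrite !ffunE; apply/val_inj; rewrite /= fm1.
rewrite (_ : << _ >> = gen K i * << [ffun=> FMonom s] >>); first exact: Pg.
rewrite malgUM; congr << _ >>.
by apply/ffunP=> j; rewrite !ffunE; apply/val_inj; rewrite /= fmM fmU.
Qed.

Lemma bsumP (K : comNzRingType) (J : finType) (eps : J -> K) (B : lmodType K) r c
    (G H : seq J -> B) :
  bsum eps r (fun t => c *: G t + H t) = c *: bsum eps r G + bsum eps r H.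
Proof.
elim: r G H => [|r IH] G H //=; rewrite scaler_sumr -big_split.
by apply: eq_bigr => j _ /=; rewrite IH scalerDr !scalerA mulrC.
Qed.

(** A word is linear in a letter that occurs in it exactly once. This is what lets the formula for
    S, written for one letter, agree with the map defined on generators. *)
Lemma linear_eval (K : comNzRingType) (M : monomType) (F : frame K M) P :
  all (fun x => count_mem 0%N (nth [::] x.2.2 0) == 1%N) P ->
  linear (fun y => eval F 1 [:: y] P).
Proof.
move=> lin c y z; elim: P lin => [|x P IH] /=.
  by rewrite !eval_nil scaler0 addr0.
case/andP=> /eqP lin /IH {}IH.
rewrite (eval_cons F 1 [:: c *: y + z]) (eval_cons F 1 [:: y]) (eval_cons F 1 [:: z]).
rewrite IH scalerDr addrACA; congr (_ + _); rewrite scalerA mulrC -scalerA -scalerDr.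
congr (_ *: _); rewrite /eval1.
have wE t : tval 1 ((c *: y + z) :: t) x.2.2 =
    c *: tval 1 (y :: t) x.2.2 + tval 1 (z :: t) x.2.2.
  rewrite /tval !tn1E; elim: (nth _ _ _) lin => [|[|l] w IHw] //= lin.
    (* The head of the word is the only occurrence of letter 0, so the value of the rest does not
       depend on that letter. *)
    have w0 a b : wval (a :: t) w = wval (b :: t) w.
      apply: eq_big_seq => -[] //= w0.
      by move: lin => [/eqP]; rewrite -leqn0 leqNgt -has_count has_pred1 w0.
    rewrite /wval !big_cons /=.
    rewrite -!/(wval _ w) (w0 (c *: y + z) 0) (w0 y 0) (w0 z 0).
    by rewrite mulPl.
  rewrite /wval !big_cons /= -!/(wval _ w) IHw //.
  by rewrite malg_mulPr.
rewrite (eq_bsum _ (fun t _ => wE (map (fvec (f := F)) t))).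
exact: bsumP.
Qed.

Fact order1_step (K : comNzRingType) (W : lmodType K) (h u c1 x : K) (E y z : W) :
  (0%:~R + c1 * h + x * u) *: E + (h *: y + u *: z)
  = h *: (c1 *: E + y) + u *: (x *: E + z).
Proof.
by rewrite add0r !scalerDr !scalerA scalerDl addrACA (mulrC h) (mulrC u).
Qed.

Lemma eval_order1 (K : comNzRingType) (M : monomType) (F : frame K M) n s P :
  all (fun x => x.1.1.1.1.1 == 0) P ->
  exists y z, eval F n s P = fh F *: y + fu F *: z.
Proof.
elim: P => [|x P IH] /=; first by exists 0, 0; rewrite eval_nil !scaler0 addr0.
case/andP=> c0 /IH[y [z E]].
move: c0; case: x => -[[[[c0 c1] c2] ca] cb] [r W] /= /eqP ->.
exists (c1%:~R *: eval1 F n s r W + y).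
exists ((c2%:~R + ca%:~R * fa F + cb%:~R * fb F) *: eval1 F n s r W + z).
by rewrite eval_cons E; apply: order1_step.
Qed.

Definition antipodeP (S : fsum) m (w : seq nat) : fsum :=
  fahom 1 m (fun l => rebase m l S) w.

Definition fleft (S : fsum) m (W : seq (seq nat)) : fsum :=
  fmul 1 m (antipodeP S m (nth [::] W 0)) (fword (nth [::] W 1)).

Definition fright (S b : fsum) m (W : seq (seq nat)) : fsum :=
  fmul 1 m (fmul 1 m (fword (nth [::] W 0)) (flift m b)) (antipodeP S m (nth [::] W 1)).

Definition fPhi (S b : fsum) m (W : seq (seq nat)) : fsum :=
  fmul 1 m (fmul 1 m (fmul 1 m (fword (nth [::] W 0)) (flift m b))
                     (antipodeP S m (nth [::] W 1))) (fword (nth [::] W 2)).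

Definition fPhi_inv (S b : fsum) m (W : seq (seq nat)) : fsum :=
  fmul 1 m (fmul 1 m (fmul 1 m (antipodeP S m (nth [::] W 0)) (fword (nth [::] W 1)))
                     (flift m b)) (antipodeP S m (nth [::] W 2)).

(* Each step solves m (S ⊗ id) Delta = eps on V to one more order in h, starting
   from S(x) = -x. *)
Definition SP : fsum := Eval vm_compute in
  iter 2 (fun S => fnorm 1 (fsub S (fbind 1 (fleft S) DeltaP)))
    [:: (cint (-1), (0%N, [:: [:: 0%N]]))].

(* The solution b = 1 + O(h^2) of m (id ⊗ S ⊗ id) (1 ⊗ b ⊗ 1 Phi) = 1. *)
Definition bP : fsum := Eval vm_compute in
  fsub (fscale (cint 2) (fone 1)) (fnorm 0 (fbind 0 (fPhi SP (fone 1)) (PhiP (-1)))).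

Lemma eval_mulE (K : comNzRingType) (M : monomType) (F : frame K M) n m s P P' X Y :
  size s = m -> X = eval F n s P -> Y = eval F n s P' ->
  X * Y = eval F n s (fmul n m P P').
Proof. by move=> sm -> ->; rewrite eval_mul. Qed.

(** The pairs intertwined by p are closed under products. With p = Phi this reduces coassociativity
    up to Phi to generators. *)
Fact intertwine_mul (R : nzRingType) (p a b c d : R) :
  a * p = p * b -> c * p = p * d -> a * c * p = p * (b * d).
Proof. by move=> ap cp; rewrite -mulrA cp !mulrA ap. Qed.

(** * Coassociativity, counit, pentagon and the inverse of Phi *)

Section QuasiHopf.
Variables (K : comNzRingType) (k : fieldType) (V : vectType k).
Local Notation I := 'I_(\dim (fullv : {vspace V})).
Local Notation A := (TV K V 1).
Local Notation idA := (@idfun A).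
Variables (F : frame K (word V)) (Q : A -> Prop).
Hypothesis Qvec : forall j, Q (@fvec _ _ F j).
Hypothesis Qgen : forall i, Q (gen K i).
Hypothesis linear_Q : forall (B : lmodType K) (f f' : A -> B),
  linear f -> linear f' -> (forall i, f (gen K i) = f' (gen K i)) ->
  forall y, Q y -> f y = f' y.
Variable (Delta : {lrmorphism A -> TV K V 2}).
Hypothesis DeltaQ : forall y, Q y -> eval F 2 [:: y] DeltaP = Delta y.
Local Notation Phi := (eval F 3 [::] (PhiP (-1))).
Local Notation Phi' := (eval F 3 [::] (PhiP 1)).

Let DeltaM x y : Delta (x * y) = Delta x * Delta y. Proof. exact: rmorphM. Qed.
Let Delta_P c x y : Delta (c *: x + y) = c *: Delta x + Delta y.
Proof. exact: linearP. Qed.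
Let Delta_1 : Delta 1 = 1. Proof. exact: rmorph1. Qed.
Let Delta_0 : Delta 0 = 0. Proof. exact: linear0. Qed.

Let phiD m w := fhom 2 m (fun l => rebase m l DeltaP) w.

Let repD : represents F Q phiD Delta.
Proof. exact: represents_hom. Qed.

Let Qs1 i : {in [:: gen K i : A], forall y, Q y}.
Proof. by move=> y; rewrite inE => /eqP->. Qed.

Let idM (x y : A) : idA (x * y) = idA x * idA y. Proof. by []. Qed.

Fact coassoc_gen i :
  (idA \otf Delta) (Delta (gen K i)) * Phi = Phi * (Delta \otf idA) (Delta (gen K i)).
Proof.
have sz : size [:: gen K i : A] = 1%N by [].
have eD := DeltaQ (Qgen i).
have e1 : (idA \otf Delta) (Delta (gen K i)) =
    eval F 3 [:: gen K i] (fbind 1 (fmap01 2 phiD) DeltaP).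
  exact: etrans (congr1 _ (esym eD)) (esym (eval_map01 Qvec repD DeltaP sz (@Qs1 i))).
have e2 : (Delta \otf idA) (Delta (gen K i)) =
    eval F 3 [:: gen K i] (fbind 1 (fmap10 2 phiD) DeltaP).
  exact: etrans (congr1 _ (esym eD)) (esym (eval_map10 Qvec repD DeltaP sz (@Qs1 i))).
have e3 := esym (@eval_lift _ _ F 3 1 _ (PhiP (-1)) sz).
apply: etrans (eval_mulE sz e1 e3) (etrans _ (esym (eval_mulE sz e3 e2))).
by apply: (@eval_eq _ _ _ _ 1) => //; vm_compute.
Qed.

Fact coassoc u :
  (idA \otf Delta) (Delta u) * Phi = Phi * (Delta \otf idA) (Delta u).
Proof.
elim/tensor_ind: u => [|i u IH|c u v IHu IHv].
- have ID1 : (idA \otf Delta) ((1 : A) \ot (1 : A)) = 1.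
    apply: etrans (tmap_tens _ _ _ _) _.
    exact: etrans (congr1 (tens (1 : A)) Delta_1) (@tens1 K _ 1 2).
  have DI1 : (Delta \otf idA) ((1 : A) \ot (1 : A)) = 1.
    apply: etrans (tmap_tens _ _ _ _) _.
    exact: etrans (congr1 (fun x : TV K V 2 => x \ot (1 : A)) Delta_1) (@tens1 K _ 2 1).
  have -> : Delta 1 = (1 : A) \ot (1 : A) by rewrite Delta_1 tens1.
  rewrite ID1 DI1; exact: etrans (mul1r _) (esym (mulr1 _)).
- have e1 := etrans (congr1 (idA \otf Delta) (DeltaM (gen K i) u))
                    (tmapM idM DeltaM _ _).
  have e2 := etrans (congr1 (Delta \otf idA) (DeltaM (gen K i) u))
                    (tmapM DeltaM idM _ _).
  exact: etrans (congr1 ( *%R^~ _) e1)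
    (etrans (intertwine_mul (coassoc_gen i) IH) (esym (congr1 ( *%R _) e2))).
- have e1 := etrans (congr1 (idA \otf Delta) (Delta_P c u v)) (mlin_is_linear _ c _ _).
  have e2 := etrans (congr1 (Delta \otf idA) (Delta_P c u v)) (mlin_is_linear _ c _ _).
  apply: etrans (congr1 ( *%R^~ _) e1) (etrans _ (esym (congr1 ( *%R _) e2))).
  apply: etrans (mulPl _ _ _ _) (etrans _ (esym (malg_mulPr _ _ _ _))).
  exact: scaleD_congr IHu IHv.
Qed.

Lemma counit_linear : scalar (@counit K k V).
Proof. by move=> c x y; rewrite /counit mcoeffD mcoeffZ. Qed.

Lemma counit_monoid : monoid_morphism (@counit K k V).
Proof.
split; first exact: (rmorph1 (mcoeff (mone : {ffun 'I_1 -> word V}))).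
exact: (rmorphM (mcoeff (mone : {ffun 'I_1 -> word V}))).
Qed.

Lemma counit_gen i : (@counit K k V) (gen K i) = 0.
Proof.
rewrite /counit mcoeffU; case: eqP => // /ffunP/(_ ord0); rewrite !ffunE.
by move/(congr1 (fun w : word V => size (w : seq _))); rewrite fmU fm1.
Qed.

Lemma counit_Q y : Q y -> (@counit K k V) y = 0.
Proof.
apply: (@linear_Q K^o (@counit K k V) (fun=> 0)) => [c x z|c x z|i].
- exact: counit_linear.
- by rewrite scaler0 addr0.
- exact: counit_gen.
Qed.

Lemma counit_wval s w : {in s, forall y, Q y} -> (@counit K k V) (wval s w) = (w == [::])%:R.
Proof.
move=> Qs; case: w => [|l w]; rewrite /wval ?big_nil ?big_cons.
  by rewrite counit_monoid.1.
rewrite counit_monoid.2; case: (ltnP l (size s)) => ls.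
  by rewrite counit_Q ?mul0r //; apply/Qs/mem_nth.
by rewrite (nth_default 0 ls) /counit mcoeff0 mul0r.
Qed.

Local Notation eps0 := (eps_scalar (@counit K k V)).

Fact eps0_linear : linear eps0.
Proof.
move=> c x y; apply/malgP => w.
rewrite mcoeffD mcoeffZ /eps_scalar !mcoeffC counit_linear mulrnDl.
by rewrite mulrnAr.
Qed.

Let eps0L : {linear A -> TV K V 0} := HB.pack eps0 (GRing.isLinear.Build _ _ _ _ eps0 eps0_linear).

Fact eps0M x y : eps0 (x * y) = eps0 x * eps0 y.
Proof. by rewrite /eps_scalar counit_monoid.2 rmorphM. Qed.

Definition feps0 (m : nat) (W : seq (seq nat)) : fsum :=
  if nth [::] W 0 is [::] then fword (nth [::] W 1) else [::].
Definition feps1 (m : nat) (W : seq (seq nat)) : fsum :=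
  if nth [::] W 1 is [::] then fword (nth [::] W 0) else [::].
Definition feps010 m (W : seq (seq nat)) : fsum :=
  if nth [::] W 1 is [::] then
    ftens 1 1 m (fword (nth [::] W 0)) (fword (nth [::] W 2)) else [::].

Fact eps0_tens (x y : A) : (eps0 \otf idA) (x \ot y : TV K V 2) = (@counit K k V) x *: y.
Proof. exact: etrans (tmap_tens eps0L idfun x y) (tens_scalar0 _ _). Qed.

Fact tens_eps0 (x : A) (c : K) : x \ot (c%:MP : TV K V 0) = c *: x :> TV K V 1.
Proof.
apply/malgP => w; rewrite (@tens_coef K _ 1 0) mcoeffC mcoeffZ.
have -> : (@wright _ 1 0 w == (mone : {ffun 'I_0 -> word V}) :> {ffun 'I_0 -> word V}) = true.
  by apply/eqP/ffunP; case.
rewrite mulr1n mulrC; congr (_ * mcoeff _ _); apply/ffunP=> i; rewrite !ffunE.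
by congr (w _); apply: val_inj.
Qed.

Fact eps1_tens (x y : A) : (idA \otf eps0) (x \ot y : TV K V 2) = (@counit K k V) y *: x.
Proof. exact: etrans (tmap_tens idfun eps0L x y) (tens_eps0 _ _). Qed.

Fact counit_left u : (eps0 \otf idA) (Delta u) = u.
Proof.
elim/tensor_ind: u => [|i u IH|c u v IHu IHv].
- have -> : Delta 1 = (1 : A) \ot (1 : A) by rewrite Delta_1 tens1.
  by rewrite eps0_tens counit_monoid.1 scale1r.
- have e1 := etrans (congr1 (eps0 \otf idA) (DeltaM (gen K i) u)) (tmapM eps0M idM _ _).
  apply: etrans e1 (congr2 _ _ IH).
  apply: etrans (congr1 (eps0 \otf idA) (esym (DeltaQ (Qgen i)))) _.
  transitivity (eval F 1 [:: gen K i] (fbind 1 feps0 DeltaP)).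
    apply/esym/(@eval_bind _ _ _ 2 1 1 Q) => // [|s W Qs|].
    - exact: mlin_is_linear.
    - apply: esym; apply: etrans (congr1 _ (tval2E _ _)) _.
      rewrite eps0_tens counit_wval // /feps0; case: (nth _ W 0) => [|l w].
        by rewrite scale1r eval_word.
      by rewrite scale0r eval_nil.
    - exact: Qs1.
  transitivity (eval F 1 [:: gen K i] (fword [:: 0%N])).
    by apply: (@eval_eq _ _ _ _ 1) => //; vm_compute.
  by rewrite eval_word /wval big_seq1.
- apply: etrans (congr1 (eps0 \otf idA) (Delta_P c u v)) _.
  exact: etrans (mlin_is_linear _ c _ _) (scaleD_congr _ IHu IHv).
Qed.

Fact counit_right u : (idA \otf eps0) (Delta u) = u.
Proof.
elim/tensor_ind: u => [|i u IH|c u v IHu IHv].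
- have -> : Delta 1 = (1 : A) \ot (1 : A) by rewrite Delta_1 tens1.
  by rewrite eps1_tens counit_monoid.1 scale1r.
- have e1 := etrans (congr1 (idA \otf eps0) (DeltaM (gen K i) u)) (tmapM idM eps0M _ _).
  apply: etrans e1 (congr2 _ _ IH).
  apply: etrans (congr1 (idA \otf eps0) (esym (DeltaQ (Qgen i)))) _.
  transitivity (eval F 1 [:: gen K i] (fbind 1 feps1 DeltaP)).
    apply/esym/(@eval_bind _ _ _ 2 1 1 Q) => // [|s W Qs|].
    - exact: mlin_is_linear.
    - apply: esym; apply: etrans (congr1 _ (tval2E _ _)) _.
      rewrite eps1_tens counit_wval // /feps1; case: (nth _ W 1) => [|l w].
        by rewrite scale1r eval_word.
      by rewrite scale0r eval_nil.
    - exact: Qs1.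
  transitivity (eval F 1 [:: gen K i] (fword [:: 0%N])).
    by apply: (@eval_eq _ _ _ _ 1) => //; vm_compute.
  by rewrite eval_word /wval big_seq1.
- apply: etrans (congr1 (idA \otf eps0) (Delta_P c u v)) _.
  exact: etrans (mlin_is_linear _ c _ _) (scaleD_congr _ IHu IHv).
Qed.

Fact middle_tens (x y z : A) : (idA \otf eps0 \otf idA) (x \ot y \ot z : TV K V 3)
  = (@counit K k V) y *: (x \ot z).
Proof.
apply: etrans (tmap_tens3 idfun eps0L idfun x y z) _.
exact: etrans (congr1 (fun t : A => t \ot z) (tens_eps0 x _)) (tensZl _ _ _).
Qed.

Fact counit_middle : (idA \otf eps0 \otf idA) Phi = 1 :> TV K V 2.
Proof.
transitivity (eval F 2 [::] (fbind 0 feps010 (PhiP (-1)))).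
  apply/esym/(@eval_bind _ _ _ 3 2 0 Q) => // [|s W Qs]; first exact: mlin_is_linear.
  apply: esym; apply: etrans (congr1 _ (tval3E _ _)) _.
  rewrite middle_tens counit_wval // /feps010; case: (nth _ W 1) => [|l w].
    by rewrite scale1r (@eval_tens _ _ _ 1 1) // !eval_word.
  by rewrite scale0r eval_nil.
apply: etrans (@eval_one _ _ F 2 [::]).
by apply: (@eval_eq _ _ _ _ 0) => //; vm_compute.
Qed.

Fact pentagon :
  (idA \otf idA \otf Delta) Phi * (Delta \otf idA \otf idA) Phi
  = (1 : A) \ot Phi * (idA \otf Delta \otf idA) Phi * (Phi \ot (1 : A)) :> TV K V 4.
Proof.
have sz : size ([::] : seq A) = 0%N by [].
have Q0 : {in ([::] : seq A), forall y, Q y} by [].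
have e1 := esym (eval_map001 Qvec repD (PhiP (-1)) sz Q0).
have e2 := esym (eval_map100 Qvec repD (PhiP (-1)) sz Q0).
have e3 := esym (eval_map010 Qvec repD (PhiP (-1)) sz Q0).
have e4 : (1 : A) \ot Phi = eval F 4 [::] (ftens 1 3 0 (fone 1) (PhiP (-1))).
  by rewrite (@eval_tens _ _ _ 1 3) // eval_one.
have e5 : Phi \ot (1 : A) = eval F 4 [::] (ftens 3 1 0 (PhiP (-1)) (fone 1)).
  by rewrite (@eval_tens _ _ _ 3 1) // eval_one.
apply: etrans (eval_mulE sz e1 e2) (etrans _ (esym (eval_mulE sz (eval_mulE sz e4 e3) e5))).
by apply: (@eval_eq _ _ _ _ 0) => //; vm_compute.
Qed.

Fact Phi_inv_r : Phi * Phi' = 1.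
Proof.
have sz : size ([::] : seq A) = 0%N by [].
apply: etrans (eval_mulE sz erefl erefl) (etrans _ (@eval_one _ _ F 3 [::])).
by apply: (@eval_eq _ _ _ _ 0) => //; vm_compute.
Qed.

Fact Phi_inv_l : Phi' * Phi = 1.
Proof.
have sz : size ([::] : seq A) = 0%N by [].
apply: etrans (eval_mulE sz erefl erefl) (etrans _ (@eval_one _ _ F 3 [::])).
by apply: (@eval_eq _ _ _ _ 0) => //; vm_compute.
Qed.

End QuasiHopf.

Lemma tens_ext (K : comNzRingType) (M : monomType) p q (B : lmodType K)
    (f f' : tpow K M (p + q) -> B) : linear f -> linear f' ->
    (forall (x : tpow K M p) (y : tpow K M q), f (x \ot y) = f' (x \ot y)) ->
  forall u, f u = f' u.
Proof.
move=> lf lf' ff.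
have zf : f 0 = 0 by have := lf (-1) 0 0; rewrite scaler0 addr0 scaleN1r addNr.
have zf' : f' 0 = 0 by have := lf' (-1) 0 0; rewrite scaler0 addr0 scaleN1r addNr.
elim/malg_ind => [|c w u IH]; first by rewrite zf zf'.
rewrite lf lf' IH; congr (_ *: _ + _).
have -> : w = wcat (wleft w) (wright w) by apply/eqP; rewrite eq_sym eq_wcat !eqxx.
by rewrite -tensUU ff.
Qed.

Fact mul1_Pl (K : comNzRingType) (B : lalgType K) (c : K) (x y a z : B) :
  (c *: x + y) * a * z = c *: (x * a * z) + y * a * z.
Proof. by rewrite !mulrDl !scalerAl. Qed.

Fact mul3_Pl (K : comNzRingType) (B : lalgType K) (c : K) (x y a z t w : B) :
  (c *: x + y) * a * z * t * w = c *: (x * a * z * t * w) + y * a * z * t * w.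
Proof. by rewrite !mulrDl !scalerAl. Qed.

Fact mul3_mid (K : comNzRingType) (W : monomType) (c : K) (p q x y r t : {malg K[W]}) :
  p * q * (c *: x + y) * r * t = c *: (p * q * x * r * t) + p * q * y * r * t.
Proof. by rewrite malg_mulPr; exact: mul1_Pl. Qed.

(** * The quasi-antipode *)

Section Antipode.
Variables (K : comNzRingType) (k : fieldType) (V : vectType k).
Local Notation I := 'I_(\dim (fullv : {vspace V})).
Local Notation A := (TV K V 1).
Variables (F : frame K (word V)) (Q : A -> Prop).
Hypothesis Qvec : forall j, Q (@fvec _ _ F j).
Hypothesis Qgen : forall i, Q (gen K i).
Hypothesis linear_Q : forall (B : lmodType K) (f f' : A -> B),
  linear f -> linear f' -> (forall i, f (gen K i) = f' (gen K i)) ->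
  forall y, Q y -> f y = f' y.
Variable (Delta : {lrmorphism A -> TV K V 2}).
Hypothesis DeltaQ : forall y, Q y -> eval F 2 [:: y] DeltaP = Delta y.

Definition antipode : A -> A := mlin (fun w : {ffun 'I_1 -> word V} =>
  \prod_(i <- rev (w ord0 : seq I)) eval F 1 [:: gen K i] SP).
Local Notation S := antipode.
Local Notation b := (eval F 1 [::] bP).

Lemma antipode_linear : linear S. Proof. exact: mlin_is_linear. Qed.

Lemma antipode1 : S 1 = 1.
Proof. by rewrite /S mlinU ffunE fm1 big_nil. Qed.

Lemma antipodeM x y : S (x * y) = S y * S x.
Proof.
apply: mlin_antimorph => [|w z]; first exact: malg_scalerAr.
by rewrite ffunE fmM rev_cat big_cat.
Qed.

(** [SP] is a formula in an arbitrary letter while S is defined on generators; both are linear in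
    the letter, hence agree on [Q]. *)
Lemma antipode_Q y : Q y -> eval F 1 [:: y] SP = S y.
Proof.
apply: (@linear_Q A (fun y => eval F 1 [:: y] SP)) => [||i].
- exact: linear_eval.
- exact: antipode_linear.
by rewrite /S mlinU ffunE fmU big_seq1.
Qed.

Let S0 : S 0 = 0. Proof. exact: linear0. Qed.

Let repS : represents F Q (antipodeP SP) S.
Proof.
apply: represents_ahom => //; [exact: antipode1|exact: antipodeM|exact: antipode_Q].
Qed.

Let Qs1 i : {in [:: gen K i : A], forall y, Q y}.
Proof. by move=> y; rewrite inE => /eqP->. Qed.

(** The factor 1 is the element a of the quasi-antipode, kept to match the shape of the axiom. *)
Definition mulL (u : TV K V 2) : A := mlin (fun w : {ffun 'I_2 -> word V} =>
  S (factor K w 0) * 1 * factor K w 1) u.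
Definition mulR (u : TV K V 2) : A := mlin (fun w : {ffun 'I_2 -> word V} =>
  factor K w 0 * b * S (factor K w 1)) u.

Fact mulL_linear : linear mulL. Proof. exact: mlin_is_linear. Qed.
Fact mulR_linear : linear mulR. Proof. exact: mlin_is_linear. Qed.

Fact mulL_tens (x y : A) : mulL (x \ot y) = S x * 1 * y.
Proof.
apply: (@mlin_tens2 K _ _ (fun x y : A => S x * 1 * y)) => [c u v z|c z u v].
  by rewrite antipode_linear; exact: mul1_Pl.
exact: malg_mulPr.
Qed.

Fact mulR_tens (x y : A) : mulR (x \ot y) = x * b * S y.
Proof.
apply: (@mlin_tens2 K _ _ (fun x y : A => x * b * S y)) => [c u v z|c z u v].
  exact: mul1_Pl.
by rewrite antipode_linear; exact: malg_mulPr.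
Qed.

(** S reverses products, so the contraction of X (r ⊗ t) is S(r) mulL(X) t: X sits in the middle,
    and if it contracts to a scalar, that scalar comes out and S(r) t remains. *)
Fact mulL_mul X Y c : mulL X = c *: (1 : A) -> mulL (X * Y) = c *: mulL Y.
Proof.
move=> Xc; apply: (@tens_ext K _ 1 1 _ (fun Y => mulL (X * Y)) (fun Y => c *: mulL Y)).
- by move=> a x y; exact: etrans (congr1 mulL (malg_mulPr _ _ _ _)) (mulL_linear _ _ _).
- move=> a x y; apply: etrans (congr1 _ (mulL_linear _ _ _)) _.
  by rewrite scalerDr !scalerA mulrC.
move=> r t; rewrite mulL_tens mulr1 scalerAl.
have -> : c *: S r = S r * mulL X by rewrite Xc malg_scalerAr mulr1.
move: (X); apply: (@tens_ext K _ 1 1 _ (fun X => mulL (X * (r \ot t)))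
  (fun X => S r * mulL X * t)) => [a x y|a x y|x y].
- exact: etrans (congr1 mulL (mulPl _ _ _ _)) (mulL_linear _ _ _).
- apply: etrans (congr1 (fun z => S r * z * t) (mulL_linear _ _ _)) _.
  by rewrite malg_mulPr; exact: mulPl.
apply: etrans (congr1 mulL (@tensM K _ 1 1 _ _ _ _)) _.
by rewrite !mulL_tens antipodeM !mulr1 !mulrA.
Qed.

(** The mirror image of [mulL_mul]: now Y sits inside, and (x ⊗ y) Y contracts to x mulR(Y) S(y), so
    Y has to contract to a multiple of b. *)
Fact mulR_mul X Y c : mulR Y = c *: b -> mulR (X * Y) = c *: mulR X.
Proof.
move=> Yc; apply: (@tens_ext K _ 1 1 _ (fun X => mulR (X * Y)) (fun X => c *: mulR X)).
- by move=> a x y; exact: etrans (congr1 mulR (mulPl _ _ _ _)) (mulR_linear _ _ _).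
- move=> a x y; apply: etrans (congr1 _ (mulR_linear _ _ _)) _.
  by rewrite scalerDr !scalerA mulrC.
move=> x y; rewrite mulR_tens scalerAl -malg_scalerAr -Yc.
move: (Y); apply: (@tens_ext K _ 1 1 _ (fun Y => mulR ((x \ot y) * Y))
  (fun Y => x * mulR Y * S y)) => [a r t|a r t|r t].
- exact: etrans (congr1 mulR (malg_mulPr _ _ _ _)) (mulR_linear _ _ _).
- apply: etrans (congr1 (fun z => x * z * S y) (mulR_linear _ _ _)) _.
  by rewrite malg_mulPr; exact: mulPl.
apply: etrans (congr1 mulR (@tensM K _ 1 1 _ _ _ _)) _.
by rewrite !mulR_tens antipodeM !mulrA.
Qed.

Fact mulL_eval m s P : size s = m -> {in s, forall y, Q y} ->
  eval F 1 s (fbind m (fleft SP) P) = mulL (eval F 2 s P).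
Proof.
move=> sm Qs; apply: (@eval_bind _ _ _ 2 1 m Q) => // [|s' W Qs'].
  exact: mulL_linear.
apply: esym; apply: etrans (congr1 _ (tval2E _ _)) _.
have ew w : wval s' w = _ := esym (eval_word F s' w).
have es w := esym (repS w Qs').
apply: etrans (mulL_tens _ _) (etrans (congr1 ( *%R^~ _) (mulr1 _)) _).
exact: eval_mulE erefl (es _) (ew _).
Qed.

Fact mulR_eval m s P : size s = m -> {in s, forall y, Q y} ->
  eval F 1 s (fbind m (fright SP bP) P) = mulR (eval F 2 s P).
Proof.
move=> sm Qs; apply: (@eval_bind _ _ _ 2 1 m Q) => // [|s' W Qs'].
  exact: mulR_linear.
apply: esym; apply: etrans (congr1 _ (tval2E _ _)) _.
have ew w : wval s' w = _ := esym (eval_word F s' w).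
have es w := esym (repS w Qs').
have eb := esym (@eval_lift _ _ F 1 _ s' bP erefl).
exact: etrans (mulR_tens _ _) (eval_mulE erefl (eval_mulE erefl (ew _) eb) (es _)).
Qed.

Local Notation counit := (@counit K k V).

Fact antipode_left u : mulL (Delta u) = counit u *: 1.
Proof.
elim/tensor_ind: u => [|i u IH|c u v IHu IHv].
- have -> : Delta 1 = (1 : A) \ot (1 : A) by rewrite rmorph1 tens1.
  by rewrite mulL_tens antipode1 (@counit_monoid K k V).1 scale1r !mulr1.
- rewrite (@counit_monoid K k V).2 (rmorphM Delta) counit_gen mul0r scale0r.
  have L0 : mulL (Delta (gen K i)) = 0 *: (1 : A).
    apply: etrans (congr1 mulL (esym (DeltaQ (Qgen i)))) _.
    apply: etrans (esym (@mulL_eval 1 [:: gen K i] DeltaP erefl (@Qs1 i))) _.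
    apply: etrans _ (esym (scale0r _)); apply: etrans _ (@eval_nil _ _ F 1 [:: gen K i]).
    by apply: (@eval_eq _ _ _ _ 1) => //; vm_compute.
  by rewrite (mulL_mul _ L0) scale0r.
- apply: etrans (congr1 mulL (linearP Delta _ _ _)) _.
  apply: etrans (mulL_linear _ _ _) _.
  rewrite counit_linear scalerDl -scalerA; exact: scaleD_congr IHu IHv.
Qed.

Fact antipode_right u : mulR (Delta u) = counit u *: b.
Proof.
elim/tensor_ind: u => [|i u IH|c u v IHu IHv].
- have -> : Delta 1 = (1 : A) \ot (1 : A) by rewrite rmorph1 tens1.
  by rewrite mulR_tens antipode1 (@counit_monoid K k V).1 scale1r mul1r mulr1.
- rewrite (@counit_monoid K k V).2 (rmorphM Delta) counit_gen mul0r scale0r.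
  have R0 : mulR (Delta (gen K i)) = 0.
    apply: etrans (congr1 mulR (esym (DeltaQ (Qgen i)))) _.
    apply: etrans (esym (@mulR_eval 1 [:: gen K i] DeltaP erefl (@Qs1 i))) _.
    apply: etrans _ (@eval_nil _ _ F 1 [:: gen K i]).
    by apply: (@eval_eq _ _ _ _ 1) => //; vm_compute.
  by rewrite (mulR_mul _ IH) R0 scaler0.
- apply: etrans (congr1 mulR (linearP Delta _ _ _)) _.
  apply: etrans (mulR_linear _ _ _) _.
  rewrite counit_linear scalerDl -scalerA; exact: scaleD_congr IHu IHv.
Qed.

Let Q0 : {in ([::] : seq A), forall y, Q y}. Proof. by []. Qed.

Fact antipode_on_Phi : mlin (fun w : {ffun 'I_3 -> word V} =>
    factor K w 0 * b * S (factor K w 1) * 1 * factor K w 2%:R)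
  (eval F 3 [::] (PhiP (-1))) = 1.
Proof.
set L := mlin _.
have L_tens (x y z : A) : L (x \ot y \ot z) = x * b * S y * 1 * z.
  apply: (@mlin_tens3 K _ _ (fun x y z : A => x * b * S y * 1 * z)) => [c u v p q|c p u v q|c p q u v].
  - exact: mul3_Pl.
  - by rewrite antipode_linear; exact: mul3_mid.
  - exact: malg_mulPr.
transitivity (eval F 1 [::] (fbind 0 (fPhi SP bP) (PhiP (-1)))).
  apply/esym/(@eval_bind _ _ _ 3 1 0 Q) => // [|s W Qs]; first exact: mlin_is_linear.
  apply: esym; apply: etrans (congr1 _ (tval3E _ _)) _.
  have ew w : wval s w = _ := esym (eval_word F s w).
  have es w := esym (repS w Qs).
  have eb := esym (@eval_lift _ _ F 1 _ s bP erefl).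
  apply: etrans (L_tens _ _ _) (etrans (congr1 ( *%R^~ _) (mulr1 _)) _).
  exact: eval_mulE erefl (eval_mulE erefl (eval_mulE erefl (ew _) eb) (es _)) (ew _).
apply: etrans (@eval_one _ _ F 1 [::]).
by apply: (@eval_eq _ _ _ _ 0) => //; vm_compute.
Qed.

Fact antipode_on_Phi_inv : mlin (fun w : {ffun 'I_3 -> word V} =>
    S (factor K w 0) * 1 * factor K w 1 * b * S (factor K w 2%:R))
  (eval F 3 [::] (PhiP 1)) = 1.
Proof.
set L := mlin _.
have L_tens (x y z : A) : L (x \ot y \ot z) = S x * 1 * y * b * S z.
  apply: (@mlin_tens3 K _ _ (fun x y z : A => S x * 1 * y * b * S z)) => [c u v p q|c p u v q|c p q u v].
  - by rewrite antipode_linear; exact: mul3_Pl.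
  - exact: mul3_mid.
  - by rewrite antipode_linear; exact: malg_mulPr.
transitivity (eval F 1 [::] (fbind 0 (fPhi_inv SP bP) (PhiP 1))).
  apply/esym/(@eval_bind _ _ _ 3 1 0 Q) => // [|s W Qs]; first exact: mlin_is_linear.
  apply: esym; apply: etrans (congr1 _ (tval3E _ _)) _.
  have ew w : wval s w = _ := esym (eval_word F s w).
  have es w := esym (repS w Qs).
  have eb := esym (@eval_lift _ _ F 1 _ s bP erefl).
  apply: etrans (L_tens _ _ _) _.
  apply: etrans (congr1 (fun x => x * _ * b * _) (mulr1 _)) _.
  exact: eval_mulE erefl (eval_mulE erefl (eval_mulE erefl (es _) (ew _)) eb) (es _).
apply: etrans (@eval_one _ _ F 1 [::]).
by apply: (@eval_eq _ _ _ _ 0) => //; vm_compute.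
Qed.

End Antipode.

(* S o S = 1 + N with N^3 = 0. *)
Lemma bijective_of_unipotent_square (K : comNzRingType) (W : lmodType K) (h u : K)
    (S : W -> W) : h * h = 2%:R * u -> h * u = 0 -> u * u = 0 -> linear S ->
    (forall x, exists y z, S (S x) = x + (h *: y + u *: z)) -> bijective S.
Proof.
move=> hh hu uu linS SS.
have [N Ndef] : {N : W -> W | forall x, N x = S (S x) - x} by exists (fun x => S (S x) - x).
have linN : linear N by move=> c x y; rewrite !Ndef !linS scalerBr opprD addrACA.
pose NL : {linear W -> W} := HB.pack N (GRing.isLinear.Build _ _ _ _ N linN).
have NE x : exists y z, N x = h *: y + u *: z.
  by have [y [z e]] := SS x; exists y, z; rewrite Ndef e addrC addKr.
have uh : u * h = 0 by rewrite mulrC.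
have NNN x : N (N (N x)) = 0.
  have [y [z ->]] := NE x; have [y1 [z1 yE]] := NE y; have [y2 [z2 zE]] := NE z.
  (* Applying N repeatedly raises the order: values lie in hW + uW, then in 2uW because h h = 2u and
     h u = u u = 0, and then vanish. *)
  have -> : N (h *: y + u *: z) = (2%:R * u) *: y1.
    rewrite -[N _]/(NL _) linearD !linearZ /= yE zE !scalerDr !scalerA hh hu uh uu.
    by rewrite !scale0r !addr0.
  have [y3 [z3 e]] := NE y1.
  rewrite -[N _]/(NL _) linearZ /= e scalerDr !scalerA -!mulrA uh uu mulr0.
  by rewrite !scale0r addr0.
(* The geometric series for the inverse of 1 + N, which stops because N^3 = 0. *)
pose R x := x - N x + N (N x).
have ND a b : N (a + b) = N a + N b by rewrite -[N _]/(NL _) linearD.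
have NB a b : N (a - b) = N a - N b by rewrite -[N _]/(NL _) linearB.
have RE x : R x = x - (N x - N (N x)) 
  by rewrite /R (opprB (N x) (N (N x))) [RHS]addrA [RHS]addrAC.
have SSR x : S (S (R x)) = x.
  have -> : S (S (R x)) = R x + N (R x) by rewrite Ndef addrC subrK.
  by rewrite RE !NB NNN subr0 subrK.
have RSS x : R (S (S x)) = x.
  have -> : S (S x) = x + N x by rewrite Ndef addrC subrK.
  rewrite RE !ND NNN addr0 [N x + _ - _]addrK; exact: addrK.
have Sinj : injective S by move=> x y e; rewrite -[x]RSS -[y]RSS e.
exists (R \o S) => x /=; first exact: RSS.
by apply: Sinj; exact: SSR.
Qed.

(** hB + uB is an ideal, so congruence modulo it is compatible with products. *)
Fact order1_mul (K : comNzRingType) (B : lalgType K) (h u : K) (x v y z y' z' : B) :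
    (forall c (a b : B), a * (c *: b) = c *: (a * b)) ->
  exists y1 z1, (x + (h *: y + u *: z)) * (v + (h *: y' + u *: z'))
    = x * v + (h *: y1 + u *: z1).
Proof.
move=> sAr; set t := h *: y' + u *: z'.
exists (x * y' + y * (v + t)), (x * z' + z * (v + t)).
have tE : x * t = h *: (x * y') + u *: (x * z') by rewrite mulrDr !sAr.
rewrite mulrDl (mulrDl (h *: y)) -!scalerAl mulrDr tE -addrA; congr (_ + _).
by rewrite addrACA -!scalerDr.
Qed.

Fact order1_combine (K : comNzRingType) (W : lmodType K) (h u c : K)
    (x v y z y' z' : W) :
  c *: (x + (h *: y + u *: z)) + (v + (h *: y' + u *: z'))
  = c *: x + v + (h *: (c *: y + y') + u *: (c *: z + z')).
Proof.
rewrite !scalerDr !scalerA ![c * _]mulrC addrACA; congr (_ + _).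
exact: addrACA.
Qed.

Section QuasiHopfDeformation.
Variables (K : comNzRingType) (k : fieldType) (V : vectType k).
Local Notation A := (TV K V 1).
Variables (F : frame K (word V)) (Q : A -> Prop).
Hypothesis Qvec : forall j, Q (@fvec _ _ F j).
Hypothesis Qgen : forall i, Q (gen K i).
Hypothesis linear_Q : forall (B : lmodType K) (f f' : A -> B),
  linear f -> linear f' -> (forall i, f (gen K i) = f' (gen K i)) ->
  forall y, Q y -> f y = f' y.
Variable (Delta : {lrmorphism A -> TV K V 2}).
Hypothesis DeltaQ : forall y, Q y -> eval F 2 [:: y] DeltaP = Delta y.
Local Notation S := (antipode F).

Let repS : represents F Q (antipodeP SP) S.
Proof.
apply: represents_ahom => //.
- exact: (linear0 (mlin _)).
- exact: antipode1.
- exact: antipodeM.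
- exact: antipode_Q.
Qed.

Fact antipode_square_gen i :
  exists y z, S (S (gen K i)) = gen K i + (fh F *: y + fu F *: z).
Proof.
have Qs : {in [:: gen K i : A], forall y, Q y} by move=> y; rewrite inE => /eqP->.
pose P := fbind 1 (fun m W => antipodeP SP m (nth [::] W 0)) SP.
have SE : eval F 1 [:: gen K i] P = S (S (gen K i)).
  apply: etrans _ (congr1 S (antipode_Q F linear_Q (Qgen i))).
  apply: (@eval_bind _ _ _ 1 1 1 Q) => // [|s W Qs']; first exact: mlin_is_linear.
  by rewrite /tval tn1E; exact: repS.
(* As [SP] starts with -x, the terms of order 0 in S(S(x)) - x cancel in the normal form; that only
   orders h and u remain is checked by computation. *)
have [y [z e]] := @eval_order1 _ _ F 1 [:: gen K i]
  (fnorm 1 (fsub P (fword [:: 0%N]))) ltac:(by vm_compute).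
exists y, z; rewrite -e eval_norm // eval_sub SE eval_word /wval big_seq1 /=.
by rewrite addrC subrK.
Qed.

Lemma antipode_bijective : bijective S.
Proof.
apply: (bijective_of_unipotent_square (fhh F) (fhu F) (fuu F)) => [|x].
  exact: mlin_is_linear.
elim/tensor_ind: x => [|i u [y' [z' IH]]|c u v [y [z IHu]] [y' [z' IHv]]].
- by exists 0, 0; rewrite !antipode1 !scaler0 !addr0.
- have [y [z e]] := antipode_square_gen i.
  have [y1 [z1 E]] := order1_mul (fh F) (fu F) (gen K i) u y z y' z' (@malg_scalerAr K _).
  exists y1, z1; apply: etrans E; apply: etrans (congr1 S (antipodeM F (gen K i) u)) _.
  apply: etrans (antipodeM F (S u) (S (gen K i))) _.
  exact: (congr2 (fun a b : A => a * b) e IH).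
- exists (c *: y + y'), (c *: z + z').
  apply: etrans (congr1 S (antipode_linear F c u v)) _.
  apply: etrans (antipode_linear F c (S u) (S v)) _.
  apply: etrans (scaleD_congr c IHu IHv) _; exact: order1_combine.
Qed.

Lemma quasi_Hopf_DeltaP :
  quasi_Hopf Delta (@counit K k V) (eval F 3 [::] (PhiP (-1))).
Proof.
split.
- by move=> c x y; exact: linearP.
- by split; [exact: rmorph1 | exact: rmorphM].
- exact: counit_linear.
- exact: counit_monoid.
- exact: (coassoc Qvec Qgen DeltaQ).
- exact: (counit_left Qvec Qgen linear_Q DeltaQ).
- exact: (counit_right Qvec Qgen linear_Q DeltaQ).
- exact: (counit_middle Qvec linear_Q).
- exact: (pentagon Qvec DeltaQ).
exists (eval F 3 [::] (PhiP 1)); split; [exact: Phi_inv_r | exact: Phi_inv_l |].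
exists S, 1, (eval F 1 [::] bP); split.
- exact: antipode_linear.
- exact: antipode_bijective.
- exact: antipode1.
- exact: antipodeM.
- exact: (antipode_left Qvec Qgen linear_Q DeltaQ).
- exact: (antipode_right Qvec Qgen linear_Q DeltaQ).
- exact: (antipode_on_Phi Qvec linear_Q).
- exact: (antipode_on_Phi_inv Qvec linear_Q).
Qed.

End QuasiHopfDeformation.

(** * Permutations of tensor factors *)

(** Permutations as lists of values with their parity: a first value j creates j inversions, and
    [bump j] renumbers the others so as to avoid j. *)
Fixpoint sperms n : seq (bool * seq nat) :=
  if n is n'.+1 then
    [seq (odd j (+) x.1, j :: map (bump j) x.2) | j <- iota 0 n, x <- sperms n']
  else [:: (false, [::])].

Lemma sum_perms (K : comNzRingType) (B : lmodType K) n (G : seq nat -> B) :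
  \sum_(s : 'S_n) (-1) ^+ (odd_perm s) *: G [seq val (s i) | i <- enum 'I_n]
  = \sum_(x <- sperms n) (-1) ^+ x.1 *: G x.2.
Proof.
elim: n G => [|n IH] G.
  rewrite big_seq1 /= (bigD1 (1%g : 'S_0)) //= big1 ?addr0 => [|s /eqP[]]; last first.
    by apply/permP => -[].
  by rewrite odd_perm1 /= enum_ord0.
rewrite [RHS](_ : _ = \sum_(j <- iota 0 n.+1) \sum_(x <- sperms n)
    (-1) ^+ (odd j (+) x.1) *: G (j :: map (bump j) x.2)); last exact: big_allpairs_dep.
rewrite -[iota 0 n.+1]val_enum_ord big_map big_enum.
rewrite (partition_big (fun s : 'S_n.+1 => s ord0) xpredT) //=.
apply: eq_bigr => j _; rewrite (reindex (lift_perm ord0 j)); last first.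
  (* The inverse of [lift_perm ord0 j]: it deletes the point 0 together with its image. *)
  pose ulsf (s : 'S_n.+1) k := odflt k (unlift (s ord0) (s (lift ord0 k))).
  have ulsfK (s : 'S_n.+1) k : lift (s ord0) (ulsf s k) = s (lift ord0 k).
    rewrite /ulsf; have := neq_lift ord0 k.
    by rewrite -(can_eq (permK s)) => /unlift_some[] ? ? ->.
  have inj_ulsf (s : 'S_n.+1) : injective (ulsf s).
    move=> k l /(congr1 (lift (s ord0))); rewrite !ulsfK => /perm_inj.
    exact: lift_inj.
  exists (fun s => perm (inj_ulsf s)) => [s _ | s /eqP sj].
    apply/permP=> k; rewrite permE; apply: (@lift_inj _ j).
    by rewrite -{1}(lift_perm_id ord0 j s) ulsfK lift_perm_lift.
  apply/permP=> k; case: (unliftP ord0 k) => [l|] ->.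
    by rewrite lift_perm_lift permE -sj ulsfK.
  by rewrite lift_perm_id sj.
under eq_bigl => s do rewrite lift_perm_id eqxx.
have := IH (fun p => (-1) ^+ (odd j) *: G (val j :: map (bump j) p)).
under [in RHS]eq_bigr => x _ do rewrite scalerA -signr_addb addbC.
move <-; apply: eq_bigr => s _; rewrite odd_lift_perm scalerA -signr_addb /=.
rewrite addbC; congr (_ *: G _); rewrite enum_ordSl /= lift_perm_id -!map_comp.
by congr (_ :: _); apply: eq_map => i /=; rewrite lift_perm_lift.
Qed.

Section FormalPermutations.
Variables (K : comNzRingType) (M : monomType).
Local Notation A := (tpow K M 1).

Lemma tnU n (v : nat -> {ffun 'I_1 -> M}) :
  tn n (fun k => << v k >> : A) = << [ffun i : 'I_n => v i ord0] >>.
Proof.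
elim: n v => [|n IH] v /=; first by congr << _ >>; apply/ffunP; case.
rewrite (IH (v \o S)) (@tensUU K M 1 n); congr << _ >>; apply/ffunP=> i; rewrite !ffunE.
by case: splitP => j /= ->; rewrite ?ffunE // (ord1 j).
Qed.

Lemma tn_linear n (i : 'I_n) c (f f1 f2 : nat -> A) : f i = c *: f1 i + f2 i ->
  (forall l, l != i -> f1 l = f l /\ f2 l = f l) ->
  tn n f = c *: tn n f1 + tn n f2.
Proof.
move=> fi fl; apply/malgP => w; rewrite mcoeffD mcoeffZ !tn_coef.
have D (h : nat -> A) : \prod_(l < n) (h l)@_[ffun=> w l] =
    (h i)@_[ffun=> w i] * \prod_(l < n | l != i) (h l)@_[ffun=> w l].
  by rewrite (bigD1 i).
rewrite !D fi mcoeffD mcoeffZ mulrDl mulrA.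
by congr (_ * _ + _ * _); apply: eq_bigr => l li; have [e1 e2] := fl l li;
  rewrite ?e1 ?e2.
Qed.

Lemma Alt_linear n : linear (@Alt K M n).
Proof.
move=> c u v; rewrite /Alt scaler_sumr -big_split; apply: eq_bigr => s _ /=.
have -> : tshuffle s (c *: u + v) = c *: tshuffle s u + tshuffle s v by exact: linearP.
by rewrite scalerDr !scalerA mulrC.
Qed.

Lemma Alt_tn n (f : nat -> A) : Alt (tn n f) =
  \sum_(x <- sperms n) (-1) ^+ x.1 *: tn n (fun i => f (nth 0%N x.2 i)).
Proof.
rewrite -(sum_perms n (fun p => tn n (fun i => f (nth 0%N p i)))).
apply: eq_bigr => s _; congr (_ *: _).
apply: (tshuffle_tn (permK s) (permKV s)) => i.
by rewrite (nth_map i) ?size_enum_ord // nth_ord_enum.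
Qed.

Lemma cp_linear : linear (@cp K M).
Proof.
move=> c u v; rewrite /cp scaler_sumr -big_split; apply: eq_bigr => s _ /=.
exact: linearP.
Qed.

Lemma cp_tn (f : nat -> A) : cp (tn 3 f) =
  \sum_(j <- iota 0 3) tn 3 (fun i => f ((i + j) %% 3)%N).
Proof.
rewrite -[iota 0 3]val_enum_ord big_map big_enum; apply: eq_bigr => j _.
by apply: (tshuffle_tn (addrK j) (subrK j)).
Qed.

Lemma flip_tn (f : nat -> A) : flip (tn 2 f) = tn 2 (fun i => f (1 - i)%N).
Proof.
by apply: (tshuffle_tn (@rev_ordK 2) (@rev_ordK 2)) => i; rewrite /= subSS.
Qed.

Definition fAlt n (m : nat) (W : seq (seq nat)) : fsum :=
  [seq (cint ((-1) ^+ (x.1 : bool)), (0%N, mkseq (fun i => nth [::] W (nth 0%N x.2 i)) n))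
    | x <- sperms n].
Definition fcp (m : nat) (W : seq (seq nat)) : fsum :=
  [seq (cint 1, (0%N, mkseq (fun i => nth [::] W ((i + j) %% 3)%N) 3)) | j <- iota 0 3].
Definition fflip (m : nat) (W : seq (seq nat)) : fsum :=
  [:: (cint 1, (0%N, [:: nth [::] W 1; nth [::] W 0]))].

Variable F : frame K M.

Lemma eval_Alt n m s P : size s = m ->
  eval F n s (fbind m (fAlt n) P) = Alt (eval F n s P).
Proof.
move=> sm; apply: (@eval_bind _ _ _ n n m (fun=> True)) => // [|s' W _].
  exact: Alt_linear.
rewrite /tval Alt_tn /eval big_map; apply: eq_bigr => x _.
rewrite cval_int rmorphXn rmorphN1 /eval1 [LHS]/= cats0; congr (_ *: _).
by apply: eq_tn => i lt_in; rewrite nth_mkseq.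
Qed.

Lemma eval_cp m s P : size s = m -> eval F 3 s (fbind m fcp P) = cp (eval F 3 s P).
Proof.
move=> sm; apply: (@eval_bind _ _ _ 3 3 m (fun=> True)) => // [|s' W _].
  exact: cp_linear.
rewrite /tval cp_tn /eval big_map; apply: eq_bigr => j _.
rewrite cval_int scale1r /eval1 [LHS]/= cats0.
by apply: (@eq_tn K M 3) => i lt_in; rewrite nth_mkseq.
Qed.

Lemma eval_flip m s P : size s = m ->
  eval F 2 s (fbind m fflip P) = flip (eval F 2 s P).
Proof.
move=> sm; apply: (@eval_bind _ _ _ 2 2 m (fun=> True)) => // [|s' W _].
  exact: mlin_is_linear.
rewrite /tval flip_tn eval_seq1 cval_int scale1r /eval1 [LHS]/= cats0.
by apply: (@eq_tn K M 2) => -[|[|i]].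
Qed.

Definition fplace (i j : nat) (m : nat) (W : seq (seq nat)) : fsum :=
  [:: (cint 1, (0%N, mkseq (fun k => if k == i then nth [::] W 0 else
        if k == j then nth [::] W 1 else [::]) 3))].

Lemma place_tens (i j : 'I_3) (x y : A) : (i < j)%N ->
  place i j (x \ot y : tpow K M 2)
  = tn 3 (fun k => if k == i then x else if k == j then y else 1).
Proof.
move=> ij; have lij : i != j by rewrite -val_eqE neq_ltn ij.
pose G (x y : A) : tpow K M 3 := tn 3 (fun k => if k == i then x else if k == j then y else 1).
have Gl c a b d : G (c *: a + b) d = c *: G a d + G b d.
  apply: (tn_linear (i := i)) => [|l]; first by rewrite eqxx.
  by rewrite -val_eqE => /negPf /= ->.
have Gr c a b d : G a (c *: b + d) = c *: G a b + G a d.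
  apply: (tn_linear (i := j)) => [|l].
    by rewrite eqxx val_eqE eq_sym (negPf lij).
  by rewrite -val_eqE => /negPf /= ->.
rewrite -[RHS](mlin_tens x y Gl Gr); apply: eq_mlin => w.
pose v (k : nat) : {ffun 'I_1 -> M} :=
  if k == i then @wleft M 1 1 w else if k == j then @wright M 1 1 w else mone.
have -> : G << @wleft M 1 1 w >> << @wright M 1 1 w >> = tn 3 (fun k => << v k >>).
  by apply: eq_tn => k _; rewrite /v; case: ifP => // _; case: ifP.
rewrite tnU; congr << _ >>; apply/ffunP=> l; rewrite !ffunE /v -!val_eqE /=.
case: ifP => _; last case: ifP => _; rewrite ffunE //; congr (w _); exact: val_inj.
Qed.

Lemma eval_place (i j : 'I_3) m s P : (i < j)%N -> size s = m ->
  eval F 3 s (fbind m (fplace i j) P) = place i j (eval F 2 s P).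
Proof.
move=> ij sm; apply: (@eval_bind _ _ _ 2 3 m (fun=> True)) => // [|s' W _].
  exact: mlin_is_linear.
rewrite tval2E place_tens // eval_seq1 cval_int scale1r /eval1 [LHS]/= cats0.
apply: (@eq_tn K M 3) => k lt_k; rewrite nth_mkseq //.
by case: ifP => // _; case: ifP => // _; rewrite /wval big_nil.
Qed.

End FormalPermutations.

(** * The Pohlmeyer-Rehren quasi-Lie bialgebra *)

Definition flie n m (P Q : fsum) : fsum := fsub (fmul n m P Q) (fmul n m Q P).

Definition prim2P : fsum := [:: (cint 1, (0%N, [:: [:: 0%N]; [::]]));
                                (cint 1, (0%N, [:: [::]; [:: 0%N]]))].
Definition prim3P : fsum := [:: (cint 1, (0%N, [:: [:: 0%N]; [::]; [::]]));
                                (cint 1, (0%N, [:: [::]; [:: 0%N]; [::]]));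
                                (cint 1, (0%N, [:: [::]; [::]; [:: 0%N]]))].

Definition deltaP : fsum :=
  flie 2 1 (flift 1 metricP) (fsub in1P in2P).

Definition metric3P i j : fsum := fbind 0 (fplace i j) metricP.

Definition g12_g13P : fsum := flie 3 0 (metric3P 0 1) (metric3P 0 2).

Definition phiP : fsum :=
  fsub (fscale (cint (-1)) g12_g13P ++ flie 3 0 (metric3P 0 1) (metric3P 1 2))
       (flie 3 0 (metric3P 0 2) (metric3P 1 2)).

Lemma eval_lie (K : comNzRingType) (M : monomType) (F : frame K M) n m s P P' X Y :
    size s = m -> X = eval F n s P -> Y = eval F n s P' ->
  lie X Y = eval F n s (flie n m P P').
Proof. by move=> sm -> ->; rewrite eval_sub !eval_mul. Qed.

Lemma eval_subE (K : comNzRingType) (M : monomType) (F : frame K M) n s P P' X Y :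
  X = eval F n s P -> Y = eval F n s P' -> X - Y = eval F n s (fsub P P').
Proof. by move=> -> ->; rewrite eval_sub. Qed.

Lemma eval_addE (K : comNzRingType) (M : monomType) (F : frame K M) n s P P' X Y :
  X = eval F n s P -> Y = eval F n s P' -> X + Y = eval F n s (P ++ P').
Proof. by move=> -> ->; rewrite eval_cat. Qed.

Lemma eval_tensE (K : comNzRingType) (M : monomType) (F : frame K M) p q m s P P' X Y :
    size s = m -> X = eval F p s P -> Y = eval F q s P' ->
  X \ot Y = eval F (p + q) s (ftens p q m P P').
Proof. by move=> sm -> ->; rewrite eval_tens. Qed.

Lemma eval_AltE (K : comNzRingType) (M : monomType) (F : frame K M) n m s P X :
  size s = m -> X = eval F n s P -> Alt X = eval F n s (fbind m (fAlt n) P).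
Proof. by move=> sm ->; rewrite eval_Alt. Qed.

Lemma eval_cpE (K : comNzRingType) (M : monomType) (F : frame K M) m s P X :
  size s = m -> X = eval F 3 s P -> cp X = eval F 3 s (fbind m fcp P).
Proof. by move=> sm ->; rewrite eval_cp. Qed.

Lemma eval_letter (K : comNzRingType) (M : monomType) (F : frame K M) s l x :
  nth 0 s l = x -> x = eval F 1 s (fword [:: l]).
Proof. by move=> <-; rewrite eval_word /wval big_seq1. Qed.

Lemma eval_oneE (K : comNzRingType) (M : monomType) (F : frame K M) n s :
  1 = eval F n s (fone n).
Proof. by rewrite eval_one. Qed.

Section Lspan.
Variables (K : comNzRingType) (B : lmodType K) (P : B -> Prop).

Lemma lspan_lin c u v : lspan P u -> lspan P v -> lspan P (c *: u + v).
Proof.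
elim=> [|a x y Px _ IH] Pv; first by rewrite scaler0 add0r.
rewrite scalerDr scalerA -addrA; apply: lspanD Px _; exact: IH.
Qed.

Lemma lspan_gen u : P u -> lspan P u.
Proof.
by move=> Pu; rewrite -[u]addr0 -[u]scale1r; apply: lspanD => //; apply: lspan0.
Qed.

Lemma lspanZ c u : lspan P u -> lspan P (c *: u).
Proof. by move=> Pu; rewrite -[_ *: u]addr0; apply: lspan_lin Pu _; apply: lspan0. Qed.

Lemma lspan_add u v : lspan P u -> lspan P v -> lspan P (u + v).
Proof. by move=> Pu; rewrite -[u]scale1r; apply: lspan_lin. Qed.

Lemma lspan_sub u v : lspan P u -> lspan P v -> lspan P (u - v).
Proof. by move=> Pu Pv; rewrite addrC -scaleN1r; apply: lspan_lin. Qed.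

Lemma lspan_bsum (J : finType) (ep : J -> K) r (G : seq J -> B) :
  (forall t, lspan P (G t)) -> lspan P (bsum ep r G).
Proof.
elim: r G => [|r IH] G PG //=.
elim: (index_enum J) => [|j s IHs]; first by rewrite big_nil; apply: lspan0.
by rewrite big_cons; apply: lspan_lin IHs; apply: IH => t.
Qed.

Lemma lspan_ind_linear (B' : lmodType K) (f f' : B -> B') : linear f -> linear f' ->
  (forall u, P u -> f u = f' u) -> forall u, lspan P u -> f u = f' u.
Proof.
move=> lf lf' ff u; elim=> [|c x y Px _ IH]; last by rewrite lf lf' ff // IH.
have z (h : B -> B') : linear h -> h 0 = 0.
  by move=> lh; have := lh (-1) 0 0; rewrite scaler0 addr0 scaleN1r addNr.
by rewrite !z.
Qed.

End Lspan.

Fact lie_jacobi (R : pzRingType) (a b c : R) :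
  lie a (lie b c) - lie b (lie a c) = lie (lie a b) c.
Proof.
have E (x y z t : R) : x - y - (z - t) = x + t - (y + z).
  by rewrite opprB addrACA opprD.
rewrite /lie !mulrBr !mulrBl !mulrA !E.
by rewrite subrKA [b * c * a - _ + _]addrC subrKA E [c * a * b + _]addrC.
Qed.

Fact lie_split (R : pzRingType) (a b c d p q r t : R) :
  a * b + c * d - (p * q + r * t) = (a * b - r * t) + (c * d - p * q).
Proof. by rewrite (addrC (p * q)) opprD addrACA. Qed.

Lemma tensDl (K : comNzRingType) (M : monomType) p q (u u' : tpow K M p) (v : tpow K M q) :
  (u + u') \ot v = u \ot v + u' \ot v.
Proof. by have := tensPl 1 u u' v; rewrite !scale1r. Qed.

(** * The map delta ⊗ id as a derivation *)

Section Leibniz.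
Variables (k : fieldType) (V : vectType k).
Local Notation T := (TV k V 1).
Local Notation idT := (@idfun T).
Local Notation L := (@freeLie k V).
Variables (g : TV k V 2).
Local Notation D := (PR_delta g).

Fact PR_delta_linear : linear D. Proof. exact: mlin_is_linear. Qed.
Fact Delta0_linear : linear (@Delta0 k k V). Proof. exact: mlin_is_linear. Qed.

Definition PR_deltaL : {linear T -> TV k V 2} :=
  HB.pack D (GRing.isLinear.Build _ _ _ _ D PR_delta_linear).

Definition Delta0L : {linear T -> TV k V 2} :=
  HB.pack (@Delta0 k k V) (GRing.isLinear.Build _ _ _ _ (@Delta0 k k V) Delta0_linear).

Fact Delta0M (x y : T) : Delta0 (x * y) = Delta0 x * Delta0 y. Proof. exact: rmorphM. Qed.
Fact Delta0_1 : Delta0 (1 : T) = 1. Proof. exact: rmorph1. Qed.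
Fact Delta0_0 : Delta0 (0 : T) = 0. Proof. exact: linear0. Qed.
Fact PR_delta_1 : D 1 = 0.
Proof. by rewrite /PR_delta /derlift mlinU ffunE fm1. Qed.
Fact PR_delta_0 : D 0 = 0. Proof. exact: linear0. Qed.

Definition delta_id : TV k V 2 -> TV k V 3 := D \otf idT.
Definition Delta0_id : TV k V 2 -> TV k V 3 := @Delta0 k k V \otf idT.

Fact delta_id_linear : linear delta_id. Proof. exact: mlin_is_linear. Qed.
Fact Delta0_id_linear : linear Delta0_id. Proof. exact: mlin_is_linear. Qed.

Fact delta_id_tens (x y : T) : delta_id (x \ot y) = D x \ot y.
Proof. exact: (tmap_tens PR_deltaL idfun). Qed.
Fact Delta0_id_tens (x y : T) : Delta0_id (x \ot y) = Delta0 x \ot y.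
Proof. exact: (tmap_tens Delta0L idfun). Qed.
Fact Delta0_idM X Y : Delta0_id (X * Y) = Delta0_id X * Delta0_id Y.
Proof. exact: (tmapM Delta0M (fun x y => erefl)). Qed.

(** [PR_delta] is a derivation along [Delta0], so on elementary tensors this is its Leibniz rule in
    the first factor; bilinearity in X and Y does the rest. *)
Fact delta_id_mul X Y : delta_id (X * Y) = delta_id X * Delta0_id Y + Delta0_id X * delta_id Y.
Proof.
have lE := delta_id_linear; have lD := Delta0_id_linear.
apply: (@tens_ext k _ 1 1 _ (fun X => delta_id (X * Y)) (fun X => delta_id X * Delta0_id Y + Delta0_id X * delta_id Y)).
- by move=> c x y; exact: etrans (congr1 delta_id (mulPl _ _ _ _)) (lE _ _ _).
- exact: (linear_addf (linear_mulrf (Delta0_id Y) lE) (linear_mulrf (delta_id Y) lD)).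
move=> x y; move: Y; apply: (@tens_ext k _ 1 1 _ (fun Y => delta_id ((x \ot y) * Y))
  (fun Y => delta_id (x \ot y) * Delta0_id Y + Delta0_id (x \ot y) * delta_id Y)).
- by move=> c u v; exact: etrans (congr1 delta_id (malg_mulPr _ _ _ _)) (lE _ _ _).
- exact: (linear_addf (linear_mullf (delta_id (x \ot y)) lD) (linear_mullf (Delta0_id (x \ot y)) lE)).
move=> u v; rewrite !delta_id_tens !Delta0_id_tens.
apply: etrans (congr1 delta_id (@tensM k _ 1 1 _ _ _ _)) _.
apply: etrans (delta_id_tens _ _) _.
apply: etrans (congr1 (fun t : TV k V 2 => t \ot (y * v)) (derliftM _ x u)) _.
apply: etrans (tensDl _ _ _) _.
exact: (congr2 (fun a b : TV k V 3 => a + b) (esym (@tensM k _ 2 1 _ _ _ _))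
                                             (esym (@tensM k _ 2 1 _ _ _ _))).
Qed.

Fact delta_id_lie X Y : delta_id (lie X Y) = lie (delta_id X) (Delta0_id Y) + lie (Delta0_id X) (delta_id Y).
Proof.
have EB (u v : TV k V 2) : delta_id (u - v) = delta_id u - delta_id v by exact: (linearB (mlin _)).
rewrite /lie EB !delta_id_mul; exact: lie_split.
Qed.

Fact Delta0_id_lie X Y : Delta0_id (lie X Y) = lie (Delta0_id X) (Delta0_id Y).
Proof.
have DB (u v : TV k V 2) : Delta0_id (u - v) = Delta0_id u - Delta0_id v by exact: (linearB (mlin _)).
by rewrite /lie DB !Delta0_idM.
Qed.

Fact delta_id_prim2 x : delta_id (prim2 x) = D x \ot (1 : T).
Proof.
apply: etrans (linearD (mlin _) _ _) _.
apply: etrans (congr2 (fun a b : TV k V 3 => a + b) (delta_id_tens x 1) (delta_id_tens 1 x)) _.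
rewrite PR_delta_1; apply: etrans (congr1 _ (tens0l _ _)) _; exact: addr0.
Qed.

Fact Delta0_id_prim2 x : L x -> Delta0_id (prim2 x) = prim3 x.
Proof.
move=> Lx; apply: etrans (linearD (mlin _) _ _) _.
apply: etrans (congr2 (fun a b : TV k V 3 => a + b) (Delta0_id_tens x 1) (Delta0_id_tens 1 x)) _.
by rewrite Delta0_freeLie // Delta0_1 /prim2 tensDl -(@tens1 k _ 1 1).
Qed.

(** For primitive x, [prim3 x] is the iterated coproduct (Delta0 ⊗ id) Delta0 x, which is an algebra
    morphism. *)
Lemma prim3_lie x y : L x -> L y -> prim3 (lie x y) = lie (prim3 x) (prim3 y).
Proof.
move=> Lx Ly; rewrite -!Delta0_id_prim2 //; last exact: freeLie_lie.
by rewrite prim2_lie Delta0_id_lie.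
Qed.

End Leibniz.

(** * Cyclic sums and primitive elements *)

Section Cyclic.
Variables (K : comNzRingType) (M : monomType).
Local Notation A := (tpow K M 1).

Lemma tshuffleM n (s : 'I_n -> 'I_n) (u v : tpow K M n) :
  tshuffle s (u * v) = tshuffle s u * tshuffle s v.
Proof.
apply: mlin_morphM => [|w z]; first exact: malg_scalerAr.
by rewrite malgUM; congr << _ >>; apply/ffunP=> i; rewrite !ffunE.
Qed.

Lemma prim3_tn (x : A) :
  prim3 x = \sum_(j : 'I_3) tn 3 (fun i => if i == j then x else 1).
Proof.
by rewrite !big_ord_recl big_ord0 addr0 !tn3E /= addrA.
Qed.

Lemma tshuffle_prim3 (x : A) (j : 'I_3) : tshuffle (fun i => i + j) (prim3 x) = prim3 x.
Proof.
have sB (u v : tpow K M 3) : tshuffle (fun i => i + j) (u + v)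
  = tshuffle (fun i => i + j) u + tshuffle (fun i => i + j) v by exact: (linearD (mlin _)).
rewrite prim3_tn [RHS](reindex_inj (addrI (- j))).
have -> : tshuffle (fun i => i + j) (\sum_(l < 3) tn 3 (fun i => if i == l then x else 1))
  = \sum_(l < 3) tshuffle (fun i => i + j) (tn 3 (fun i => if i == l then x else 1)).
  exact: (linear_sum (mlin _)).
apply: eq_bigr => l _; apply: (tshuffle_tn (addrK j) (subrK j)) => i.
by rewrite !val_eqE (eq_sym i) (addrC (- j)) subr_eq eq_sym.
Qed.

(** [prim3 x] is invariant under cyclic permutations, which act by algebra automorphisms; so cp
    commutes with the adjoint action. *)
Lemma cp_lie (x : A) Z : cp (lie (prim3 x) Z) = lie (prim3 x) (cp Z).
Proof.
rewrite /cp /lie mulr_sumr mulr_suml -sumrB; apply: eq_bigr => j _.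
have sB (u v : tpow K M 3) : tshuffle (fun i => i + j) (u - v)
  = tshuffle (fun i => i + j) u - tshuffle (fun i => i + j) v by exact: (linearB (mlin _)).
by rewrite sB !tshuffleM tshuffle_prim3.
Qed.

End Cyclic.

Fact lie_linear_r (K : comNzRingType) (B : lalgType K) (c : K) (x y z : B) :
  (forall c (a b : B), a * (c *: b) = c *: (a * b)) ->
  lie x (c *: y + z) = c *: lie x y + lie x z.
Proof.
by move=> sAr; rewrite /lie mulrDr mulrDl sAr -scalerAl scalerBr opprD addrACA.
Qed.

Fact lie_linear_l (K : comNzRingType) (B : lalgType K) (c : K) (x y z : B) :
  (forall c (a b : B), a * (c *: b) = c *: (a * b)) ->
  lie (c *: y + z) x = c *: lie y x + lie z x.
Proof.
by move=> sAr; rewrite /lie mulrDr mulrDl sAr -scalerAl scalerBr opprD addrACA.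
Qed.

Fact sub_addACA (W : zmodType) (x y z t : W) : (x + y) - (z + t) = (x - z) + (y - t).
Proof. by rewrite opprD addrACA. Qed.

(** * The axioms of the quasi-Lie bialgebra *)

Section PohlmeyerRehren.
Variables (k : fieldType) (V : vectType k).
Hypothesis char0 : [pchar k] =i pred0.
Variables (d : nat) (ep : 'I_d.+1 -> k) (e : 'I_d.+1 -> V).
Local Notation T := (TV k V 1).
Local Notation idT := (@idfun T).
Local Notation L := (@freeLie k V).
Local Notation F := (frame0 ep e).
Variables (g : TV k V 2).
Hypothesis gE : g = \sum_j ep j *: (iotaV (e j) \ot iotaV (e j)).
Local Notation D := (PR_delta g).
Local Notation phi := (PR_phi g).

Definition in_V (y : T) := exists x : V, y = iotaV x.

Let Vvec j : in_V (@fvec _ _ F j). Proof. by exists (e j). Qed.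
Let Lvec j : L (@fvec _ _ F j). Proof. exact: freeLie_gen. Qed.

Lemma freeLie_0 : L 0.
Proof.
have L0 : L (iotaV 0) by exact: freeLie_gen.
by have := freeLie_lin (-1) L0 L0; rewrite scaleN1r addNr.
Qed.

Lemma eval_prim2 (y : T) : prim2 y = eval F 2 [:: y] prim2P.
Proof.
rewrite /prim2P !eval_cons eval_nil !cval_int !scale1r addr0 /eval1 /= !tval2E /=.
by rewrite /wval !big_seq1 !big_nil.
Qed.

Lemma eval_prim3 (y : T) : prim3 y = eval F 3 [:: y] prim3P.
Proof.
rewrite /prim3P !eval_cons eval_nil !cval_int !scale1r addr0 addrA /eval1 ![bsum _ _ _]/=.
by rewrite !tval3E /= /wval !big_seq1 !big_nil.
Qed.

Lemma eval_delta (y : T) : in_V y -> D y = eval F 2 [:: y] deltaP.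
Proof.
move=> [x ->]; apply: etrans (PR_delta_gen _ _) _.
apply: eval_lie => //; first exact: (eval_metric_at gE).
by apply: eval_subE; [exact: eval_in1 | exact: eval_in2].
Qed.

Let phiD := fun m w =>
  fder 2 m (fun l => rebase m l deltaP) (fun l => rebase m l prim2P) w.
Let phi0 := fun m w => fhom 2 m (fun l => rebase m l prim2P) w.

Lemma V_freeLie y : in_V y -> L y.
Proof. by move=> [x ->]; exact: freeLie_gen. Qed.

Let D0L y : L y -> eval F 2 [:: y] prim2P = Delta0 y.
Proof. by move=> Ly; rewrite -eval_prim2 Delta0_freeLie. Qed.

(** Here letters may lie anywhere in L(V), since all its elements are primitive; [cross_pure] uses
    this for p, q, r, s. For [repD] the formula for the cobracket confines them to V. *)
Let rep0 : represents F L phi0 (@Delta0 k k V).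
Proof.
by apply: represents_hom => //; [exact: Delta0_0 | exact: Delta0_1 | exact: Delta0M].
Qed.

Let repD : represents F in_V phiD D.
Proof.
apply: (represents_der (L := @Delta0 k k V)).
- exact: Delta0_0.
- exact: Delta0_1.
- exact: Delta0M.
- exact: PR_delta_0.
- exact: PR_delta_1.
- exact: derliftM.
- by move=> y /V_freeLie; exact: D0L.
- by move=> y /eval_delta.
Qed.

Let sz0 : size ([::] : seq T) = 0%N. Proof. by []. Qed.
Let V0 : {in ([::] : seq T), forall y, in_V y}. Proof. by []. Qed.

Lemma eval_place01 : place 0 1 g = eval F 3 [::] (metric3P 0 1).
Proof.
apply: etrans (congr1 _ (eval_metric gE)) _; apply: esym.
exact: (@eval_place _ _ F 0 1 0 [::] metricP).
Qed.

Lemma eval_place02 : place 0 2%:R g = eval F 3 [::] (metric3P 0 2).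
Proof.
apply: etrans (congr1 _ (eval_metric gE)) _; apply: esym.
exact: (@eval_place _ _ F 0 2%:R 0 [::] metricP).
Qed.

Lemma eval_place12 : place 1 2%:R g = eval F 3 [::] (metric3P 1 2).
Proof.
apply: etrans (congr1 _ (eval_metric gE)) _; apply: esym.
exact: (@eval_place _ _ F 1 2%:R 0 [::] metricP).
Qed.

Lemma eval_g12_g13 : lie (place 0 1 g) (place 0 2%:R g) = eval F 3 [::] g12_g13P.
Proof. exact: eval_lie sz0 eval_place01 eval_place02. Qed.

Lemma eval_phi : phi = eval F 3 [::] phiP.
Proof.
apply: eval_subE; last exact: eval_lie sz0 eval_place02 eval_place12.
apply: eval_addE; last exact: eval_lie sz0 eval_place01 eval_place12.
rewrite eval_scale cval_int scaleN1r; congr (- _); exact: eval_g12_g13.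
Qed.

(** Used twice: it exhibits phi as an antisymmetric tensor, and it makes Alt of -1/2 [g12, g13]
    equal to phi. *)
Lemma Alt_g12_g13 : Alt (lie (place 0 1 g) (place 0 2%:R g)) = (-2)%:~R *: phi.
Proof.
apply: etrans (eval_AltE sz0 eval_g12_g13) _.
rewrite eval_phi -(cval_int F) -eval_scale.
by apply: (@eval_eq _ _ _ _ 0) => //; vm_compute.
Qed.

(** phi is -1/2 Alt [g12, g13], and [g12, g13] is a weighted sum of [e_i, e_j] ⊗ e_i ⊗ e_j, whose
    three factors lie in L(V). *)
Lemma phi_wedge3 : wedge3 L phi.
Proof.
have two0 : (-2)%:~R != 0 :> k.
  by rewrite rmorphN oppr_eq0 /= rmorph_nat ((pcharf0P k).1 char0).
rewrite -[phi](scalerK two0) -Alt_g12_g13; apply: lspanZ.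
have -> : lie (place 0 1 g) (place 0 2%:R g) = bsum ep 2 (fun t =>
    let a := nth 0 (map (fvec (f := F)) t) 0 in let b := nth 0 (map (fvec (f := F)) t) 1 in
    lie a b \ot a \ot b).
  rewrite eval_g12_g13.
  transitivity (eval F 3 [::] [:: (cint (-1), (2%N, [:: [:: 1%N; 0%N]; [:: 0%N]; [:: 1%N]]));
    (cint 1, (2%N, [:: [:: 0%N; 1%N]; [:: 0%N]; [:: 1%N]]))]).
    by apply: (@eval_eq _ _ _ _ 0) => //; vm_compute.
  rewrite eval_cons eval_seq1 !cval_int scale1r /eval1 -bsumP.
  apply: eq_bsum => t _; rewrite !tval3E /= /wval !big_cons !big_nil !mulr1 /=.
  rewrite /lie addrC.
  set a := nth 0 _ 0; set b := nth 0 _ 1.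
  have -> : a * b - b * a = (-1) *: (b * a) + a * b by rewrite scaleN1r addrC.
  by rewrite addrC !tensPl.
have AL := @Alt_linear k (word V) 3.
pose A : {linear TV k V 3 -> TV k V 3} := HB.pack (@Alt k (word V) 3)
  (GRing.isLinear.Build _ _ _ _ (@Alt k (word V) 3) AL).
rewrite -[Alt _]/(A _) bsum_linear; apply: lspan_bsum => t.
apply: lspan_gen.
set a := nth 0 _ 0; set b := nth 0 _ 1.
have Lnth l : L (nth 0 (map (fvec (f := F)) t) l).
  case: (ltnP l (size t)) => lt; last by rewrite nth_default ?size_map //; exact: freeLie_0.
  by rewrite (nth_map (fidx0 F)).
exists (lie a b), a, b; split; [|exact: Lnth|exact: Lnth|by []].
by apply: freeLie_lie; exact: Lnth.
Qed.

(** On V, [e ⊗ e, x_1 - x_2] = [e, x] ⊗ e - e ⊗ [e, x] = Alt ([e, x] ⊗ e). The cocycle identity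
    extends this to brackets, as the antisymmetric tensors are stable under the adjoint action. *)
Lemma delta_wedge2 x : L x -> wedge2 L (D x).
Proof.
have ad u (t : TV k V 2) : L u -> wedge2 L t -> wedge2 L (lie (prim2 u) t).
  move=> Lu; elim=> [|c y z [p [q [Lp Lq ->]]] _ IH].
    by rewrite /lie mulr0 mul0r subr0; exact: lspan0.
  rewrite (lie_linear_r c (prim2 u) _ z (@malg_scalerAr k _)); apply: lspan_lin IH.
  have -> : lie (prim2 u) (Alt (p \ot q)) = Alt (lie u p \ot q) + Alt (p \ot lie u q).
    (* The identity holds for arbitrary elements, which are made the letters of a context and
       compared formally. *)
    have sz : size [:: u; p; q] = 3%N by [].
    have eu := @eval_letter _ _ F [:: u; p; q] 0 u erefl.
    have ep' := @eval_letter _ _ F [:: u; p; q] 1 p erefl.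
    have eq := @eval_letter _ _ F [:: u; p; q] 2 q erefl.
    have e1 := eval_oneE F 1 [:: u; p; q].
    have l1 := eval_lie sz
      (eval_addE (eval_tensE sz eu e1) (eval_tensE sz e1 eu))
      (eval_AltE sz (eval_tensE sz ep' eq)).
    have r1 := eval_addE
      (eval_AltE sz (eval_tensE sz (eval_lie sz eu ep') eq))
      (eval_AltE sz (eval_tensE sz ep' (eval_lie sz eu eq))).
    apply: etrans l1 (etrans _ (esym r1)).
    by apply: (@eval_eq _ _ _ _ 3) => //; vm_compute.
  apply: lspan_add; apply: lspan_gen.
    by exists (lie u p), q; split => //; apply: freeLie_lie.
  by exists p, (lie u q); split => //; apply: freeLie_lie.
elim=> [v|c u v _ IHu _ IHv|u v Lu IHu Lv IHv].
- rewrite PR_delta_gen gE; elim: (index_enum _) => [|j s IH].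
    by rewrite big_nil /lie mulr0 mul0r subr0; exact: lspan0.
  rewrite big_cons (lie_linear_l _ _ _ _ (@malg_scalerAr k _)).
  apply: lspan_lin IH; apply: lspan_gen.
  exists (lie (iotaV (e j)) (iotaV v)), (iotaV (e j)); split.
  + by apply: freeLie_lie; exact: freeLie_gen.
  + exact: freeLie_gen.
  + set a := iotaV (e j); set b := iotaV v.
    have sz : size [:: a; b] = 2%N by [].
    have ea := @eval_letter _ _ F [:: a; b] 0 a erefl.
    have eb := @eval_letter _ _ F [:: a; b] 1 b erefl.
    have e1 := eval_oneE F 1 [:: a; b].
    have l1 := eval_lie sz (eval_tensE sz ea ea)
      (eval_subE (eval_tensE sz eb e1) (eval_tensE sz e1 eb)).
    have r1 := eval_AltE sz (eval_tensE sz (eval_lie sz ea eb) ea).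
    apply: etrans l1 (etrans _ (esym r1)).
    by apply: (@eval_eq _ _ _ _ 2) => //; vm_compute.
- by rewrite PR_delta_linear; exact: lspan_lin.
- by rewrite PR_delta_cocycle //; apply: lspan_sub; exact: ad.
Qed.

Let szx (x : T) : size [:: x] = 1%N. Proof. by []. Qed.

Lemma coJacobi_gen x : in_V x -> cp (delta_id g (D x)) = lie (prim3 x) phi.
Proof.
move=> Vx; have Qx : {in [:: x], forall y, in_V y} by move=> y; rewrite inE => /eqP->.
have e1 := etrans (congr1 (delta_id g) (eval_delta Vx))
  (esym (@eval_map10 _ _ F in_V Vvec 2 phiD (PR_deltaL g) repD 1 [:: x] deltaP (szx x) Qx)).
have e2 := @eval_lie _ _ F 3 1 [:: x] _ _ _ _ (szx x) (eval_prim3 x)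
  (etrans eval_phi (esym (@eval_lift _ _ F 3 1 [:: x] phiP (szx x)))).
apply: etrans (eval_cpE (szx x) e1) (etrans _ (esym e2)).
by apply: (@eval_eq _ _ _ _ 1) => //; vm_compute.
Qed.

(* The terms of cp (delta ⊗ id) delta [x, y] that mix delta x and delta y: they
   cancel by the antisymmetry of both. *)
Definition cross (X Y : TV k V 2) : TV k V 3 :=
  cp (lie (X \ot (1 : T)) (Delta0_id Y) - lie (Y \ot (1 : T)) (Delta0_id X)).

Lemma cross_linear Y : linear (cross^~ Y).
Proof.
have lT : linear (fun X : TV k V 2 => X \ot (1 : T)) by move=> c u v; exact: tensPl.
have lD := @Delta0_id_linear k V.
have l1 := linear_addf (linear_mulrf (Delta0_id Y) lT) (linear_oppf (linear_mullf (Delta0_id Y) lT)).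
have l2 := linear_addf (linear_mullf (Y \ot (1 : T)) lD)
                       (linear_oppf (linear_mulrf (Y \ot (1 : T)) lD)).
exact: (linear_comp (@cp_linear k (word V)) (linear_addf l1 (linear_oppf l2))).
Qed.

(** Transfers the linearity in the first argument to the second, for the double reduction to pure
    antisymmetric tensors. *)
Lemma cross_anti X Y : cross X Y = - cross Y X.
Proof.
pose cpL : {linear TV k V 3 -> TV k V 3} := HB.pack (@cp k (word V))
  (GRing.isLinear.Build _ _ _ _ (@cp k (word V)) (@cp_linear k (word V))).
apply: etrans (linearB cpL _ _) (etrans (esym (opprB _ _)) _).
exact: congr1 (esym (linearB cpL _ _)).
Qed.

Lemma cross_pure p q r s : L p -> L q -> L r -> L s ->
  cross (Alt (p \ot q)) (Alt (r \ot s)) = 0.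
Proof.
move=> Lp Lq Lr Ls; pose env := [:: p; q; r; s].
have sz : size env = 4%N by [].
have Qenv : {in env, forall y, L y}.
  by move=> y; rewrite !inE => /or4P[] /eqP->.
pose XP := fbind 4 (fAlt 2) (ftens 1 1 4 (fword [:: 0%N]) (fword [:: 1%N])).
pose YP := fbind 4 (fAlt 2) (ftens 1 1 4 (fword [:: 2%N]) (fword [:: 3%N])).
have eX : Alt (p \ot q) = eval F 2 env XP.
  by apply: eval_AltE => //; apply: eval_tensE => //; apply: eval_letter.
have eY : Alt (r \ot s) = eval F 2 env YP.
  by apply: eval_AltE => //; apply: eval_tensE => //; apply: eval_letter.
have eD (Z : TV k V 2) ZP : Z = eval F 2 env ZP ->
    Delta0_id Z = eval F 3 env (fbind 4 (fmap10 2 phi0) ZP).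
  by move=> ->; exact: esym (@eval_map10 _ _ F L Lvec 2 phi0 (@Delta0L k V) rep0 4 env ZP sz Qenv).
have e1 := eval_oneE F 1 env.
have l1 := eval_lie sz (eval_tensE sz eX e1) (eD _ _ eY).
have l2 := eval_lie sz (eval_tensE sz eY e1) (eD _ _ eX).
apply: etrans (eval_cpE sz (eval_subE l1 l2)) (etrans _ (@eval_nil _ _ F 3 env)).
by apply: (@eval_eq _ _ _ _ 4) => //; vm_compute.
Qed.

Lemma cross_wedge2 X Y : wedge2 L X -> wedge2 L Y -> cross X Y = 0.
Proof.
have l0 : linear (fun _ : TV k V 2 => 0 : TV k V 3).
  by move=> c u v; rewrite scaler0 addr0.
move=> WX WY; apply: (lspan_ind_linear (cross_linear Y) l0) WX => _ [p [q [Lp Lq ->]]].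
rewrite cross_anti; apply/eqP; rewrite oppr_eq0; apply/eqP.
apply: (lspan_ind_linear (cross_linear (Alt (p \ot q))) l0) WY.
by move=> _ [r [s [Lr Ls ->]]]; exact: cross_pure.
Qed.

Lemma coJacobi x : L x -> cp (delta_id g (D x)) = lie (prim3 x) phi.
Proof.
have EP := @delta_id_linear k V g; have cpP := @cp_linear k (word V).
pose cpL : {linear TV k V 3 -> TV k V 3} := HB.pack (@cp k (word V))
  (GRing.isLinear.Build _ _ _ _ (@cp k (word V)) cpP).
elim=> [v|c u v Lu IHu Lv IHv|u v Lu IHu Lv IHv].
- by apply: coJacobi_gen; exists v.
- have -> : prim3 (c *: u + v) = c *: prim3 u + prim3 v.
    apply: etrans (esym (Delta0_id_prim2 (freeLie_lin c Lu Lv))) _.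
    apply: etrans (congr1 (@Delta0_id k V) (prim2_is_linear c u v)) _.
    apply: etrans (Delta0_id_linear c (prim2 u) (prim2 v)) _.
    exact: scaleD_congr (Delta0_id_prim2 Lu) (Delta0_id_prim2 Lv).
  apply: etrans (congr1 (fun X => cp (delta_id g X)) (PR_delta_linear g c u v)) _.
  apply: etrans (congr1 (@cp _ _) (EP _ _ _)) (etrans (cpP _ _ _) _).
  rewrite IHu IHv; exact: esym (lie_linear_l _ _ _ _ (@malg_scalerAr k _)).
have Eprim a b : L a -> delta_id g (lie (prim2 a) (D b)) =
    lie (D a \ot (1 : T)) (Delta0_id (D b)) + lie (prim3 a) (delta_id g (D b)).
  by move=> La; rewrite delta_id_lie delta_id_prim2 Delta0_id_prim2.
(* The first line is what cp turns into [cross (D u) (D v)], which vanishes; in the second line cp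
   meets the induction hypotheses. *)
have EE : delta_id g (D (lie u v)) =
    (lie (D u \ot (1 : T)) (Delta0_id (D v)) - lie (D v \ot (1 : T)) (Delta0_id (D u)))
    + (lie (prim3 u) (delta_id g (D v)) - lie (prim3 v) (delta_id g (D u))).
  apply: etrans (congr1 (delta_id g) (PR_delta_cocycle g Lu Lv)) _.
  apply: etrans (linearB (mlin _) _ _) _.
  apply: etrans (congr2 (fun a b : TV k V 3 => a - b) (Eprim u v Lu) (Eprim v u Lv)) _.
  exact: sub_addACA.
apply: etrans (congr1 (@cp _ _) EE) (etrans (linearD cpL _ _) _).
apply: etrans (congr2 (fun a b : TV k V 3 => a + b)
  (cross_wedge2 (delta_wedge2 Lu) (delta_wedge2 Lv)) (linearB cpL _ _)) _.
apply: etrans (add0r _) _.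
apply: etrans (congr2 (fun a b : TV k V 3 => a - b) (cp_lie _ _) (cp_lie _ _)) _.
apply: etrans (congr2 (fun a b : TV k V 3 => a - b)
  (congr1 (lie (prim3 u)) IHv) (congr1 (lie (prim3 v)) IHu)) _.
(* What remains is [u, [v, phi]] - [v, [u, phi]], with u and v acting through [prim3]. *)
apply: etrans (lie_jacobi (prim3 u) (prim3 v) phi) _.
exact: (congr1 (fun a : TV k V 3 => lie a phi) (esym (prim3_lie Lu Lv))).
Qed.

Lemma Alt_delta_phi : Alt ((D \otf idT \otf idT) phi) = 0.
Proof.
have e1 := etrans (congr1 (D \otf idT \otf idT) eval_phi)
  (esym (@eval_map100 _ _ F in_V Vvec 2 phiD (PR_deltaL g) repD 0 [::] phiP sz0 V0)).
apply: etrans (@eval_AltE _ _ F 4 0 [::] _ _ sz0 e1) (etrans _ (@eval_nil _ _ F 4 [::])).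
by apply: (@eval_eq _ _ _ _ 0) => //; vm_compute.
Qed.

Lemma PR_quasi_Lie_bialgebra : quasi_Lie_bialgebra L D phi.
Proof.
split.
- split; [exact: freeLie_0 | by move=> *; exact: freeLie_lin | exact: freeLie_lie].
- exact: PR_delta_linear.
- exact: delta_wedge2.
- exact: PR_delta_cocycle.
- exact: phi_wedge3.
- exact: coJacobi.
- exact: Alt_delta_phi.
Qed.

End PohlmeyerRehren.

(** * Quantization modulo h^3 *)

Section Reduction.
Variables (k : fieldType).
Local Notation qC := (qpolyC ('X^3 : {poly k})).

Definition hcoef0 (c : kh k) : k := (c : {poly k})`_0.

Fact hcoef0_zmod : zmod_morphism hcoef0.
Proof. by move=> x y; rewrite /hcoef0 /= coefB. Qed.

Fact hcoef0_monoid : monoid_morphism hcoef0.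
Proof.
split=> [|x y]; first by rewrite /hcoef0 /= coefC.
rewrite /hcoef0 poly_of_qpolyM -coef0M; move: ((x : {poly k}) * (y : {poly k})) => p.
(* The multiple of X^3 that the reduction removes has constant coefficient 0. *)
rewrite mk_monic_Xn [in RHS](Pdiv.RingMonic.rdivp_eq (monicXn k 3) p).
by rewrite coefD coefMXn add0r.
Qed.

Definition hcoef0R : {rmorphism kh k -> k} :=
  HB.pack hcoef0 (GRing.isZmodMorphism.Build _ _ hcoef0 hcoef0_zmod)
    (GRing.isMonoidMorphism.Build _ _ hcoef0 hcoef0_monoid).

Lemma hcoef0C x : hcoef0 (qC x) = x.
Proof. by rewrite /hcoef0 qpolyCE coefC. Qed.

Lemma hcoef0_hbar : hcoef0 (hbar k) = 0.
Proof.
(* The image of h in the field k has cube 0, hence is 0. *)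
have E := etrans (esym (rmorphXn hcoef0R 3 (hbar k)))
  (etrans (congr1 hcoef0R (hbar3 k)) (rmorph0 hcoef0R)).
by move/eqP: E; rewrite expf_eq0 => /andP[_ /eqP].
Qed.

Variable (V : vectType k).

Lemma modhD m (u v : TV (kh k) V m) : modh (u + v) = modh u + modh v.
Proof. exact: (tcoefD hcoef0R). Qed.
Lemma modhN m (u : TV (kh k) V m) : modh (- u) = - modh u.
Proof. exact: (tcoefN hcoef0R). Qed.
Lemma modhZ m c (u : TV (kh k) V m) : modh (c *: u) = hcoef0 c *: modh u.
Proof. exact: (tcoefZ hcoef0R). Qed.
Lemma modhM m (u v : TV (kh k) V m) : modh (u * v) = modh u * modh v.
Proof. exact: (tcoefM hcoef0R). Qed.
Lemma modh1 m : modh (1 : TV (kh k) V m) = 1.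
Proof. exact: (tcoefU hcoef0R). Qed.
Lemma modh_hbar m (u : TV (kh k) V m) : modh (hbar k *: u) = 0.
Proof. by rewrite modhZ hcoef0_hbar scale0r. Qed.
Lemma modh_const m (u : TV k V m) : modh (const_h u) = u.
Proof.
apply/malgP => w; apply: etrans (tcoef_coef hcoef0R _ _) _.
exact: etrans (congr1 hcoef0 (tcoef_coef qC u w)) (hcoef0C _).
Qed.
Lemma modh_flip (u : TV (kh k) V 2) : modh (flip u) = flip (modh u).
Proof. exact: (tcoef_tshuffle hcoef0R u (@rev_ordK 2) (@rev_ordK 2)). Qed.
Lemma modh_Alt n (u : TV (kh k) V n) : modh (Alt u) = Alt (modh u).
Proof.
apply: etrans (tcoef_sum hcoef0R _ _) _; apply: eq_bigr => s _.
apply: etrans (tcoefZ hcoef0R _ _) _.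
rewrite rmorphXn rmorphN1; congr (_ *: _).
exact: (tcoef_tshuffle hcoef0R u (permK s) (permKV s)).
Qed.

End Reduction.

Fact Phi2_step (k : fieldType) (W : lmodType k) (x y : k) (E1 E2 : W) :
  2%:R != 0 :> k ->
  - (2%:R^-1 *: (1%:~R *: E1 + (-1)%:~R *: E2))
  = (((-1)%:~R + 0%:~R * x + 0%:~R * y) / 2%:R) *: E1
    + (((1%:~R + 0%:~R * x + 0%:~R * y) / 2%:R) *: E2 + 0).
Proof.
move=> two0; rewrite !mul0r !addr0 scale1r mulN1r mul1r scaleN1r scaleNr.
by rewrite scalerBr opprB addrC.
Qed.

Fact lie_order1 (K : comNzRingType) (B : lalgType K) (h : K) (p q a b : B) :
    (forall c (x y : B), x * (c *: y) = c *: (x * y)) ->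
  lie (p + h *: a) (q + h *: b)
  = lie p q + h *: (lie p b + lie a q + h *: lie a b).
Proof.
move=> sAr.
have lD (x y z : B) : lie x (y + z) = lie x y + lie x z.
  by rewrite /lie mulrDr mulrDl opprD addrACA.
have lD' (x y z : B) : lie (x + y) z = lie x z + lie y z.
  by rewrite /lie mulrDr mulrDl opprD addrACA.
have lZ c (x y : B) : lie x (c *: y) = c *: lie x y.
  by rewrite /lie sAr -scalerAl scalerBr.
have lZ' c (x y : B) : lie (c *: x) y = c *: lie x y.
  by rewrite /lie sAr -scalerAl scalerBr.
rewrite lD !lD' !lZ !lZ' (scalerDr h (lie p b + lie a q)) (scalerDr h (lie p b)).
move: (h *: lie a q) (h *: lie p b) (h *: (h *: lie a b)) (lie p q) => x y z t.
by rewrite -!addrA (addrCA x).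
Qed.

Fact lie_antisym_step (R : pzRingType) (p q a a' b b' : R) :
  lie p a + lie b q - (lie p a' + lie b' q) = lie p (a - a') - lie q (b - b').
Proof.
have E (x y z t : R) : x - y - (z - t) = x + t - (y + z).
  by rewrite opprB addrACA opprD.
have -> : lie p (a - a') = lie p a - lie p a'.
  rewrite /lie mulrBr mulrBl; move: (p * a) (p * a') (a * p) (a' * p) => x y z t.
  by rewrite !E (addrC y).
have -> : lie q (b - b') = lie b' q - lie b q.
  rewrite /lie mulrBr mulrBl; move: (q * b) (q * b') (b * q) (b' * q) => x y z t.
  by rewrite !E (addrC x).
by move: (lie p a) (lie b q) (lie p a') (lie b' q) => x y z t; rewrite opprB opprD addrACA (addrC y).
Qed.

Fact horner_step (K : comNzRingType) (W : lmodType K) (h : K) (x y z : W) :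
  x + h *: y + (h * h) *: z = x + h *: (y + h *: z).
Proof. by rewrite scalerDr scalerA addrA. Qed.

Fact order_step (K : comNzRingType) (W : lmodType K) (h c : K) (x y z t : W) :
  c *: (x + h *: y) + (z + h *: t) = c *: x + z + h *: (c *: y + t).
Proof. by rewrite !scalerDr !scalerA (mulrC c) addrACA. Qed.

Fact sub_order1 (K : comNzRingType) (W : lmodType K) (h : K) (x y z : W) :
  x + h *: y - (x + h *: z) = h *: (y - z).
Proof. by rewrite opprD addrACA subrr add0r scalerBr. Qed.

Fact half_cancel (k : fieldType) (W : lmodType k) (x : W) : 2%:R != 0 :> k ->
  - (2%:R^-1 *: ((-2)%:~R *: x)) = x.
Proof.
move=> two0; rewrite rmorphN /= rmorph_nat scaleNr scalerN opprK scalerA mulVf //.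
by rewrite scale1r.
Qed.

Lemma const_h_lie (k : fieldType) (V : vectType k) m (u v : TV k V m) :
  const_h (lie u v) = lie (const_h u) (const_h v).
Proof. exact: (tcoef_lie (qpolyC 'X^3)). Qed.

Lemma modh_lie (k : fieldType) (V : vectType k) m (u v : TV (kh k) V m) :
  modh (lie u v) = lie (modh u) (modh v).
Proof. exact: (tcoef_lie (hcoef0R k)). Qed.

(** * The deformed structure and its classical limit *)

Section Quantization.
Variables (k : fieldType) (V : vectType k).
Hypothesis char0 : [pchar k] =i pred0.
Variables (d : nat) (ep : 'I_d.+1 -> k) (e : 'I_d.+1 -> V) (alpha beta : k).
Local Notation T := (TV k V 1).
Local Notation F0 := (frame0 ep e).
Local Notation Fh := (frameh char0 ep e alpha beta).
Variables (g : TV k V 2).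
Hypothesis gE : g = \sum_j ep j *: (iotaV (e j) \ot iotaV (e j)).
Variable (Delta : {lrmorphism TV (kh k) V 1 -> TV (kh k) V 2}).
Hypothesis Delta_gen : forall x : V,
  Delta (const_h (iotaV x)) =
    const_h (in1 x + in2 x) + hbar k *: const_h (Delta1 g x)
    + hbar k ^+ 2 *: const_h (Delta2 alpha beta g x).
Local Notation Phi := (1 + hbar k ^+ 2 *: const_h (Phi2 g)).

Lemma DeltaQ y : isV y -> eval Fh 2 [:: y] DeltaP = Delta y.
Proof.
move=> [x ->]; exact: etrans (eval_DeltaP char0 alpha beta gE x) (esym (Delta_gen x)).
Qed.

Lemma Phi2_form : Phi2 g = \sum_(y <- behead (PhiP (-1)))
  cu_coef alpha beta y.1 *: eval1 F0 3 [::] y.2.1 y.2.2.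
Proof.
have two0 : 2%:R != 0 :> k by rewrite ((pcharf0P k).1 char0).
rewrite [RHS]big_cons big_seq1 -[X in _ + X]addr0.
apply: etrans _ (Phi2_step (2%:R * alpha) (2%:R * beta) _ _ two0).
congr (- (_ *: _)); apply: etrans (eval_g12_g13 gE) _.
transitivity (eval F0 3 [::] [:: (cint 1, (2%N, [:: [:: 0%N; 1%N]; [:: 0%N]; [:: 1%N]]));
   (cint (-1), (2%N, [:: [:: 1%N; 0%N]; [:: 0%N]; [:: 1%N]]))]).
  by apply: (@eval_eq _ _ _ _ 0) => //; vm_compute.
by rewrite eval_cons eval_seq1 !cval_int.
Qed.

Lemma eval_PhiP : Phi = eval Fh 3 [::] (PhiP (-1)).
Proof.
apply: etrans _ (esym (eval_cat Fh 3 [::] (fone 3) (behead (PhiP (-1))))).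
rewrite eval_one Phi2_form; congr (_ + _).
by apply: esym; apply: (@eval_cu _ _ char0 _ ep e alpha beta 3 [::]).
Qed.

Lemma quasi_Hopf_deformation : quasi_Hopf Delta (@counit (kh k) k V) Phi.
Proof.
rewrite eval_PhiP.
apply: (@quasi_Hopf_DeltaP _ _ _ Fh (@isV k V)).
- exact: frameh_vec.
- exact: isV_gen.
- by move=> B f f' lf lf' ff y; exact: linear_isV.
- exact: DeltaQ.
Qed.

Lemma modh_Delta_gen x : modh (Delta (const_h (iotaV x))) = prim2 (iotaV x).
Proof.
apply: etrans (congr1 (@modh k V 2) (Delta_gen x)) _.
have E1 (Y : TV k V 2) (Z : TV (kh k) V 2) : modh (const_h Y + hbar k *: Z) = Y.
  apply: etrans (modhD _ _) _.
  apply: etrans (congr2 (fun a b : TV k V 2 => a + b) (modh_const _) (modh_hbar _)) _.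
  exact: addr0.
rewrite expr2; apply: etrans (congr1 (@modh k V 2) (horner_step _ _ _ _)) _.
exact: E1.
Qed.

Lemma modh_Delta u : modh (Delta u) = Delta0 (modh u).
Proof.
elim/tensor_ind: u => [|i u IH|c u v IHu IHv].
- by rewrite rmorph1 !modh1 rmorph1.
- have eg : modh (Delta (gen (kh k) i)) = Delta0 (gen k i).
    have [x ex] : exists x : V, gen k i = iotaV x by exists (vbasis fullv)`_i; rewrite iotaV_basis.
    rewrite -const_h_gen ex modh_Delta_gen Delta0_freeLie //; exact: freeLie_gen.
  apply: etrans (congr1 (@modh k V 2) (rmorphM Delta _ _)) _.
  apply: etrans (modhM _ _) _; apply: etrans _ (congr1 (@Delta0 k k V) (esym (modhM _ _))).
  apply: etrans _ (esym (Delta0M _ _)).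
  rewrite -const_h_gen modh_const const_h_gen.
  exact: (congr2 (fun a b : TV k V 2 => a * b) eg IH).
- apply: etrans (congr1 (@modh k V 2) (linearP Delta c u v)) _.
  apply: etrans (modhD _ _) _.
  apply: etrans _ (congr1 (@Delta0 k k V) (esym (etrans (modhD _ _)
    (congr1 (fun a : T => a + _) (modhZ _ _))))).
  apply: etrans _ (esym (Delta0_linear _ _ _)).
  apply: etrans (congr1 (fun a : TV k V 2 => a + _) (modhZ _ _)) _.
  exact: scaleD_congr IHu IHv.
Qed.

Lemma flip_prim2 (x : T) : flip (prim2 x) = prim2 x.
Proof.
apply: etrans (congr1 (@flip k _) (eval_prim2 ep e x)) _.
apply: etrans (esym (@eval_flip _ _ F0 1 [:: x] prim2P erefl)) (etrans _ (esym (eval_prim2 ep e x))).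
by apply: (@eval_eq _ _ _ _ 1) => //; vm_compute.
Qed.

(** g is symmetric, so flipping [g, x_1] gives [g, x_2]. *)
Lemma Delta1_antisym x : Delta1 g x - flip (Delta1 g x) = PR_delta g (iotaV x).
Proof.
have sz : size [:: iotaV x : T] = 1%N by [].
have e1 := eval_lie sz (eval_metric_at gE sz) (eval_in1 ep e x).
have e2 := etrans (congr1 (@flip k _) e1) (esym (@eval_flip _ _ F0 1 _ _ sz)).
have Vx : in_V (iotaV x : T) by exists x.
apply: etrans (eval_subE e1 e2) (etrans _ (esym (eval_delta gE Vx))).
by apply: (@eval_eq _ _ _ _ 1) => //; vm_compute.
Qed.

Lemma flip_const_h (u : TV k V 2) : flip (const_h u) = const_h (flip u).
Proof. exact: esym (tcoef_tshuffle (qpolyC 'X^3) u (@rev_ordK 2) (@rev_ordK 2)). Qed.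

Fact flip_linear (K : comNzRingType) (M : monomType) : linear (@flip K M).
Proof. exact: mlin_is_linear. Qed.

(** The first-order part E is fixed only up to what h kills, so the claim concerns its class modulo
    h. It passes to brackets because the antisymmetrized class satisfies the same cocycle rule as
    [PR_delta]. *)
Lemma Delta_order1 x : freeLie x -> exists E : TV (kh k) V 2,
  Delta (const_h x) = const_h (prim2 x) + hbar k *: E
  /\ modh E - flip (modh E) = PR_delta g x.
Proof.
have fP := @flip_linear k (word V).
pose fL : {linear TV k V 2 -> TV k V 2} := HB.pack (@flip k (word V))
  (GRing.isLinear.Build _ _ _ _ (@flip k (word V)) fP).
elim=> [v|c u v _ [X [eX fX]] _ [Y [eY fY]]|u v Lu [X [eX fX]] Lv [Y [eY fY]]].
- exists (const_h (Delta1 g v) + hbar k *: const_h (Delta2 alpha beta g v)); split.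
    apply: etrans (Delta_gen v) _; rewrite expr2; exact: horner_step.
  have -> : modh (const_h (Delta1 g v) + hbar k *: const_h (Delta2 alpha beta g v))
      = Delta1 g v.
    apply: etrans (modhD _ _) _.
    apply: etrans (congr2 (fun a b : TV k V 2 => a + b) (modh_const _) (modh_hbar _)) _.
    exact: addr0.
  exact: Delta1_antisym.
- exists (qpolyC 'X^3 c *: X + Y); split.
    apply: etrans (congr1 Delta (const_hP c u v)) _.
    apply: etrans (linearP Delta _ _ _) _.
    apply: etrans (scaleD_congr _ eX eY) _.
    apply: etrans _ (congr1 (fun a => a + _) (esym (etrans (congr1 (@const_h k V 2)
      (prim2_is_linear c u v)) (const_hP _ _ _)))).
    exact: order_step.
  have -> : modh (qpolyC 'X^3 c *: X + Y) = c *: modh X + modh Y.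
    apply: etrans (modhD _ _) (congr1 (fun a : TV k V 2 => a + _) _).
    exact: etrans (modhZ _ _) (congr1 (fun a => a *: _) (hcoef0C c)).
  rewrite fP PR_delta_linear -fX -fY scalerBr opprD; exact: addrACA.
(* The part of the commutator of the two coproducts that is divisible by h, as computed in
   [lie_order1]. *)
exists (lie (const_h (prim2 u)) Y + lie X (const_h (prim2 v)) + hbar k *: lie X Y); split.
  have Dlie a b : Delta (lie a b) = lie (Delta a) (Delta b).
    apply: etrans (linearB Delta _ _) _.
    exact: (congr2 (fun a b : TV (kh k) V 2 => a - b) (rmorphM Delta _ _) (rmorphM Delta _ _)).
  apply: etrans (congr1 Delta (const_h_lie u v)) _.
  apply: etrans (Dlie _ _) _.
  apply: etrans (congr2 (@lie _) eX eY) _.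
  apply: etrans (lie_order1 _ _ _ _ _ (@malg_scalerAr (kh k) _)) _.
  apply: (congr1 (fun a => a + _)).
  exact: etrans (esym (const_h_lie _ _)) (congr1 (@const_h k V 2) (esym (prim2_lie u v))).
have -> : modh (lie (const_h (prim2 u)) Y + lie X (const_h (prim2 v)) + hbar k *: lie X Y)
    = lie (prim2 u) (modh Y) + lie (modh X) (prim2 v).
  apply: etrans (modhD _ _) _.
  apply: etrans (congr2 (fun a b : TV k V 2 => a + b) (modhD _ _) (modh_hbar _)) _.
  apply: etrans (addr0 _) _.
  apply: etrans (congr2 (fun a b : TV k V 2 => a + b) (modh_lie _ _) (modh_lie _ _)) _.
  exact: (congr2 (fun a b : TV k V 2 => lie a (modh Y) + lie (modh X) b)
                 (modh_const _) (modh_const _)).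
have flie a b : flip (lie a b) = lie (flip a) (flip b) :> TV k V 2.
  apply: etrans (linearB fL _ _) _.
  exact: (congr2 (fun a b : TV k V 2 => a - b) (tshuffleM _ _ _) (tshuffleM _ _ _)).
have -> : flip (lie (prim2 u) (modh Y) + lie (modh X) (prim2 v))
    = lie (prim2 u) (flip (modh Y)) + lie (flip (modh X)) (prim2 v).
  apply: etrans (linearD fL _ _) _.
  apply: etrans (congr2 (fun a b : TV k V 2 => a + b) (flie _ _) (flie _ _)) _.
  by rewrite !flip_prim2.
apply: etrans (lie_antisym_step _ _ _ _ _ _) _; rewrite fX fY.
exact: esym (PR_delta_cocycle g Lu Lv).
Qed.

(** All permutations fix 1, and the signs of the six permutations add up to 0. *)
Lemma Alt1 (K : comNzRingType) (M : monomType) (F : frame K M) :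
  Alt (1 : tpow K M 3) = 0.
Proof.
have sz : size ([::] : seq (tpow K M 1)) = 0%N by [].
apply: etrans (eval_AltE sz (eval_oneE F 3 [::])) (etrans _ (@eval_nil _ _ F 3 [::])).
by apply: (@eval_eq _ _ _ _ 0) => //; vm_compute.
Qed.

Lemma Alt_Phi2 : Alt (Phi2 g) = PR_phi g.
Proof.
have two0 : 2%:R != 0 :> k by rewrite ((pcharf0P k).1 char0).
pose A : {linear TV k V 3 -> TV k V 3} := HB.pack (@Alt k (word V) 3)
  (GRing.isLinear.Build _ _ _ _ (@Alt k (word V) 3) (@Alt_linear k (word V) 3)).
have AN c X : Alt (- (c *: X)) = - (c *: Alt X) :> TV k V 3.
  by rewrite -[LHS]/(A _) linearN linearZ.
apply: etrans (AN _ _) _.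
apply: etrans (congr1 (fun a : TV k V 3 => - (_ *: a)) (Alt_g12_g13 gE)) _.
exact: half_cancel.
Qed.

Lemma PR_quantization : quantization_mod_h3 (PR_delta g) (PR_phi g) Delta Phi.
Proof.
split.
- exact: (PR_quasi_Lie_bialgebra char0 gE).
- exact: quasi_Hopf_deformation.
- exact: modh_Delta.
- by exists (const_h (Phi2 g)).
(* The part [prim2 x] is symmetric and drops out, leaving h times the antisymmetrization of E. *)
- move=> x /Delta_order1[E [e1 e2]]; exists (E - flip E); split; last first.
    apply: etrans (modhD _ _) _.
    apply: etrans (congr1 (fun a : TV k V 2 => modh E + a) (modhN _)) _.
    exact: etrans (congr1 (fun a : TV k V 2 => modh E - a) (modh_flip _)) e2.
  have fP := @flip_linear (kh k) (word V).
  apply: etrans (congr2 (fun a b : TV (kh k) V 2 => a - flip b) e1 e1) _.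
  have -> : flip (const_h (prim2 x) + hbar k *: E) = const_h (prim2 x) + hbar k *: flip E.
    apply: etrans (congr1 (@flip _ _) (addrC _ _)) _.
    apply: etrans (fP _ _ _) (etrans (addrC _ _) _).
    apply: (congr1 (fun a => a + _)).
    exact: etrans (flip_const_h _) (congr1 (@const_h k V 2) (flip_prim2 x)).
  exact: sub_order1.
- exists (Alt (const_h (Phi2 g))); split; last first.
    by rewrite modh_Alt modh_const; exact: Alt_Phi2.
  apply: etrans (congr1 (@Alt _ _ 3) (addrC _ _)) _.
  apply: etrans (Alt_linear _ _ _) _.
  apply: etrans (congr1 (fun a : TV (kh k) V 3 => _ + a) (Alt1 Fh)) _.
  exact: addr0.
Qed.

End Quantization.

Theorem theorem2p9 (k : fieldType) (char0 : [pchar k] =i pred0)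
    (V : vectType k) (g : TV k V 2) (g_sign : minkowski_signature g)
    (alpha beta : k)
    (Delta : {lrmorphism TV (kh k) V 1 -> TV (kh k) V 2})
    (Delta_gen : forall x : V,
      Delta (const_h (iotaV x)) =
        const_h (in1 x + in2 x) + hbar k *: const_h (Delta1 g x)
        + hbar k ^+ 2 *: const_h (Delta2 alpha beta g x)) :
  quantization_mod_h3 (PR_delta g) (PR_phi g) Delta
    (1 + hbar k ^+ 2 *: const_h (Phi2 g)).
Proof.
case: g_sign => d [e [_ gE]].
pose ep (j : 'I_d.+1) : k := if j == ord0 then -1 else 1.
apply: (@PR_quantization k V char0 d ep (fun j => tnth e j) alpha beta) => //.
rewrite gE big_ord_recl /ep eqxx scaleN1r; congr (_ + _).
by apply: eq_bigr => j _; rewrite scale1r.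
Qed.
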